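(* Let $\nu,\mu>0$, $T>0$, let $(u,b)$ be a weak solution of the 3D MHD equations on $[0,T]$ that is regular on $(0,T)$, and let $2\le r<6$ (respectively $2\le r\le\infty$ if $b\equiv0$). Let $c_r>0$ be the constant, depending only on $r$, used in the definition of $\Lambda_r$ and $Q_r$. Then there is an absolute constant $\kappa>0$ such that the condition $$\limsup_{q\to\infty}\int_{T/2}^{T}1_{q\le Q_r(t)}\|\Delta_q(\nabla\times u)\|_{L^\infty}\,dt\le c_r$$ is satisfied provided one of the following holds: (1) $\displaystyle\limsup_{q\to\infty}\int_{\mathcal T_q}^T\|\Delta_q(\nabla\times u)\|_{L^\infty}\,dt\le c_r$. (2) $\displaystyle\lim_{\varepsilon\to0}\limsup_{q\to\infty}\int_{T-\varepsilon}^T\|\Delta_q(\nabla\times u)\|_{L^\infty}\,dt\le c_r$. (3) $\displaystyle\int_0^T\sup_{q\le Q_r(t)}\|\Delta_q(\nabla\times u)\|_{L^\infty}\,dt<\infty$. (4) For some $1\le l<\infty$: $\displaystyle\limsup_{q\to\infty}\int_0^T1_{q\le Q_r(t)}\Big(\lambda_q^{-1+\frac2l+\frac3r}\|u_q(t)\|_{L^r}\Big)^l\,dt\le\kappa\, c_r^l\min\{\nu,\mu\}^{l-1}$. (5) For some $1\le l<\infty$: $\displaystyle\limsup_{q\to\infty}\int_{\mathcal T_q}^T\Big(\lambda_q^{-1+\frac2l+\frac3r}\|u_q(t)\|_{L^r}\Big)^l\,dt\le\kappa\, c_r^l\min\{\nu,\mu\}^{l-1}$. (6) For some $1\le l<\infty$: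 $\displaystyle\lim_{\varepsilon\to0}\limsup_{q\to\infty}\int_{T-\varepsilon}^T\Big(\lambda_q^{-1+\frac2l+\frac3r}\|u_q(t)\|_{L^r}\Big)^l\,dt\le\kappa\, c_r^l\min\{\nu,\mu\}^{l-1}$. (7) For some $1\le l<\infty$: $\displaystyle\int_0^T\Big(\|u_{\le Q_r(t)}(t)\|_{B^{-1+\frac2l+\frac3r}_{r,\infty}}\Big)^l\,dt<\infty$. (8) $\displaystyle\limsup_{t\to T-}\|u(t)-u(T)\|_{B^{-1+\frac3r}_{r,\infty}}<\frac{c_r}{2}\min\{\nu,\mu\}$.
   Context: **MHD equations** on $\mathbb R^3$: $u_t+u\cdot\nabla u-b\cdot\nabla b+\nabla p=\nu\Delta u$, $b_t+u\cdot\nabla b-b\cdot\nabla u=\mu\Delta b$, $\nabla\cdot u=\nabla\cdot b=0$, with divergence-free initial data $u_0,b_0\in L^2(\mathbb R^3)$. For $b\equiv0$ these are the Navier–Stokes equations. **Weak solution on $[0,T]$**: a pair of divergence-free $u,b\in C_w([0,T];L^2(\mathbb R^3))\cap L^2(0,T;H^1(\mathbb R^3))$ satisfying, for all $t\in[0,T]$ and all $\phi\in C_0^\infty([0,T]\times\mathbb R^3)$ with $\nabla_x\cdot\phi=0$, $(u(t),\phi(t))-(u_0,\phi(0))=\int_0^t (u,\partial_s\phi)+\nu(u,\Delta\phi)+(u\cdot\nabla\phi,u)-(b\cdot\nabla\phi,b)\,ds$ and $(b(t),\phi(t))-(b_0,\phi(0))=\int_0^t (b,\partial_s\phi)+\mu(b,\Delta\phi)+(u\cdot\nabla\phi,b)-(b\cdot\nabla\phi,u)\,ds$,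 where $(\cdot,\cdot)$ is the $L^2$ inner product. **Regular**: a weak solution is regular on a time interval $\mathcal I$ if $\|u(t)\|_{H^s}$ and $\|b(t)\|_{H^s}$ are continuous on $\mathcal I$ for some $s>\frac12$. **Littlewood–Paley projections**: fix a nonnegative radial $\chi\in C_0^\infty(\mathbb R^3)$ with $\chi=1$ for $|\xi|\le 3/4$ and $\chi=0$ for $|\xi|\ge1$; $\varphi(\xi)=\chi(\xi/2)-\chi(\xi)$; $\lambda_q=2^q$; $\Delta_q$ is the Fourier multiplier with symbol $\varphi(\lambda_q^{-1}\xi)$ for $q\ge0$ and $\chi(\xi)$ for $q=-1$; $u_q=\Delta_q u$, $u_{\le Q}=\sum_{q=-1}^Q u_q$. Besov norm: $\|u\|_{B^s_{p,\infty}}=\sup_{q\ge-1}\lambda_q^s\|u_q\|_{L^p}$. **Dissipation wavenumber**: with $c_r>0$ a constant depending only on $r$, $\Lambda_r(t)=\min\{\lambda_q: q\in\mathbb N,\ \lambda_p^{-1+\frac3r}\|u_p(t)\|_{L^r}<c_r\min\{\nu,\mu\}\ \ \forall p>q\}$ (with $0\in\mathbb N$, $3/\infty=0$), and $Q_r(t)$ is defined by $2^{Q_r(t)}=\Lambda_r(t)$. The same constant $c_r$ appears throughout. $1_{q\le Q_r(t)}$ equals $1$ if $q\le Q_r(t)$ and $0$ otherwise. **Times $\mathcal T_q$**: $\mathcal T_q=\sup\{t\in(T/2,T): Q_r(\tau)<q\ \ \forall\tau\in(T/2,t)\}$ (with value $T/2$ if the set is empty). ''Absolute constant'' means independent of the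 solution, $\nu,\mu,T,l,r$ and $c_r$. *)

(* Defs.v *)
From HB Require Import structures.
From mathcomp Require Import all_boot all_order all_algebra.
From mathcomp Require Import all_classical all_reals all_analysis.
From mathcomp Require Import complex.

Set Implicit Arguments.
Unset Strict Implicit.
Unset Printing Implicit Defensive.

Import Order.TTheory GRing.Theory Num.Theory.
Import numFieldNormedType.Exports.

Local Open Scope classical_set_scope.
Local Open Scope ring_scope.

(* R^3 is R * R * R: the library equips this product with a normed-module
   structure and with product measures (matrices carry no measure).  The measure
   is declared on products of measurableTypeR R, an alias of R with its Borel
   sigma-algebra. *)
Notation R3 R := (R * R * R)%type.

Section euclidean.
Variable R : realType.

Definition mR3 := (measurableTypeR R * measurableTypeR R * measurableTypeR R)%type.

Definition mu3 : {measure set mR3 -> \bar R} :=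
  (@lebesgue_measure R \x @lebesgue_measure R \x @lebesgue_measure R)%E.

Definition vfield := 'I_3 -> R3 R -> R.

Definition crd (x : R3 R) (i : 'I_3) : R := nth 0 [:: x.1.1; x.1.2; x.2] i.

Definition basis_vec (i : 'I_3) : R3 R :=
  ((i == 0 :> nat)%:R, (i == 1 :> nat)%:R, (i == 2 :> nat)%:R).

Definition dot (x y : R3 R) : R := \sum_i crd x i * crd y i.

Definition enorm (x : R3 R) : R := Num.sqrt (dot x x).

Definition vabs (f : vfield) (x : R3 R) : R :=
  Num.sqrt (\sum_i f i x ^+ 2).

Definition vsub (f g : vfield) : vfield := fun i x => f i x - g i x.

Definition measurable3 (f : R3 R -> R) : Prop :=
  measurable_fun (setT : set mR3) (f : mR3 -> R).

Definition vLnorm (p : \bar R) (f : vfield) : \bar R :=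
  Lnorm mu3 p (fun x => (vabs f x)%:E).

Definition L2 (f : vfield) : Prop :=
  (forall i, measurable3 (f i)) /\ (vLnorm 2%:E f < +oo)%E.

Definition inner (f g : vfield) : R := \int[mu3]_x (\sum_i f i x * g i x).

End euclidean.

Section smooth_functions.
Variable R : realType.

(* On a finite-dimensional space, C^oo amounts to the existence and continuity
   of all iterated directional derivatives. *)
Definition smooth (V : normedModType R) (f : V -> R) : Prop :=
  forall vs : seq V,
    let g := foldr (fun v h => 'D_v h) f vs in
    continuous g /\ forall x v, derivable g x v.

Definition compactly_supported (V : normedModType R) (f : V -> R) : Prop :=
  compact (closure [set x | f x != 0]).

Definition div_free (f : vfield R) : Prop :=
  forall psi : R3 R -> R, smooth psi -> compactly_supported psi ->
    \int[@mu3 R]_x (\sum_i f i x * 'D_(basis_vec R i) psi x) = 0.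

(* Space-time test fields are indexed by components.  The class
   C_0^oo([0,T] x R^3) consists of the restrictions to [0,T] x R^3 of smooth
   compactly supported functions on R x R^3, whence the divergence constraint
   on [0,T] only. *)
Definition Dt (f : R * R3 R -> R) : R * R3 R -> R :=
  'D_(1, (0, 0, 0)) f.
Definition Dx (i : 'I_3) (f : R * R3 R -> R) : R * R3 R -> R :=
  'D_(0, basis_vec R i) f.

Definition test_field (T : R) (phi : 'I_3 -> R * R3 R -> R) : Prop :=
  (forall i, smooth (phi i) /\ compactly_supported (phi i)) /\
  (forall t x, 0 <= t <= T -> \sum_i Dx i (phi i) (t, x) = 0).

Definition at_time (phi : 'I_3 -> R * R3 R -> R) (t : R) : vfield R :=
  fun i x => phi i (t, x).

Definition dt_field (phi : 'I_3 -> R * R3 R -> R) :=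
  fun i => Dt (phi i).

Definition lap_field (phi : 'I_3 -> R * R3 R -> R) :=
  fun i y => \sum_j Dx j (Dx j (phi i)) y.

(* (v . grad) phi(t) *)
Definition advect (v : vfield R) (phi : 'I_3 -> R * R3 R -> R) (t : R) :
    vfield R :=
  fun i x => \sum_j v j x * Dx j (phi i) (t, x).

End smooth_functions.

Section fourier.
Variable R : realType.
Local Open Scope complex_scope.

Definition expi (a : R) : R[i] := cos a +i* sin a.

Definition cintegral (D : set (R3 R)) (f : R3 R -> R[i]) : R[i] :=
  (\int[@mu3 R]_(x in D) complex.Re (f x)) +i*
  (\int[@mu3 R]_(x in D) complex.Im (f x)).

Definition trunc_fourier (f : R3 R -> R) (n : nat) (xi : R3 R) : R[i] :=
  cintegral [set x | enorm x <= n%:R] (fun x => (f x)%:C * expi (- dot x xi)).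

(* Fourier-Plancherel transform, normalised as
   int f(x) exp(- i x . xi) dx: the limit in L^2, as n -> oo, of the integrals
   over the balls of radius n. *)
Definition is_fourier (f : R3 R -> R) (F : R3 R -> R[i]) : Prop :=
  [/\ measurable3 (fun xi => complex.Re (F xi)),
      measurable3 (fun xi => complex.Im (F xi)) &
      (fun n => Lnorm (@mu3 R) 2%:E
         (fun xi => (Normc.normc (F xi - trunc_fourier f n xi))%:E))
        @ \oo --> 0%E].

(* Any representative of the transform, which is unique up to a null set. *)
Definition fourier (f : R3 R -> R) : R3 R -> R[i] :=
  xget (fun=> 0) [set F | is_fourier f F].

Definition inv_fourier (F : R3 R -> R[i]) (x : R3 R) : R[i] :=
  (((2 * pi) ^- 3)%:C) * cintegral setT (fun xi => F xi * expi (dot x xi)).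

(* (int (1 + |xi|^2)^s |f^(xi)|^2 dxi)^(1/2), possibly +oo *)
Definition Hs_norm (s : R) (f : vfield R) : \bar R :=
  (poweR (\int[@mu3 R]_xi
     ((1 + enorm xi ^+ 2) `^ s *
        \sum_i Normc.normc (fourier (f i) xi) ^+ 2)%:E) 2^-1)%E.

End fourier.

Section littlewood_paley.
Variable R : realType.
Local Open Scope complex_scope.

Record cutoff (chi : R3 R -> R) : Prop := Cutoff {
  cutoff_smooth : smooth chi;
  cutoff_supp : compactly_supported chi;
  cutoff_ge0 : forall xi, 0 <= chi xi;
  cutoff_radial : forall xi eta, enorm xi = enorm eta -> chi xi = chi eta;
  cutoff_inner : forall xi, enorm xi <= 3 / 4 -> chi xi = 1;
  cutoff_outer : forall xi, 1 <= enorm xi -> chi xi = 0 }.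

Definition lambda (q : int) : R := 2 ^ q.

Variable chi : R3 R -> R.

Definition lp_phi (xi : R3 R) : R := chi (2^-1 *: xi) - chi xi.

(* Dyadic indices range over the integers q >= -1. *)
Definition lp_symbol (q : int) (xi : R3 R) : R :=
  if 0 <= q then lp_phi ((lambda q)^-1 *: xi)
  else if q == -1 then chi xi else 0.

(* The block Delta_q of the distribution with Fourier transform F.  The symbol
   is even and F is the transform of a real distribution, so that the inverse
   transform is real; taking the real part only changes the codomain. *)
Definition lp_block (q : int) (F : R3 R -> R[i]) (x : R3 R) : R :=
  complex.Re (inv_fourier (fun xi => (lp_symbol q xi)%:C * F xi) x).

Definition Delta (q : int) (f : vfield R) : vfield R :=
  fun i => lp_block q (fourier (f i)).

(* The Fourier transform of the distribution curl f is i xi x f^(xi); addition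
   in 'I_3 is modulo 3. *)
Definition curl_hat (f : vfield R) (i : 'I_3) (xi : R3 R) : R[i] :=
  (0 +i* 1) * ((crd xi (i + 1))%:C * fourier (f (i + 2%:R)) xi -
        (crd xi (i + 2%:R))%:C * fourier (f (i + 1)) xi).

Definition Delta_curl (q : int) (f : vfield R) : vfield R :=
  fun i => lp_block q (curl_hat f i).

(* u_{<= Q}; the sum is finite when Q < +oo, and otherwise the whole series. *)
Definition lp_low (Q : \bar R) (f : vfield R) : vfield R := fun i x =>
  limn (fun n => \sum_(0 <= k < n | ((k%:Z - 1)%:~R%:E <= Q)%E)
                   Delta (k%:Z - 1) f i x).

Definition besov (s : R) (p : \bar R) (f : vfield R) : \bar R :=
  ereal_sup [set ((lambda q `^ s)%:E * vLnorm p (Delta q f))%E |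
             q in [set q : int | -1 <= q]].

End littlewood_paley.

Section wavenumber.
Variables (R : realType) (chi : R3 R -> R).

(* 3 / r, with 3 / oo = 0 *)
Definition three_over (r : \bar R) : R := if r is r0%:E then 3 / r0 else 0.

(* Lambda_r for the threshold c_r min(nu, mu) = theta; +oo when no admissible q
   exists. *)
Definition Lambda_r (r : \bar R) (theta : R) (f : vfield R) : \bar R :=
  ereal_inf [set (lambda R q%:Z)%:E | q in [set q : nat |
    forall p : nat, (q < p)%N ->
      ((lambda R p%:Z `^ (-1 + three_over r))%:E * vLnorm r (Delta chi p%:Z f)
         < theta%:E)%E]].

(* log_2 Lambda_r *)
Definition Q_r (r : \bar R) (theta : R) (f : vfield R) : \bar R :=
  (lne (Lambda_r r theta f) * (ln 2)^-1%:E)%E.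

(* 1_{q <= Q} *)
Definition ind_le (q : int) (Q : \bar R) : \bar R := ((q%:~R%:E <= Q)%E%:R)%:E.

(* calT_q, where Q t stands for Q_r(t) *)
Definition time_set (T : R) (Q : R -> \bar R) (q : int) : set R :=
  [set t | T / 2 < t < T /\
           forall tau, T / 2 < tau < t -> (Q tau < q%:~R%:E)%E].

Definition time_T (T : R) (Q : R -> \bar R) (q : int) : R :=
  if `[< time_set T Q q !=set0 >] then sup (time_set T Q q) else T / 2.

End wavenumber.

Section mhd.
Variable R : realType.

Definition in_Cw_L2 (T : R) (u : R -> vfield R) : Prop :=
  (forall t, 0 <= t <= T -> L2 (u t)) /\
  (forall psi, L2 psi ->
     {within `[0, T], continuous (fun t => inner (u t) psi)}).

Definition in_L2_H1 (T : R) (u : R -> vfield R) : Prop :=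
  (\int[@lebesgue_measure R]_(t in `[0%R, T]) poweR (Hs_norm 1 (u t)) 2 < +oo)%E.

Record mhd_weak_solution (nu mu T : R) (u0 b0 : vfield R)
    (u b : R -> vfield R) : Prop := MhdWeakSolution {
  mhd_u0 : L2 u0 /\ div_free u0;
  mhd_b0 : L2 b0 /\ div_free b0;
  mhd_div_u : forall t, 0 <= t <= T -> div_free (u t);
  mhd_div_b : forall t, 0 <= t <= T -> div_free (b t);
  mhd_Cw_u : in_Cw_L2 T u;
  mhd_Cw_b : in_Cw_L2 T b;
  mhd_H1_u : in_L2_H1 T u;
  mhd_H1_b : in_L2_H1 T b;
  mhd_eq_u : forall t phi, 0 <= t <= T -> test_field T phi ->
    inner (u t) (at_time phi t) - inner u0 (at_time phi 0) =
    \int[@lebesgue_measure R]_(s in `[0, t])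
      (inner (u s) (at_time (dt_field phi) s)
       + nu * inner (u s) (at_time (lap_field phi) s)
       + inner (advect (u s) phi s) (u s)
       - inner (advect (b s) phi s) (b s));
  mhd_eq_b : forall t phi, 0 <= t <= T -> test_field T phi ->
    inner (b t) (at_time phi t) - inner b0 (at_time phi 0) =
    \int[@lebesgue_measure R]_(s in `[0, t])
      (inner (b s) (at_time (dt_field phi) s)
       + mu * inner (b s) (at_time (lap_field phi) s)
       + inner (advect (u s) phi s) (b s)
       - inner (advect (b s) phi s) (u s)) }.

(* Finiteness is part of the continuity of the norm. *)
Definition Hs_continuous (s : R) (I : set R) (u : R -> vfield R) : Prop :=
  (forall t, I t -> Hs_norm s (u t) \is a fin_num) /\
  {within I, continuous (fun t => fine (Hs_norm s (u t)))}.

Definition regular_on (I : set R) (u b : R -> vfield R) : Prop :=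
  exists2 s : R, 2^-1 < s & Hs_continuous s I u /\ Hs_continuous s I b.

Definition vanishes (T : R) (b : R -> vfield R) : Prop :=
  forall t, 0 <= t <= T -> forall i, {ae @mu3 R, forall x, b t i x = 0}.

End mhd.

(* Main.v *)
Require Import Defs.
From HB Require Import structures.
From mathcomp Require Import all_boot all_order all_algebra.
From mathcomp Require Import all_classical all_reals all_analysis.
From mathcomp Require Import measurable_realfun ess_sup_inf.
From mathcomp Require Import complex.
From mathcomp Require Import ring lra zify.

Set Implicit Arguments.
Unset Strict Implicit.
Unset Printing Implicit Defensive.

Import Order.TTheory GRing.Theory Num.Theory.
Import numFieldNormedType.Exports.

Local Open Scope classical_set_scope.
Local Open Scope ring_scope.

(* Write x_q = lambda_q^(-1+3/r) |u_q|_r and theta = c_r min(nu, mu).  By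
   definition q <= Q_r holds as soon as x_p >= theta for some p >= q, and, for
   q > 0, only then.  Bernstein's inequality bounds |Delta_q curl u|_oo by a
   multiple of lambda_q^2 x_q <= lambda_q^2 (theta^(1-l) x_q^l + theta).  The
   first term is what (4) controls; for the second, {q <= Q_r} is covered by the
   sets {x_p >= theta}, p >= q, where Chebyshev's inequality gives measures at
   most theta^(-l) lambda_p^(-2) times the integrals in (4), and the sum over p
   is geometric.  Regularity on (0,T) makes x_q small uniformly on compact
   subintervals, so that Q_r is bounded there, and the other conditions reduce
   to (4), or give the conclusion at once, by localisation near T or by
   dominated convergence.

   The Fourier transform is handled through real cosine transforms [cosT].
   Damping by exp(-e(|y_1|+|y_2|+|y_3|)) turns them into convolutions with
   Poisson kernels; this yields Bessel's inequality, hence the transform of an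
   L^2 function, and enough of Parseval's identity.  As Delta_q u(t)(x) is a
   pairing of u(t) with a fixed L^2 function, weak continuity in t makes the
   norms of Delta_q u lower semicontinuous in t, hence measurable. *)

(** * Poisson kernels and cosine transforms *)

(** [fourier] is an arbitrary representative of an L^2 limit, so it has no pointwise formula. By
    [mult_rep] every block of [f] becomes an integral of [f] itself against the cosine transform of
    the symbol, and facts about blocks are read off either from this pairing or from the frequency
    integral [mult].

    Bernstein's inequality does not go through convolution with a Schwartz kernel: [xi_j] is
    expanded as an arcsine series in sines, and each sine is a central difference. The Lipschitz
    bound that results keeps a function comparable to its supremum on a box of side of order 1/L,
    which gives Nikol'skii's inequality. The constants are numerical, free of [chi], [r] and [l].
    The 6 in [kappa] is 2 + 4: an upper limit at most M yields integrals below 2M eventually, and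
    the sum over p doubles this once more.

    In (7) the block of u_(<=Q) at the edge q = Q is not that of u, but two neighbouring blocks
    recover it. In (8) nothing is known about the blocks of u(T), so u(t) is compared with u at an
    earlier, regular time. *)

Section lebesgue3.
Variable R : realType.
Local Notation leb := (@lebesgue_measure R).
Local Notation mR := (measurableTypeR R).

Lemma mu3_box (A B C : set mR) :
  measurable A -> measurable B -> measurable C ->
  mu3 R (A `*` B `*` C) = (leb A * leb B * leb C)%E.
Proof.
move=> mA mB mC.
transitivity (((leb \x leb) (A `*` B)) * leb C)%E.
  exact: (@product_measure1E _ _ _ _ R (leb \x leb)%E leb (A `*` B) C
    (measurableX mA mB) mC).
by rewrite (product_measure1E leb leb mA mB).
Qed.

Lemma sigma_finite_leb2 : sigma_finite setT (leb \x leb)%E.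
Proof.
have /sigma_finiteP[F [TF ndF Foo]] := sigma_finiteT leb.
exists (fun n => F n `*` F n).
  rewrite -setXTT TF predeqE => -[x y]; split.
    move=> [/= [n _ Fn] [k _ Fk]].
    exists (maxn n k) => //; split => /=.
    - by move: x Fn; exact/subsetPset/ndF/leq_maxl.
    - by move: y Fk; exact/subsetPset/ndF/leq_maxr.
  by move=> [n _ []] /= *; split; exists n.
move=> k; have [mF Fy] := Foo k.
split; first exact: measurableX.
have Ff : leb (F k) \is a fin_num by rewrite ge0_fin_numE.
apply: le_lt_trans (_ : (fine (leb (F k)) * fine (leb (F k)))%:E < _)%E; last exact: ltry.
by rewrite EFinM fineK//; rewrite le_eqVlt; apply/orP; left; apply/eqP/(product_measure1E leb leb mF mF).
Qed.

Lemma sigma_finite_mu3 : sigma_finite setT (@mu3 R).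
Proof.
have /sigma_finiteP[F [TF ndF Foo]] := sigma_finiteT leb.
exists (fun n => F n `*` F n `*` F n).
  rewrite -setXTT -setXTT TF predeqE => -[[x y] z]; split.
    move=> [/= [[n _ Fn] [k _ Fk]] [l _ Fl]].
    exists (maxn n (maxn k l)) => //; repeat split => /=.
    - by move: x Fn; exact/subsetPset/ndF/leq_maxl.
    - by move: y Fk; apply/subsetPset/ndF; rewrite (leq_trans (leq_maxl _ l))// leq_maxr.
    - by move: z Fl; apply/subsetPset/ndF; rewrite (leq_trans (leq_maxr k _))// leq_maxr.
  by move=> [n _ [[]]] /= *; repeat split; exists n.
move=> k; have [mF Fy] := Foo k.
split; first by do 2 apply: measurableX => //.
rewrite mu3_box//.
have Ff : leb (F k) \is a fin_num by rewrite ge0_fin_numE.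
by rewrite -(fineK Ff) -!EFinM ltry.
Qed.

(** The same measure as [leb \x leb], repackaged with its sigma-finiteness so that it can be a
    factor in the Fubini and Tonelli theorems. *)
Definition leb2 : {sigma_finite_measure set (mR * mR)%type -> \bar R} :=
  HB.pack_for {sigma_finite_measure set (mR * mR)%type -> \bar R}
    (Measure.sort ((leb \x leb)%E : {measure set (mR * mR)%type -> \bar R}))
    (Measure.class ((leb \x leb)%E : {measure set (mR * mR)%type -> \bar R}))
    (Measure_isSigmaFinite.Build _ _ _
      (Measure.sort ((leb \x leb)%E : {measure set (mR * mR)%type -> \bar R}))
      sigma_finite_leb2).

(** Kernels on [X * X] are integrated with [mu3] in both variables, which requires [mu3] as a
    sigma-finite factor. *)
Definition leb3 : {sigma_finite_measure set (mR3 R) -> \bar R} :=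
  HB.pack_for {sigma_finite_measure set (mR3 R) -> \bar R}
    (Measure.sort (mu3 R)) (Measure.class (mu3 R))
    (Measure_isSigmaFinite.Build _ _ _ (Measure.sort (mu3 R)) sigma_finite_mu3).

Lemma mu3_tonelli (f : mR3 R -> \bar R) : measurable_fun [set: mR3 R] f ->
  (forall x, 0 <= f x)%E ->
  (\int[mu3 R]_x f x = \int[leb]_x \int[leb]_y \int[leb]_z f (x, y, z))%E.
Proof.
move=> mf f0.
transitivity (\int[leb2]_p \int[leb]_z f (p, z))%E.
  exact: (fubini_tonelli1 (m1 := leb2) (m2 := leb) f mf f0).
apply: (fubini_tonelli1 (m1 := leb) (m2 := leb) (fun p => \int[leb]_z f (p, z))%E).
  exact: (measurable_fun_fubini_tonelli_F (m2 := leb) f mf f0).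
by move=> p; apply: integral_ge0 => z _.
Qed.

Lemma mu3_fubini (f : mR3 R -> \bar R) : (mu3 R).-integrable [set: mR3 R] f ->
  (\int[mu3 R]_x f x = \int[leb]_x \int[leb]_y \int[leb]_z f (x, y, z))%E.
Proof.
move=> intf.
transitivity (\int[leb2]_p \int[leb]_z f (p, z))%E.
  exact: (esym (integral12_prod_meas1 (m1 := leb2) (m2 := leb) intf)).
apply: (esym (integral12_prod_meas1 (m1 := leb) (m2 := leb) (f := (fun p => \int[leb]_z f (p, z))%E) _)).
exact: (integrable_fubini_F (m1 := leb2) (m2 := leb) intf).
Qed.

Lemma mu3_prod (f g h : mR -> \bar R) :
  measurable_fun setT f -> measurable_fun setT g -> measurable_fun setT h ->
  (forall x, 0 <= f x)%E -> (forall x, 0 <= g x)%E -> (forall x, 0 <= h x)%E ->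
  (\int[mu3 R]_x (f x.1.1 * g x.1.2 * h x.2) =
   (\int[leb]_x f x) * (\int[leb]_x g x) * (\int[leb]_x h x))%E.
Proof.
move=> mf mg mh f0 g0 h0.
rewrite mu3_tonelli; last 2 first.
  - apply: emeasurable_funM => /=; last exact: measurableT_comp.
    by apply: emeasurable_funM => /=; apply: measurableT_comp => //;
       apply: measurableT_comp.
  - by move=> x; rewrite !mule_ge0.
under eq_integral => x _ do under eq_integral => y _ do
  rewrite /= ge0_integralZl// ?mule_ge0//.
under eq_integral => x _ do under eq_integral => y _ do
  rewrite muleC muleA.
have h1 : (0 <= \int[leb]_z h z)%E by exact: integral_ge0.
have g1 : (0 <= \int[leb]_z g z)%E by exact: integral_ge0.
under eq_integral => x _ do rewrite ge0_integralZl ?mule_ge0//.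
under eq_integral => x _ do rewrite [(_ * f x)%E]muleC muleAC.
rewrite ge0_integralZr//; last first.
  by move=> x _; rewrite mule_ge0.
  by apply: emeasurable_funM.
rewrite ge0_integralZr//.
Qed.

End lebesgue3.

(** * The Poisson kernel in one dimension *)

Section poisson.
Variable R : realType.
Local Notation leb := (@lebesgue_measure R).
Implicit Types e x y z b : R.

(** The Fourier transform of exp(-e|y|), that is, 2 pi times the Poisson kernel of the half-plane at
    height [e]. *)
Definition pk e x : R := 2 * e / (e ^+ 2 + x ^+ 2).

Lemma pk_ge0 e x : 0 < e -> 0 <= pk e x.
Proof. by move=> e0; rewrite divr_ge0 ?addr_ge0 ?sqr_ge0// mulr_ge0 ?(ltW e0). Qed.

Lemma pkN e x : pk e (- x) = pk e x. Proof. by rewrite /pk sqrrN. Qed.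

Lemma continuous_pk e : 0 < e -> continuous (pk e).
Proof.
move=> e0 x; apply: cvgM; first exact: cvg_cst.
apply: cvgV; first by rewrite gt_eqF// ltr_wpDr ?sqr_ge0 ?exprn_gt0.
apply: cvgD; first exact: cvg_cst.
exact: exprn_continuous.
Qed.

Lemma is_derive_atan_pk e c x : 0 < e ->
  is_derive x (1 : R) (fun y => 2 * atan ((y - c) / e)) (pk e (x - c)).
Proof.
move=> e0.
have e_neq0 : e != 0 by rewrite gt_eqF.
have H1 : is_derive x (1 : R) (fun y => (y - c) / e) (e^-1).
  apply: is_derive_eq.
  by rewrite /= scaler0 add0r oppr0 addr0 -[_ *: _]/(_ * _) mulr1.
have H2 : is_derive ((x - c) / e) (1 : R) atan (1 + ((x - c) / e) ^+ 2)^-1.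
  exact: is_derive1_atan.
have H3 := @is_derive1_comp _ atan (fun y => (y - c) / e) x _ _ H2 H1.
have H4 := is_deriveZ 2 H3.
apply: (is_derive_eq H4).
rewrite /pk -[_ *: _]/(_ * _).
have ? : e ^+ 2 + (x - c) ^+ 2 != 0.
  by rewrite gt_eqF// ltr_wpDr ?sqr_ge0 ?exprn_gt0.
field.
by apply/andP.
Qed.

Lemma integral_pk_itv e c d : 0 < e -> 0 < d ->
  (\int[leb]_(x in `[(c - d)%R, (c + d)%R]) (pk e (x - c))%:E =
   (4 * atan (d / e))%:E)%E.
Proof.
move=> e0 d0.
have cF y : {for y, continuous (fun y : R => 2 * atan ((y - c) / e))}.
  apply/differentiable_continuous/derivable1_diffP.
  by case: (is_derive_atan_pk c y e0).
rewrite (@continuous_FTC2 _ _ (fun y => 2 * atan ((y - c) / e))).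
- rewrite -EFinB; congr EFin.
  have -> : c + d - c = d by ring.
  have -> : c - d - c = - d by ring.
  by rewrite mulNr atanN; ring.
- by lra.
- apply: continuous_subspaceT => x.
  apply: (@continuous_comp _ _ _ (fun x => x - c) (pk e)); last exact: continuous_pk.
  by apply: cvgB; [exact: cvg_id|exact: cvg_cst].
- split.
  + by move=> x _; case: (is_derive_atan_pk c x e0).
  + exact/cvg_at_right_filter/cF.
  + exact/cvg_at_left_filter/cF.
- by move=> x _; rewrite derive1E; have [_ ->] := is_derive_atan_pk c x e0.
Qed.

Lemma integral_pk e c : 0 < e ->
  (\int[leb]_x (pk e (x - c))%:E = (2 * pi)%:E)%E.
Proof.
move=> e0.
have mpk (D : set R) : measurable_fun D (fun x => (pk e (x - c))%:E).
  apply/measurable_EFinP/measurable_funTS/(measurableT_comp (f := pk e)).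
    by apply: continuous_measurable_fun; exact: continuous_pk.
  by apply: measurable_funB.
have := @ge0_nondecreasing_set_cvg_integral _ (measurableTypeR R) R
  (fun n : nat => `[(c - n%:R)%R, (c + n%:R)%R]%classic) (fun x => (pk e (x - c))%:E) leb _ _ _ _.
have -> : \bigcup_i `[(c - i%:R)%R, (c + i%:R)%R]%classic = [set: R].
  rewrite -subTset => x _ /=; exists (Num.truncn `|x - c|).+1 => //=.
  have := truncnS_gt `|x - c|; rewrite in_itv/= ltr_norml => /andP[? ?].
  by apply/andP; split; lra.
move=> H.
have {H} : (\int[leb]_(x in `[(c - i%:R)%R, (c + i%:R)%R]) (pk e (x - c))%:E)%E @[i --> \oo]
    --> (\int[leb]_x (pk e (x - c))%:E)%E.
  apply: H => //.
  - by move=> i j ij; apply/subsetPset => x; rewrite /= !in_itv /= => /andP[? ?];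
      have : i%:R <= j%:R :> R by [rewrite ler_nat]; move=> ?; apply/andP; split; lra.
  - by move=> i; exact: mpk.
  - by move=> i x ?; rewrite lee_fin pk_ge0.
move=> {}H; rewrite -(cvg_lim _ H)//; apply/cvg_lim => //.
rewrite -cvg_shiftS /=.
under eq_fun do rewrite integral_pk_itv//.
apply: cvg_EFin; first by near=> n.
have -> : 2 * pi = 4 * (pi / 2) :> R by field.
apply: cvgM; first exact: cvg_cst.
apply: (@cvg_comp _ _ _ (fun n : nat => n.+1%:R : R) (fun y : R => atan (y / e)) _ +oo).
  by rewrite (cvg_shiftS (fun n : nat => n%:R : R)); exact: cvgr_idn.
apply: cvg_comp (@cvgy_atan R).
by apply: (gt0_cvgMly (f := id)) => //; rewrite invr_gt0.
Unshelve. all: by end_near. Qed.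

(** The summand 1 in the derivative keeps the integrand nonnegative, so that the fundamental theorem
    of calculus for nonnegative functions on a half-line applies; it is subtracted again in
    [integral_exp_cos]. *)
Lemma is_derive_expcos e x b y : 0 < e ->
  is_derive y (1 : R) (fun y => expR (- e * y) *
     ((e ^+ 2 + x ^+ 2)^-1 * (x * sin (y * x + b) - e * cos (y * x + b)) - e^-1))
   (expR (- e * y) * (1 + cos (y * x + b))).
Proof.
move=> e0.
have e_neq0 : e != 0 by rewrite gt_eqF.
have D0 : e ^+ 2 + x ^+ 2 != 0.
  by rewrite gt_eqF// ltr_wpDr ?sqr_ge0 ?exprn_gt0.
have H1 : is_derive y (1 : R) (fun y => expR (- e * y)) (- e * expR (- e * y)).
  have h1 : is_derive y (1 : R) (fun y => - e * y) (- e).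
    by apply: is_derive_eq; rewrite -[LHS]/(_ * _) mulr1.
  have h2 := @is_derive1_comp _ expR _ y _ _ (is_derive_expR _) h1.
  by apply: (is_derive_eq h2); rewrite mulrC.
have h1 : is_derive y (1 : R) (fun y => y * x + b) x.
  apply: is_derive_eq.
  by rewrite scaler0 add0r addr0 -[LHS]/(_ * _) mulr1.
have h2 := @is_derive1_comp _ sin _ y _ _ (is_derive_sin _) h1.
have h3 := @is_derive1_comp _ cos _ y _ _ (is_derive_cos _) h1.
have h4 := is_deriveB (is_deriveZ x h2) (is_deriveZ e h3).
have h5 := is_deriveZ (e ^+ 2 + x ^+ 2)^-1 h4.
have h6 := is_deriveB h5 (is_derive_cst e^-1 y 1).
have h7 := is_deriveM H1 h6.
apply: (is_derive_eq h7).
set D := e ^+ 2 + x ^+ 2; set E := expR _; set S := sin _; set C := cos _.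
transitivity (E * (D^-1 * (x * (C * x) - e * (- S * x))) +
  (D^-1 * (x * S - e * C) - e^-1) * (- e * E)); first by rewrite subr0.
rewrite /D; field.
by apply/andP.
Qed.

Lemma cvg_expcos e x b : 0 < e ->
  (fun y => expR (- e * y) * ((e ^+ 2 + x ^+ 2)^-1 *
     (x * sin (y * x + b) - e * cos (y * x + b)) - e^-1)) y @[y --> +oo] --> (0 : R).
Proof.
move=> e0.
have D0 : 0 < e ^+ 2 + x ^+ 2 by rewrite ltr_wpDr ?sqr_ge0 ?exprn_gt0.
pose K := (e ^+ 2 + x ^+ 2)^-1 * (`|x| + e) + e^-1.
have cE : expR (- e * y) @[y --> +oo] --> (0 : R).
  rewrite (_ : (fun y => _) = (fun y => expR (- y)) \o (fun y => e * y)); last first.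
    by apply/funext => y /=; rewrite mulNr.
  apply: cvg_comp (@cvgr_expR R).
  exact: (gt0_cvgMry (f := id)).
apply: (@squeeze_cvgr _ _ _ _ (fun y => - (expR (- e * y) * K)) (fun y => expR (- e * y) * K)).
- apply: nearW => y; rewrite -ler_norml normrM ger0_norm ?expR_ge0//.
  rewrite ler_wpM2l ?expR_ge0// (le_trans (ler_normB _ _))// /K.
  rewrite (@ger0_norm _ e^-1) ?invr_ge0 ?(ltW e0)// lerD2r.
  rewrite normrM ger0_norm ?invr_ge0 ?(ltW D0)// ler_wpM2l ?invr_ge0 ?(ltW D0)//.
  rewrite (le_trans (ler_normB _ _))// !normrM (@ger0_norm _ e) ?(ltW e0)//.
  by rewrite lerD// ler_piMr ?sin_max ?cos_max ?(ltW e0).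
- by rewrite -oppr0 -(mul0r K); apply: cvgN; apply: cvgM => //; exact: cvg_cst.
- by rewrite -(mul0r K); apply: cvgM => //; exact: cvg_cst.
Qed.

Lemma continuous_expcos e x b :
  continuous (fun y => expR (- e * y) * (1 + cos (y * x + b))).
Proof.
move=> y; apply: cvgM.
  apply: continuous_comp; last exact: continuous_expR.
  by apply: cvgM; [exact: cvg_cst|exact: cvg_id].
apply: cvgD; first exact: cvg_cst.
apply: continuous_comp; last exact: continuous_cos.
by apply: cvgD; [apply: cvgM; [exact: cvg_id|exact: cvg_cst]|exact: cvg_cst].
Qed.

Lemma integral_expcos e x b : 0 < e ->
  (\int[leb]_(y in `[0%R, +oo[) (expR (- e * y) * (1 + cos (y * x + b)))%:E =
  (e^-1 + ((e ^+ 2 + x ^+ 2)^-1 * (e * cos b - x * sin b)))%:E)%E.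
Proof.
move=> e0.
have dF y := is_derive_expcos x b y e0.
pose F y := expR (- e * y) * ((e ^+ 2 + x ^+ 2)^-1 *
     (x * sin (y * x + b) - e * cos (y * x + b)) - e^-1).
have cF y : {for y, continuous F}.
  apply/differentiable_continuous/derivable1_diffP.
  by case: (dF y).
rewrite (ge0_continuous_FTC2y _ _ (cvg_expcos x b e0)).
- by rewrite -EFinB; congr EFin; rewrite !mulr0 !mul0r !add0r expR0; ring.
- by move=> y _; rewrite mulr_ge0 ?expR_ge0// -lerBlDl sub0r cos_geN1.
- by apply: continuous_subspaceT => y; exact: continuous_expcos.
- by move=> y _; case: (dF y).
- exact/cvg_at_right_filter/cF.
- by move=> y _; rewrite derive1E; have [_ ->] := dF y.
Qed.

(** Reflection turns the negative half-line into the positive one with [x] replaced by [- x]; the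
    sine terms of the two halves cancel and the cosine terms add up to the Poisson kernel. *)
Lemma integral_abs_expcos e x b : 0 < e ->
  (\int[leb]_y (expR (- e * `|y|) * (1 + cos (y * x + b)))%:E =
   (2 / e + cos b * pk e x)%:E)%E.
Proof.
move=> e0.
pose f y := expR (- e * `|y|) * (1 + cos (y * x + b)).
have cf : continuous f.
  move=> y; apply: cvgM.
    apply: continuous_comp; last exact: continuous_expR.
    by apply: cvgM; [exact: cvg_cst|apply: cvg_norm; exact: cvg_id].
  apply: cvgD; first exact: cvg_cst.
  apply: continuous_comp; last exact: continuous_cos.
  by apply: cvgD; [apply: cvgM; [exact: cvg_id|exact: cvg_cst]|exact: cvg_cst].
have mf (D : set R) : measurable_fun D (fun y => (f y)%:E).
  apply/measurable_EFinP/measurable_funTS.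
  exact: continuous_measurable_fun.
have f0 y : 0 <= f y.
  by rewrite mulr_ge0 ?expR_ge0// -lerBlDl sub0r cos_geN1.
have -> : [set: R] = `]-oo, 0%R[ `|` `[0%R, +oo[.
  by rewrite -setCitvr setUC setUv.
rewrite (@ge0_integral_setU _ (measurableTypeR R))//=; last 2 first.
- exact: mf.
- by apply/disj_setPS => y [/=]; rewrite !in_itv/= andbT ltNge => /negbTE ->.
rewrite integral_itv_bndo_bndc; last exact: mf.
rewrite -/f; have -> : (\int[leb]_(y in `]-oo, 0%R]) (f y)%:E =
   \int[leb]_(y in `[0%R, +oo[) (f (- y))%:E)%E.
  rewrite (@ge0_integration_by_substitution0 _ (fun y => (f (- y))%:E)).
  - by apply: eq_integral => y _; rewrite opprK.
  - apply/measurable_EFinP; apply: continuous_measurable_fun => y.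
    by apply: continuous_comp; [exact: opp_continuous|exact: cf].
  - by move=> y; rewrite lee_fin f0.
have -> : (\int[leb]_(y in `[0%R, +oo[) (f (- y))%:E =
    (e^-1 + ((e ^+ 2 + x ^+ 2)^-1 * (e * cos b + x * sin b)))%:E)%E.
  have := integral_expcos (- x) b e0; rewrite sqrrN mulNr opprK => <-.
  apply: eq_integral => y /set_mem /=; rewrite in_itv/= andbT => y0.
  by rewrite /f normrN ger0_norm// mulrN -mulNr.
have -> : (\int[leb]_(y in `[0%R, +oo[) (f y)%:E =
    (e^-1 + ((e ^+ 2 + x ^+ 2)^-1 * (e * cos b - x * sin b)))%:E)%E.
  rewrite -(integral_expcos x b e0).
  apply: eq_integral => y /set_mem /=; rewrite in_itv/= andbT => y0.
  by rewrite /f ger0_norm.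
rewrite -EFinD; congr EFin; rewrite /pk.
have ? : e ^+ 2 + x ^+ 2 != 0 by rewrite gt_eqF// ltr_wpDr ?sqr_ge0 ?exprn_gt0.
have ? : e != 0 by rewrite gt_eqF.
by field; apply/andP.
Qed.

Lemma integral_exp e : 0 < e -> (\int[leb]_y (expR (- e * `|y|))%:E = (2 / e)%:E)%E.
Proof.
(* At [x = 0] and [b = pi / 2] the cosine vanishes identically and only the damping factor
   remains. *)
move=> e0; have := integral_abs_expcos 0 (pi / 2) e0.
rewrite cos_pihalf mul0r addr0 => <-.
by apply: eq_integral => y _; rewrite mulr0 add0r cos_pihalf addr0 mulr1.
Qed.

Lemma measurable_exp_abs e : measurable_fun [set: measurableTypeR R] (fun y => expR (- e * `|y|)).
Proof.
apply: continuous_measurable_fun => y.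
apply: continuous_comp; last exact: continuous_expR.
by apply: cvgM; [exact: cvg_cst|apply: cvg_norm; exact: cvg_id].
Qed.

Lemma integrable_exp e : 0 < e ->
  leb.-integrable setT (fun y => (expR (- e * `|y|))%:E).
Proof.
move=> e0; apply/integrableP; split.
  by apply/measurable_EFinP; exact: measurable_exp_abs.
under eq_integral do rewrite gee0_abs ?lee_fin ?expR_ge0//.
by rewrite integral_exp// ltry.
Qed.

Lemma integral_exp_cos e x b : 0 < e ->
  (\int[leb]_y (expR (- e * `|y|) * cos (y * x + b))%:E =
   (cos b * pk e x)%:E)%E.
Proof.
move=> e0.
have i1 := integrable_exp e0.
have i2 : leb.-integrable setT (fun y => (expR (- e * `|y|) * cos (y * x + b))%:E).
  apply: (le_integrable _ _ _ i1) => //.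
    apply/measurable_EFinP/measurable_funM; first exact: measurable_exp_abs.
    apply: (measurableT_comp (f := cos)).
      by apply: continuous_measurable_fun; exact: continuous_cos.
    by apply: measurable_funD => //; exact: measurable_funM.
  move=> y _ /=; rewrite lee_fin normrM [leRHS]ger0_norm ?expR_ge0//.
  by rewrite ger0_norm ?expR_ge0// ler_piMr ?expR_ge0 ?cos_max.
have := integral_abs_expcos x b e0.
under eq_integral do rewrite mulrDr mulr1 EFinD.
rewrite integralD// integral_exp//.
have f2 := integrable_fin_num measurableT i2.
by rewrite -(fineK f2) -EFinD => -[] /addrI ->.
Qed.

End poisson.

(** * Product kernels on R^3 *)

Section poisson3.
Variable R : realType.
Local Notation leb := (@lebesgue_measure R).
Local Notation mR := (measurableTypeR R).
Local Notation X := (mR * mR * mR)%type.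
Local Notation mu := (@mu3 R).
Implicit Types (e b a d : R) (x : X).

Lemma dotE (x y : R3 R) : dot x y = x.1.1 * y.1.1 + x.1.2 * y.1.2 + x.2 * y.2.
Proof. by rewrite /dot !big_ord_recr big_ord0 /= add0r. Qed.

Lemma dotC (x y : R3 R) : dot x y = dot y x.
Proof. by rewrite !dotE; ring. Qed.

(** A product weight rather than a radial one: its transform is a product of [pk], so that every
    integral splits into one-dimensional ones. It tends to 1 as [e] tends to 0. *)
Definition exp3 e (y : X) := expR (- e * `|y.1.1|) * expR (- e * `|y.1.2|) * expR (- e * `|y.2|).

Definition pk3 e x (y : X) := pk e (x.1.1 - y.1.1) * pk e (x.1.2 - y.1.2) * pk e (x.2 - y.2).

Lemma exp3_ge0 e y : 0 <= exp3 e y.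
Proof. by rewrite !mulr_ge0 ?expR_ge0. Qed.

Lemma pk3_ge0 e x y : 0 < e -> 0 <= pk3 e x y.
Proof. by move=> e0; apply: mulr_ge0; [apply: mulr_ge0|]; exact: pk_ge0. Qed.

Lemma measurable_fst3 : measurable_fun setT (fun x : X => x.1.1 : R).
Proof. by apply: (@measurableT_comp _ _ _ X (mR * mR)%type mR fst _ fst). Qed.

Lemma measurable_snd3 : measurable_fun setT (fun x : X => x.1.2 : R).
Proof. by apply: (@measurableT_comp _ _ _ X (mR * mR)%type mR snd _ fst). Qed.

Lemma measurable_thd3 : measurable_fun setT (fun x : X => x.2 : R).
Proof. exact: measurable_snd. Qed.

Lemma measurable_exp3 e : measurable_fun setT (exp3 e).
Proof.
apply: measurable_funM; first apply: measurable_funM.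
- exact: (measurableT_comp (measurable_exp_abs e) measurable_fst3).
- exact: (measurableT_comp (measurable_exp_abs e) measurable_snd3).
- exact: (measurableT_comp (measurable_exp_abs e) measurable_thd3).
Qed.

Lemma measurable_pk e : 0 < e -> measurable_fun [set: mR] (pk e).
Proof. by move=> e0; apply: continuous_measurable_fun; exact: continuous_pk. Qed.

Lemma measurable_dot (d' : measure_display) (T : measurableType d') (f g : T -> X) :
  measurable_fun setT f -> measurable_fun setT g ->
  measurable_fun setT (fun t => dot (f t) (g t)).
Proof.
move=> mf mg; under eq_fun do rewrite dotE.
have m1 (h : T -> X) : measurable_fun setT h -> measurable_fun setT (fun t => (h t).1.1 : R).
  exact: (measurableT_comp measurable_fst3).
have m2 (h : T -> X) : measurable_fun setT h -> measurable_fun setT (fun t => (h t).1.2 : R).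
  exact: (measurableT_comp measurable_snd3).
have m3 (h : T -> X) : measurable_fun setT h -> measurable_fun setT (fun t => (h t).2 : R).
  exact: (measurableT_comp measurable_thd3).
by apply: measurable_funD; first apply: measurable_funD; apply: measurable_funM; auto.
Qed.

Lemma integral_exp3 e : 0 < e -> (\int[mu]_y (exp3 e y)%:E = ((2 / e) ^+ 3)%:E)%E.
Proof.
move=> e0.
under eq_integral do rewrite !EFinM.
have me : measurable_fun [set: mR] (fun y => (expR (- e * `|y|))%:E).
  by apply/measurable_EFinP; exact: measurable_exp_abs.
have p0 (y : mR) : (0 <= (expR (- e * `|y|))%:E)%E by rewrite lee_fin expR_ge0.
by rewrite (mu3_prod me me me p0 p0 p0) integral_exp// -!EFinM; congr EFin; ring.
Qed.

Lemma integrable_exp3 e : 0 < e -> mu.-integrable setT (EFin \o exp3 e).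
Proof.
move=> e0; apply/integrableP; split.
  by apply/measurable_EFinP; exact: measurable_exp3.
under eq_integral do rewrite gee0_abs ?lee_fin ?exp3_ge0//.
by rewrite integral_exp3// ltry.
Qed.

Lemma measurable_cos_dot (d' : measure_display) (T : measurableType d') (f g : T -> X) (a : T -> R) :
  measurable_fun setT f -> measurable_fun setT g -> measurable_fun setT a ->
  measurable_fun setT (fun t => cos (dot (f t) (g t) + a t)).
Proof.
move=> mf mg ma; apply: (measurableT_comp (f := @cos R)).
  by apply: continuous_measurable_fun; exact: continuous_cos.
by apply: measurable_funD => //; exact: measurable_dot.
Qed.

(** The one-dimensional formula allows any phase, so the coordinates are integrated one at a time,
    those still pending being part of the phase. *)
Lemma integral_exp3_cos e x b : 0 < e ->
  (\int[mu]_y (exp3 e y * cos (dot y x + b))%:E =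
   (cos b * (pk e x.1.1 * pk e x.1.2 * pk e x.2))%:E)%E.
Proof.
move=> e0.
rewrite mu3_fubini; last first.
  apply: (le_integrable _ _ _ (integrable_exp3 e0)) => //.
    apply/measurable_EFinP/measurable_funM; first exact: measurable_exp3.
    by apply: measurable_cos_dot.
  move=> y _ /=; rewrite lee_fin normrM [leRHS]ger0_norm ?exp3_ge0//.
  by rewrite ger0_norm ?exp3_ge0// ler_piMr ?exp3_ge0 ?cos_max.
have H (k f : R) t : (\int[leb]_y (k * (expR (- e * `|y|) * cos (y * t + f)))%:E = (k * (cos f * pk e t))%:E)%E.
  under eq_integral do rewrite EFinM.
  rewrite integralZl//; first by rewrite integral_exp_cos.
  apply: (le_integrable _ _ _ (integrable_exp e0)) => //.
    apply/measurable_EFinP/measurable_funM; first exact: measurable_exp_abs.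
    apply: (measurableT_comp (f := cos)).
      by apply: continuous_measurable_fun; exact: continuous_cos.
    by apply: measurable_funD => //; exact: measurable_funM.
  move=> y _ /=; rewrite lee_fin normrM [leRHS]ger0_norm ?expR_ge0//.
  by rewrite ger0_norm ?expR_ge0// ler_piMr ?expR_ge0 ?cos_max.
transitivity (\int[leb]_y1 \int[leb]_y2 ((expR (- e * `|y1|) * pk e x.2) * (expR (- e * `|y2|) *
   cos (y2 * x.1.2 + (y1 * x.1.1 + b))))%:E)%E.
  apply: eq_integral => y1 _; apply: eq_integral => y2 _.
  transitivity (\int[leb]_y3 ((expR (- e * `|y1|) * expR (- e * `|y2|)) * (expR (- e * `|y3|) *
   cos (y3 * x.2 + (y1 * x.1.1 + y2 * x.1.2 + b))))%:E)%E.
    apply: eq_integral => y3 _; congr EFin; rewrite /exp3 dotE/= -mulrA; congr (_ * (_ * cos _)).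
    ring.
  rewrite H; congr EFin.
  have -> : y1 * x.1.1 + y2 * x.1.2 + b = y2 * x.1.2 + (y1 * x.1.1 + b) by ring.
  ring.
transitivity (\int[leb]_y1 (pk e x.2 * pk e x.1.2 * (expR (- e * `|y1|) * cos (y1 * x.1.1 + b)))%:E)%E.
  by apply: eq_integral => y1 _; rewrite H; congr EFin; ring.
by rewrite H; congr EFin; ring.
Qed.

Lemma integral_pk3 e x : 0 < e -> (\int[mu]_y (pk3 e y x)%:E = ((2 * pi) ^+ 3)%:E)%E.
Proof.
move=> e0.
under eq_integral do rewrite !EFinM.
have me c : measurable_fun [set: mR] (fun y => (pk e (y - c))%:E).
  apply/measurable_EFinP; apply: (measurableT_comp (measurable_pk e0)).
  exact: measurable_funB.
have p0 c (y : mR) : (0 <= (pk e (y - c))%:E)%E by rewrite lee_fin pk_ge0.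
by rewrite (mu3_prod (me _) (me _) (me _) (p0 _) (p0 _) (p0 _)) !integral_pk// -!EFinM; congr EFin; ring.
Qed.

Definition box3 x d : set X :=
  `[x.1.1 - d, x.1.1 + d] `*` `[x.1.2 - d, x.1.2 + d] `*` `[x.2 - d, x.2 + d].

Lemma measurable_box3 x d : measurable (box3 x d).
Proof. by apply: measurableX => //; exact: measurableX. Qed.

Lemma mu3_box3 x d : 0 <= d -> mu (box3 x d) = ((2 * d) ^+ 3)%:E.
Proof.
move=> d0; rewrite mu3_box// !lebesgue_measure_itv/= !lte_fin.
have E (t : R) : (if (t - d < t + d)%R then (t + d)%:E - (t - d)%:E else 0)%E = (2 * d)%:E.
  case: ifPn => h; first by rewrite -EFinB; congr EFin; ring.
  by congr EFin; lra.
by rewrite !E -!EFinM; congr EFin; ring.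
Qed.

(** For fixed [d] this tends to the total mass (2 pi)^3 as [e] tends to 0, which makes [pk3] an
    approximate identity. *)
Lemma integral_pk3_box e x d : 0 < e -> 0 < d ->
  (\int[mu]_(y in box3 x d) (pk3 e y x)%:E = ((4 * atan (d / e)) ^+ 3)%:E)%E.
Proof.
move=> e0 d0; rewrite integral_mkcond.
pose f (t : R) (y : mR) := ((fun y => (pk e (y - t))%:E) \_ `[t - d, t + d]) y.
transitivity (\int[mu]_y (f x.1.1 y.1.1 * f x.1.2 y.1.2 * f x.2 y.2))%E.
  apply: eq_integral => y _; rewrite /f !patchE /box3 /=.
  rewrite !in_setX; do 3 (case: (_ \in _) => /=; rewrite ?mule0 ?mul0e//).
have mf t : measurable_fun setT (f t).
  apply/(measurable_restrictT _ _).1 => //; apply: measurable_funTS.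
  apply/measurable_EFinP; apply: (measurableT_comp (measurable_pk e0)).
  exact: measurable_funB.
have f0 t y : (0 <= f t y)%E by rewrite /f patchE; case: ifP => // _; rewrite lee_fin pk_ge0.
have If t : (\int[leb]_y f t y = (4 * atan (d / e))%:E)%E.
  by rewrite -(integral_pk_itv t e0 d0) [RHS]integral_mkcond.
by rewrite mu3_prod// !If -!EFinM; congr EFin; ring.
Qed.

End poisson3.

Section integration.
Context {d : measure_display} {T : measurableType d} {R : realType}.
Variable mu : {measure set T -> \bar R}.

Lemma integrableM_bounded (D : set T) (f h : T -> R) (C : R) : measurable D ->
  mu.-integrable D (EFin \o f) -> measurable_fun D h ->
  (forall x, D x -> `|h x| <= C) ->
  mu.-integrable D (EFin \o (fun x => f x * h x)).
Proof.
move=> mD intf mh hC.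
have mf : measurable_fun D f by apply/measurable_EFinP; exact: measurable_int intf.
apply: (le_integrable _ _ _ (integrableZl mD C intf)) => //.
  by apply/measurable_EFinP; exact: measurable_funM.
move=> x Dx /=; rewrite lee_fin normrM [leRHS]normrM mulrC ler_wpM2r//.
by rewrite (le_trans (hC x Dx))// ler_norm.
Qed.

Lemma fatou_le (D : set T) (f_ : (T -> \bar R)^nat) (f : T -> \bar R) (M : \bar R) :
  measurable D -> (forall n, measurable_fun D (f_ n)) ->
  (forall n x, D x -> 0 <= f_ n x)%E ->
  (forall x, D x -> f_ ^~ x @ \oo --> f x) ->
  (forall n, \int[mu]_(x in D) f_ n x <= M)%E ->
  (\int[mu]_(x in D) f x <= M)%E.
Proof.
move=> mD mf f0 ff fM.
rewrite [leLHS](_ : _ = \int[mu]_(x in D) limn_einf (f_ ^~ x))%E; last first.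
  apply: eq_integral => x /set_mem Dx.
  by rewrite is_cvg_limn_einfE; [exact/esym/cvg_lim/ff|apply/cvg_ex; eexists; exact: ff].
apply: (le_trans (fatou mu mD mf f0)).
rewrite limn_einf_lim; apply: lime_le; first exact: is_cvg_einfs.
by apply: nearW => n; apply: ereal_inf_le; exists (\int[mu]_(x in D) f_ n x)%E => //; exists n => /=.
Qed.

End integration.

(** * Cosine transforms and Bessel's inequality *)

Section bessel.
Variable R : realType.
Local Notation leb := (@lebesgue_measure R).
Local Notation mR := (measurableTypeR R).
Local Notation X := (mR * mR * mR)%type.
Local Notation mu := (@mu3 R).
Implicit Types (e b : R) (x : X).

Lemma integrable_pair (f g : X -> R) (k : X * X -> R) (C : R) :
  mu.-integrable setT (EFin \o f) -> mu.-integrable setT (EFin \o g) ->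
  measurable_fun setT k -> (forall p, `|k p| <= C) ->
  (leb3 R \x leb3 R)%E.-integrable setT (fun p : X * X => (f p.1 * (g p.2 * k p))%:E).
Proof.
move=> intf intg mk kC.
have mf : measurable_fun setT f by apply/measurable_EFinP; exact: measurable_int intf.
have mg : measurable_fun setT g by apply/measurable_EFinP; exact: measurable_int intg.
have mh : measurable_fun setT (fun p : X * X => (f p.1 * (g p.2 * k p))%:E).
  apply/measurable_EFinP; apply: measurable_funM; first exact: measurableT_comp.
  by apply: measurable_funM => //; exact: measurableT_comp.
apply/(@integrable12ltyP _ _ _ _ R (leb3 R) (leb3 R) _ mh).
have C0 : 0 <= C by exact: le_trans (kC point).
pose G := (\int[mu]_x `|g x|%:E)%E.
have G0 : (0 <= G)%E by apply: integral_ge0.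
have Gy : (G < +oo)%E by move/integrableP : intg => [_].
apply: (@le_lt_trans _ _ (\int[mu]_x (`|f x|%:E * (C%:E * G)))%E).
  apply: ge0_le_integral; first exact: measurableT.
  - by move=> x _; apply: integral_ge0.
  - apply: (measurable_fun_fubini_tonelli_F (m2 := leb3 R) (fun p : X * X => `|(f p.1 * (g p.2 * k p))%:E|)%E) => //.
    exact: measurableT_comp.
  - by apply: emeasurable_funM => //; apply/measurable_EFinP; exact: measurableT_comp.
  - move=> x _.
    rewrite -ge0_integralZl//; last first.
      by apply/measurable_EFinP; exact: measurableT_comp.
    rewrite -ge0_integralZl//; last 2 first.
      by apply: emeasurable_funM => //; apply/measurable_EFinP; exact: measurableT_comp.
      by move=> y _; rewrite mule_ge0// lee_fin.
    apply: ge0_le_integral => //.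
    + apply: measurableT_comp => //; exact: (measurableT_comp mh (pair1_measurable x)).
    + apply: emeasurable_funM => //; apply: emeasurable_funM => //.
      by apply/measurable_EFinP; exact: measurableT_comp.
    + move=> y _; rewrite /= !normrM -!EFinM lee_fin ler_wpM2l//.
      by rewrite mulrC ler_wpM2r.
rewrite ge0_integralZr//; last 2 first.
  by apply/measurable_EFinP; exact: measurableT_comp.
  by rewrite mule_ge0.
have Fy : (\int[mu]_x `|f x|%:E < +oo)%E by move/integrableP : intf => [_].
have F0 : (0 <= \int[mu]_x `|f x|%:E)%E by apply: integral_ge0.
by rewrite lte_mul_pinfty ?ge0_fin_numE// ?lte_mul_pinfty ?ltry.
Qed.

Lemma integrable_kernel (g : X -> R) (k : X * X -> R) (C : R) x :
  mu.-integrable setT (EFin \o g) ->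
  measurable_fun setT k -> (forall p, `|k p| <= C) ->
  mu.-integrable setT (EFin \o (fun y => g y * k (x, y))).
Proof.
move=> intg mk kC; apply: (integrableM_bounded (C := C)) => //.
exact: (measurableT_comp mk (pair1_measurable x)).
Qed.

Lemma integrable_kernel2 (g : X -> R) (k : X * X -> R) (C : R) y :
  mu.-integrable setT (EFin \o g) ->
  measurable_fun setT k -> (forall p, `|k p| <= C) ->
  mu.-integrable setT (EFin \o (fun x => g x * k (x, y))).
Proof.
move=> intg mk kC; apply: (integrableM_bounded (C := C)) => //.
exact: (measurableT_comp mk (pair2_measurable y)).
Qed.

Lemma Rfubini (f g : X -> R) (k : X * X -> R) (C : R) :
  mu.-integrable setT (EFin \o f) -> mu.-integrable setT (EFin \o g) ->
  measurable_fun setT k -> (forall p, `|k p| <= C) ->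
  \int[mu]_x (f x * \int[mu]_y (g y * k (x, y))) =
  \int[mu]_y (g y * \int[mu]_x (f x * k (x, y))).
Proof.
move=> intf intg mk kC.
have H := @Fubini _ _ _ _ R (leb3 R) (leb3 R) _ (integrable_pair intf intg mk kC).
rewrite /Rintegral; congr fine; transitivity (\int[mu]_x \int[mu]_y (f x * (g y * k (x, y)))%:E)%E.
  apply: eq_integral => x _.
  have ik := integrable_kernel x intg mk kC.
  under [RHS]eq_integral do rewrite EFinM.
  by rewrite (integralZl measurableT ik) EFinM fineK// (integrable_fin_num measurableT ik).
rewrite [LHS]H; apply: eq_integral => y _.
have ik := integrable_kernel2 y intf mk kC.
transitivity (\int[mu]_x ((g y)%:E * (f x * k (x, y))%:E))%E.
  by apply: eq_integral => x _; rewrite -EFinM mulrCA.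
by rewrite (integralZl measurableT ik) EFinM fineK// (integrable_fin_num measurableT ik).
Qed.

(** The constant 1 is not integrable in [x], so Fubini's theorem is applied with the positive
    integrable weight [exp3 1] in its place; dividing by the weight afterwards is multiplication by
    [exp3 (-1)]. *)
Lemma measurable_kernel (g : X -> R) (k : X * X -> R) (C : R) :
  mu.-integrable setT (EFin \o g) ->
  measurable_fun setT k -> (forall p, `|k p| <= C) ->
  measurable_fun [set: X] (fun x => \int[mu]_y (g y * k (x, y))).
Proof.
move=> intg mk kC.
have H := @measurable_fubini_F _ _ _ _ R (leb3 R) (leb3 R) _
  (integrable_pair (integrable_exp3 ltr01) intg mk kC).
have e0 x : exp3 1 x != 0 by rewrite gt_eqF// !mulr_gt0 ?expR_gt0.
have -> : (fun x => \int[mu]_y (g y * k (x, y))) =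
   (fun x => (exp3 1 x)^-1 * fine (\int[mu]_y (exp3 1 x * (g y * k (x, y)))%:E)).
  apply/funext => x.
  have ik := integrable_kernel x intg mk kC.
  rewrite -[fine _]/(Rintegral _ _ _) RintegralZl//.
  by rewrite mulrA mulVf// mul1r.
apply: measurable_funM.
  rewrite (_ : (fun x => _) = exp3 (-1)); first exact: measurable_exp3.
  by apply/funext => x; rewrite /exp3 !invfM -!expRN !mulN1r !mulNr !mul1r !opprK.
by apply: (measurableT_comp (f := fine)) => //; exact: H.
Qed.

(** A real form of the Fourier transform: the constant phases 0 and [pi / 2] give the real and
    imaginary parts for the kernel exp(-i dot y x), and a phase linear in [x] translates the result
    in [y]. *)
Definition cosT (g a : X -> R) (y : X) : R := \int[mu]_x (g x * cos (dot y x + a x)).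

Definition cosk (a : X -> R) (p : X * X) : R := cos (dot p.1 p.2 + a p.2).

Lemma measurable_cosk (a : X -> R) : measurable_fun setT a -> measurable_fun setT (cosk a).
Proof.
by move=> ma; apply: (measurable_cos_dot (f := fst) (g := snd) (a := a \o snd)) => //;
  exact: measurableT_comp.
Qed.

Lemma cosk_le1 (a : X -> R) p : `|cosk a p| <= 1.
Proof. exact: cos_max. Qed.

Lemma integrable_cosT (g a : X -> R) (y : X) :
  mu.-integrable setT (EFin \o g) -> measurable_fun setT a ->
  mu.-integrable setT (EFin \o (fun x => g x * cos (dot y x + a x))).
Proof.
by move=> ig ma; apply: (integrable_kernel y ig (measurable_cosk ma) (cosk_le1 a)).
Qed.

Lemma measurable_cosT (g a : X -> R) :
  mu.-integrable setT (EFin \o g) -> measurable_fun setT a ->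
  measurable_fun setT (cosT g a).
Proof.
by move=> ig ma; apply: (measurable_kernel ig (measurable_cosk ma) (cosk_le1 a)).
Qed.

Lemma cosT_le (g a : X -> R) (y : X) :
  mu.-integrable setT (EFin \o g) -> measurable_fun setT a ->
  `|cosT g a y| <= \int[mu]_x `|g x|.
Proof.
move=> ig ma; apply: (le_trans (le_normr_Rintegral _ (integrable_cosT y ig ma))) => //.
apply: le_Rintegral => //.
- exact: (integrable_norm (integrable_cosT y ig ma)).
- exact: integrable_norm.
- by move=> x _; rewrite normrM ler_piMr// cos_max.
Qed.

End bessel.

Section bessel2.
Variable R : realType.
Local Notation leb := (@lebesgue_measure R).
Local Notation mR := (measurableTypeR R).
Local Notation X := (mR * mR * mR)%type.
Local Notation mu := (@mu3 R).
Implicit Types (e b : R) (x : X).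

Definition oppx x : X := (- x.1.1, - x.1.2, - x.2).

Lemma pk3C e x (y : X) : pk3 e x y = pk3 e y x.
Proof.
by rewrite /pk3 -(pkN e (x.1.1 - _)) -(pkN e (x.1.2 - _)) -(pkN e (x.2 - _)) !opprB.
Qed.

Lemma pk3_oppx e x (y : X) : pk3 e x (oppx y) = pk3 e y (oppx x).
Proof. by rewrite /pk3 /= !opprK (addrC x.1.1) (addrC x.1.2) (addrC x.2). Qed.

Lemma measurable_pk3 e : 0 < e -> measurable_fun setT (fun p : X * X => pk3 e p.1 p.2).
Proof.
move=> e0.
have H (h : X -> R) : measurable_fun setT h ->
    measurable_fun setT (fun p : X * X => pk e (h p.1 - h p.2)).
  move=> mh; apply: (measurableT_comp (measurable_pk e0)).
  by apply: measurable_funB; apply: (measurableT_comp mh).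
apply: measurable_funM; first apply: measurable_funM.
- exact: (H _ (@measurable_fst3 R)).
- exact: (H _ (@measurable_snd3 R)).
- exact: (H _ (@measurable_thd3 R)).
Qed.

Lemma measurable_oppx : measurable_fun setT oppx.
Proof.
apply: measurable_fun_pair; first apply: measurable_fun_pair.
- by apply: (measurableT_comp (f := (-%R : R -> R))) => //; exact: measurable_fst3.
- by apply: (measurableT_comp (f := (-%R : R -> R))) => //; exact: measurable_snd3.
- by apply: (measurableT_comp (f := (-%R : R -> R))) => //; exact: measurable_thd3.
Qed.

Lemma measurable_pk3_1 e x : 0 < e -> measurable_fun setT (fun y : X => pk3 e y x).
Proof.
move=> e0.
exact: (measurableT_comp (measurable_pk3 e0) (pair2_measurable x)).
Qed.

Lemma integrable_pk3 e x : 0 < e -> mu.-integrable setT (EFin \o (fun y : X => pk3 e y x)).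
Proof.
move=> e0; apply/integrableP; split.
  by apply/measurable_EFinP; exact: measurable_pk3_1.
under eq_integral do rewrite gee0_abs ?lee_fin ?pk3_ge0//.
by rewrite integral_pk3// ltry.
Qed.

Lemma Rintegral_exp3_cos e x b : 0 < e ->
  \int[mu]_y (exp3 e y * cos (dot y x + b)) = cos b * (pk e x.1.1 * pk e x.1.2 * pk e x.2).
Proof. by move=> e0; rewrite /Rintegral integral_exp3_cos. Qed.

Lemma integrable_exp3_cos e x b : 0 < e ->
  mu.-integrable setT (EFin \o (fun y : X => exp3 e y * cos (dot y x + b))).
Proof.
move=> e0; apply: (integrableM_bounded (C := 1)) => //; first exact: integrable_exp3.
  by apply: measurable_cos_dot.
by move=> y _; exact: cos_max.
Qed.

(** The product of the cosines is a half-sum of cosines at the frequencies x + y and x - y, which is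
    why one kernel is centred at [oppx x] and the other at [x]. *)
Lemma integral_exp3_coscos e x (y : X) a b : 0 < e ->
  \int[mu]_z (exp3 e z * cos (dot z x + b) * cos (dot z y + a)) =
  2^-1 * (cos (a + b) * pk3 e y (oppx x) + cos (b - a) * pk3 e y x).
Proof.
move=> e0.
pose xy : X := (x.1.1 + y.1.1, x.1.2 + y.1.2, x.2 + y.2).
pose yx : X := (x.1.1 - y.1.1, x.1.2 - y.1.2, x.2 - y.2).
transitivity (\int[mu]_z (2^-1 * (exp3 e z * cos (dot z xy + (a + b)) +
   exp3 e z * cos (dot z yx + (b - a))))).
  apply: eq_Rintegral => z _.
  have -> : dot z xy + (a + b) = (dot z x + b) + (dot z y + a) by rewrite !dotE /=; ring.
  have -> : dot z yx + (b - a) = (dot z x + b) - (dot z y + a) by rewrite !dotE /=; ring.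
  set A := dot z x + b; set B := dot z y + a.
  by rewrite (cosD A B) (cosB A B); field.
rewrite RintegralZl//; last first.
  exact: (integrableD measurableT (integrable_exp3_cos xy (a + b) e0) (integrable_exp3_cos yx (b - a) e0)).
rewrite RintegralD//; [|exact: integrable_exp3_cos|exact: integrable_exp3_cos].
rewrite !Rintegral_exp3_cos//; congr (_ * (_ * _ + _ * _)).
  by rewrite /pk3 /= !opprK (addrC x.1.1) (addrC x.1.2) (addrC x.2).
by rewrite pk3C.
Qed.

Lemma exp3_le1 e x : 0 < e -> exp3 e x <= 1.
Proof.
move=> e0.
have H (t : R) : 0 <= expR (- e * `|t|) <= 1.
  by rewrite expR_ge0/= -expR0 ler_expR mulNr oppr_le0 mulr_ge0// ltW.
have [[/andP[? ?] /andP[? ?]] /andP[? ?]] := (H x.1.1, H x.1.2, H x.2).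
by rewrite /exp3 !mulr_ile1// mulr_ge0.
Qed.

Lemma integrable_exp3_cosT e (g a : X -> R) : 0 < e ->
  mu.-integrable setT (EFin \o g) -> measurable_fun setT a ->
  mu.-integrable setT (EFin \o (fun y => exp3 e y * cosT g a y)).
Proof.
move=> e0 ig ma; apply: (integrableM_bounded (C := \int[mu]_x `|g x|)) => //.
- exact: integrable_exp3.
- exact: measurable_cosT.
- by move=> y _; exact: cosT_le.
Qed.

Lemma integrable_poisson_phase e (g a : X -> R) x b : 0 < e ->
  mu.-integrable setT (EFin \o g) -> measurable_fun setT a ->
  mu.-integrable setT (EFin \o (fun y : X =>
    g y * (cos (a y + b) * pk3 e y (oppx x) + cos (b - a y) * pk3 e y x))).
Proof.
move=> e0 ig ma.
apply: (integrableM_bounded (C := 2 * ((2 / e) ^+ 3 + (2 / e) ^+ 3))) => //.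
  apply: measurable_funD; apply: measurable_funM => //.
  - apply: (measurableT_comp (f := @cos R)).
      by apply: continuous_measurable_fun; exact: continuous_cos.
    exact: measurable_funD.
  - exact: measurable_pk3_1.
  - apply: (measurableT_comp (f := @cos R)).
      by apply: continuous_measurable_fun; exact: continuous_cos.
    exact: measurable_funB.
  - exact: measurable_pk3_1.
move=> y _.
have pb (z : X) : pk3 e y z <= 2 * (2 / e) ^+ 3.
  have pe t : 0 <= pk e t <= 2 / e.
    rewrite pk_ge0//= /pk ler_pdivrMr; last by rewrite ltr_wpDr ?sqr_ge0 ?exprn_gt0.
    have -> : 2 / e * (e ^+ 2 + t ^+ 2) = 2 * e + 2 / e * t ^+ 2 by field; rewrite gt_eqF.
    by rewrite lerDl mulr_ge0 ?sqr_ge0// divr_ge0// ltW.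
  have [[/andP[? ?] /andP[? ?]] /andP[? ?]] := (pe (y.1.1 - z.1.1), pe (y.1.2 - z.1.2), pe (y.2 - z.2)).
  rewrite /pk3; apply: (@le_trans _ _ ((2 / e) * (2 / e) * (2 / e))).
    by apply: ler_pM => //; [exact: mulr_ge0|exact: ler_pM].
  have ? : 0 <= (2 / e) ^+ 3 by rewrite exprn_ge0// divr_ge0// ltW.
  by rewrite (_ : 2 / e * (2 / e) * (2 / e) = (2 / e) ^+ 3); [lra|ring].
rewrite mulrDr (le_trans (ler_normD _ _))// !(normrM (cos _)).
by apply: lerD; rewrite (ger0_norm (pk3_ge0 _ _ e0)) -[leRHS]mul1r ler_pM ?pk3_ge0 ?cos_max.
Qed.

(* The damping factor [exp3 e] makes the integrals absolutely convergent. *)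
Lemma integral_exp3_cosT_cos e (g a : X -> R) x b : 0 < e ->
  mu.-integrable setT (EFin \o g) -> measurable_fun setT a ->
  \int[mu]_z (exp3 e z * cosT g a z * cos (dot z x + b)) =
  2^-1 * \int[mu]_y (g y * (cos (a y + b) * pk3 e y (oppx x) + cos (b - a y) * pk3 e y x)).
Proof.
move=> e0 ig ma.
transitivity (\int[mu]_z ((exp3 e z * cos (dot z x + b)) * \int[mu]_y (g y * cosk a (z, y)))).
  by apply: eq_Rintegral => z _; rewrite mulrAC.
rewrite (Rfubini (integrable_exp3_cos x b e0) ig (measurable_cosk ma) (cosk_le1 a)).
rewrite -RintegralZl//; last exact: integrable_poisson_phase.
apply: eq_Rintegral => y _; rewrite mulrCA; congr (_ * _).
rewrite -(integral_exp3_coscos x y (a y) b e0).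
by apply: eq_Rintegral => z _.
Qed.

End bessel2.

Lemma le_integral2D {d : measure_display} {X : measurableType d} {R : realType}
  (mu : {sigma_finite_measure set X -> \bar R}) (h f g : X * X -> \bar R) :
  measurable_fun setT h -> measurable_fun setT f -> measurable_fun setT g ->
  (forall p, 0 <= h p)%E -> (forall p, 0 <= f p)%E -> (forall p, 0 <= g p)%E ->
  (forall p, h p <= f p + g p)%E ->
  (\int[mu]_x \int[mu]_y h (x, y) <=
   \int[mu]_x \int[mu]_y f (x, y) + \int[mu]_x \int[mu]_y g (x, y))%E.
Proof.
move=> mh mf mg h0 f0 g0 hfg.
have mF (k : X * X -> \bar R) : measurable_fun setT k -> (forall p, 0 <= k p)%E ->
    measurable_fun setT (fun x => \int[mu]_y k (x, y))%E.
  move=> mk k0; exact: (@measurable_fun_fubini_tonelli_F _ _ _ _ R mu k mk k0).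
have m1 (k : X * X -> \bar R) x : measurable_fun setT k -> measurable_fun setT (fun y => k (x, y)).
  by move=> mk; exact: (measurableT_comp mk (pair1_measurable x)).
rewrite -ge0_integralD//; last 4 first.
- by move=> x _; exact: integral_ge0.
- exact: mF.
- by move=> x _; exact: integral_ge0.
- exact: mF.
apply: ge0_le_integral => //.
- by move=> x _; exact: integral_ge0.
- exact: mF.
- by apply: emeasurable_funD; exact: mF.
- move=> x _; rewrite -ge0_integralD//; [|exact: m1|exact: m1].
  apply: ge0_le_integral => //; first exact: m1.
  by apply: emeasurable_funD; exact: m1.
Qed.

Section schur.
Context {d : measure_display} {X : measurableType d} {R : realType}.
Variable mu : {sigma_finite_measure set X -> \bar R}.
Variables (N : X * X -> R) (c : R).
Hypotheses (N_ge0 : forall p, 0 <= N p) (c_ge0 : 0 <= c) (mN : measurable_fun setT N).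
Hypotheses (NC : forall x y, N (x, y) = N (y, x)).
Hypothesis integral_N : forall x, (\int[mu]_y (N (x, y))%:E = c%:E)%E.

Lemma measurable_schur (g : X -> R) : measurable_fun setT g ->
  measurable_fun setT (fun p : X * X => (`|g p.1| * (`|g p.2| * N p))%:E).
Proof.
move=> mg.
have mng : measurable_fun setT (fun x => `|g x|) by exact: measurableT_comp.
apply/measurable_EFinP; apply: measurable_funM.
  exact: (measurableT_comp mng).
apply: measurable_funM; last exact: mN.
exact: (measurableT_comp mng).
Qed.

(** Schur's test: the product |g x| |g y| is at most the half-sum of the squares, and by symmetry
    and constant mass of [N] both halves have the same value. The number 1/2 is kept abstract as
    [k]. *)
Lemma schur_test (k : R) (g : X -> R) : 0 <= k -> k + k = 1 -> measurable_fun setT g ->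
  (\int[mu]_x \int[mu]_y (`|g x| * (`|g y| * N (x, y)))%:E <=
   c%:E * \int[mu]_x (g x ^+ 2)%:E)%E.
Proof.
move=> k0 k1 mg.
have mg2 : measurable_fun setT (fun x => (g x ^+ 2)%:E).
  by apply/measurable_EFinP; exact: measurable_funX.
have N1 x : measurable_fun setT (fun y => N (x, y)).
  exact: (measurableT_comp mN (pair1_measurable x)).
pose f1 (p : X * X) : \bar R := (k * (g p.1 ^+ 2 * N p))%:E.
pose f2 (p : X * X) : \bar R := (k * (g p.2 ^+ 2 * N p))%:E.
have mf1 : measurable_fun setT f1.
  apply/measurable_EFinP; apply: measurable_funM => //; apply: measurable_funM => //.
  by apply: measurable_funX; exact: (measurableT_comp mg).
have mf2 : measurable_fun setT f2.
  apply/measurable_EFinP; apply: measurable_funM => //; apply: measurable_funM => //.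
  by apply: measurable_funX; exact: (measurableT_comp mg).
have f10 p : (0 <= f1 p)%E.
  by rewrite lee_fin; apply: mulr_ge0 => //; apply: mulr_ge0; [exact: sqr_ge0|exact: N_ge0].
have f20 p : (0 <= f2 p)%E.
  by rewrite lee_fin; apply: mulr_ge0 => //; apply: mulr_ge0; [exact: sqr_ge0|exact: N_ge0].
have Ef : (\int[mu]_x \int[mu]_y f1 (x, y) = k%:E * (c%:E * \int[mu]_x (g x ^+ 2)%:E))%E.
  rewrite -ge0_integralZl//; last by move=> x _; rewrite lee_fin sqr_ge0.
  rewrite -ge0_integralZl//; last 2 first.
    exact: emeasurable_funM.
    by move=> x _; rewrite mule_ge0// lee_fin ?sqr_ge0// c_ge0.
  apply: eq_integral => x _; rewrite /f1 /=.
  transitivity (\int[mu]_y ((k * g x ^+ 2)%:E * (N (x, y))%:E))%E.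
    by apply: eq_integral => y _; rewrite -EFinM mulrA.
  rewrite ge0_integralZl//; last 3 first.
    exact/measurable_EFinP.
    by move=> y _; rewrite lee_fin N_ge0.
    by rewrite lee_fin mulr_ge0// sqr_ge0.
  by rewrite integral_N// -!EFinM; congr EFin; ring.
have Ef2 : (\int[mu]_x \int[mu]_y f2 (x, y) = \int[mu]_x \int[mu]_y f1 (x, y))%E.
  rewrite [LHS](@fubini_tonelli _ _ _ _ R mu mu f2 mf2 f20).
  by apply: eq_integral => x _; apply: eq_integral => y _; rewrite /f1 /f2 /= NC.
apply: (le_trans (le_integral2D mu (measurable_schur mg) mf1 mf2 _ f10 f20 _)).
- by move=> p; rewrite lee_fin; do 2 (apply: mulr_ge0; first exact: normr_ge0); exact: N_ge0.
- move=> p; rewrite /f1 /f2 -EFinD lee_fin.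
  rewrite -[in leRHS](real_normK (num_real (g p.1))) -[in leRHS](real_normK (num_real (g p.2))).
  have := N_ge0 p; move: (N p) `|g p.1| `|g p.2| => n u v n0.
  rewrite -subr_ge0 (_ : _ - _ = k * n * (u - v) ^+ 2); last first.
    transitivity (k * n * (u - v) ^+ 2 + ((k + k) - 1) * (u * v * n)); first by ring.
    by rewrite k1 subrr mul0r addr0.
  by apply: mulr_ge0; [exact: mulr_ge0|exact: sqr_ge0].
- rewrite Ef2 Ef; clear f10 f20 Ef Ef2.
  by rewrite -ge0_muleDl ?lee_fin// -EFinD k1 mul1e.
Qed.

End schur.

Section bessel3.
Variable R : realType.
Local Notation leb := (@lebesgue_measure R).
Local Notation mR := (measurableTypeR R).
Local Notation X := (mR * mR * mR)%type.
Local Notation mu := (@mu3 R).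
Implicit Types (e b : R) (x : X).

(** Majorises, for every phase, the kernel of the quadratic form that sends [g] to the integral of
    [exp3 e] times the square of [cosT g a]. *)
Let N e (p : X * X) : R := 2^-1 * (pk3 e p.2 (oppx p.1) + pk3 e p.2 p.1).

Let N_ge0 e p : 0 < e -> 0 <= N e p.
Proof. by move=> e0; apply: mulr_ge0; [rewrite invr_ge0|apply: addr_ge0; exact: pk3_ge0]. Qed.

Let measurable_N e : 0 < e -> measurable_fun setT (N e).
Proof.
move=> e0; apply: measurable_funM => //; apply: measurable_funD.
  apply: (measurableT_comp (measurable_pk3 e0) (g := fun p : X * X => (p.2, oppx p.1))).
  by apply: measurable_fun_pair => //; apply: measurableT_comp => //; exact: measurable_oppx.
apply: (measurableT_comp (measurable_pk3 e0) (g := fun p : X * X => (p.2, p.1))).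
exact: measurable_fun_pair.
Qed.

Let NC e x (y : X) : N e (x, y) = N e (y, x).
Proof. by rewrite /N /= (pk3_oppx e y x) (pk3C e y x). Qed.

Let integral_N e x : 0 < e -> (\int[mu]_y (N e (x, y))%:E = ((2 * pi) ^+ 3)%:E)%E.
Proof.
move=> e0; rewrite /N /=; under eq_integral do rewrite EFinM EFinD.
rewrite integralZl//; last by apply: integrableD => //; exact: integrable_pk3.
rewrite integralD//; [|exact: integrable_pk3|exact: integrable_pk3].
by rewrite !integral_pk3// -EFinD -EFinM; congr EFin; field.
Qed.

(** Expanding one of the two factors [cosT g a y] and exchanging integrals gives a double integral
    in [g] with kernel dominated by [N e]. Schur's test then yields a bound that does not depend on
    [e]. *)
Let bessel_exp e (g a : X -> R) : 0 < e ->
  mu.-integrable setT (EFin \o g) -> measurable_fun setT a ->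
  (\int[mu]_y (exp3 e y * cosT g a y * cosT g a y)%:E <=
   ((2 * pi) ^+ 3)%:E * \int[mu]_x (g x ^+ 2)%:E)%E.
Proof.
move=> e0 ig ma.
have c_ge0 : 0 <= (2 * pi) ^+ 3 :> R by rewrite exprn_ge0// mulr_ge0// pi_ge0.
have mg : measurable_fun setT g by apply/measurable_EFinP; exact: measurable_int ig.
have iw := integrable_exp3_cosT e0 ig ma.
have iww : mu.-integrable setT (EFin \o (fun y => exp3 e y * cosT g a y * cosT g a y)).
  apply: (integrableM_bounded (C := \int[mu]_x `|g x|)) => //.
    exact: measurable_cosT.
  by move=> y _; exact: cosT_le.
rewrite -(fineK (integrable_fin_num measurableT iww)) -[fine _]/(Rintegral _ _ _).
rewrite (Rfubini iw ig (measurable_cosk ma) (cosk_le1 a)).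
have k1 : 2^-1 + 2^-1 = 1 :> R by field.
have k0 : 0 <= 2^-1 :> R by rewrite invr_ge0.
apply: le_trans (schur_test (mu := leb3 R) (fun p => N_ge0 p e0) c_ge0 (measurable_N e0) (NC e) (fun x => integral_N x e0) k0 k1 mg).
have imp x : mu.-integrable setT (EFin \o (fun y : X =>
    g y * (cos (a y + a x) * pk3 e y (oppx x) + cos (a x - a y) * pk3 e y x))).
  exact: integrable_poisson_phase.
have E x : \int[mu]_y (exp3 e y * cosT g a y * cosk a (y, x)) =
  2^-1 * \int[mu]_y (g y * (cos (a y + a x) * pk3 e y (oppx x) + cos (a x - a y) * pk3 e y x)).
  exact: (integral_exp3_cosT_cos x (a x) e0 ig ma).
have iG : mu.-integrable setT (EFin \o (fun x => g x * \int[mu]_y (exp3 e y * cosT g a y * cosk a (y, x)))).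
  apply: (integrableM_bounded (C := \int[mu]_y `|exp3 e y * cosT g a y|)) => //.
    have mk : measurable_fun setT (fun p : X * X => cosk a (p.2, p.1)).
      apply: (measurableT_comp (measurable_cosk ma)); exact: measurable_fun_pair.
    exact: (measurable_kernel iw mk (fun p => cosk_le1 a _)).
  move=> x _; apply: (le_trans (le_normr_Rintegral _ _)) => //.
    exact: (integrable_kernel2 x iw (measurable_cosk ma) (cosk_le1 a)).
  apply: le_Rintegral => //.
  - apply: integrable_norm.
    exact: (integrable_kernel2 x iw (measurable_cosk ma) (cosk_le1 a)).
  - exact: integrable_norm.
  - by move=> y _; rewrite normrM ler_piMr// cosk_le1.
set I := Rintegral _ _ _; apply: (@le_trans _ _ `|I|%:E).
  by rewrite lee_fin ler_norm.
rewrite /I {I}.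
rewrite EFin_normr_Rintegral//.
apply: (le_trans (le_abse_integral _ _ _)) => //; first exact: measurable_int iG.
apply: ge0_le_integral => //.
- by apply: measurableT_comp => //; exact: measurable_int iG.
- apply: (@measurable_fun_fubini_tonelli_F _ _ _ _ R (leb3 R)
    (fun p : X * X => (`|g p.1| * (`|g p.2| * N e p))%:E)).
    exact: (measurable_schur (measurable_N e0) mg).
  by move=> p; rewrite lee_fin; do 2 (apply: mulr_ge0; first exact: normr_ge0); exact: N_ge0.
- move=> x _; rewrite /= E normrM EFinM.
  have mNx : measurable_fun setT (fun y => N e (x, y)).
    exact: (measurableT_comp (measurable_N e0) (pair1_measurable x)).
  have mgN : measurable_fun setT (fun y => (`|g y| * N e (x, y))%:E).
    apply/measurable_EFinP; apply: measurable_funM; last exact: mNx.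
    exact: measurableT_comp.
  have gN0 y : (0 <= (`|g y| * N e (x, y))%:E)%E.
    by rewrite lee_fin; apply: mulr_ge0; [exact: normr_ge0|exact: N_ge0].
  apply: (@le_trans _ _ (`|g x|%:E * \int[mu]_y (`|g y| * N e (x, y))%:E)%E).
    rewrite lee_wpmul2l ?lee_fin//.
    rewrite -(@RintegralZl _ _ _ _ _ _ 2^-1 measurableT (imp x)).
    have imp2 := integrableZl measurableT 2^-1 (imp x).
    rewrite EFin_normr_Rintegral//.
    apply: (le_trans (le_abse_integral _ _ _)) => //; first exact: measurable_int imp2.
    apply: ge0_le_integral; [exact: measurableT|by move=> y _; exact: abse_ge0| |exact: mgN|].
    + by apply: measurableT_comp => //; exact: measurable_int imp2.
    + move=> y _; rewrite /= lee_fin mulrCA normrM; apply: ler_wpM2l; first exact: normr_ge0.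
      rewrite normrM ger0_norm ?invr_ge0//; apply: ler_wpM2l; first by rewrite invr_ge0.
      rewrite (le_trans (ler_normD _ _))// !(normrM (cos _)).
      by apply: lerD; rewrite (ger0_norm (pk3_ge0 _ _ e0)) ler_piMl ?pk3_ge0 ?cos_max.
  rewrite -ge0_integralZl//.
Qed.

Lemma exp3_cvg1 x : (exp3 (n.+1%:R^-1) x) @[n --> \oo] --> (1 : R).
Proof.
have H (t : R) : expR (- n.+1%:R^-1 * `|t|) @[n --> \oo] --> (1 : R).
  rewrite -[X in _ --> X]expR0; apply: continuous_cvg; first exact: continuous_expR.
  rewrite [X in _ --> X](_ : _ = - 0 * `|t|); last by rewrite oppr0 mul0r.
  by apply: cvgM; [apply: cvgN; exact: (@cvg_harmonic R)|exact: cvg_cst].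
rewrite [X in _ --> X](_ : _ = 1 * 1 * 1); last by rewrite !mulr1.
exact: (cvgM (cvgM (H x.1.1) (H x.1.2)) (H x.2)).
Qed.

(** The damped bound is uniform in [e], so Fatou's lemma along [e = 1 / (n + 1)] removes the
    damping. *)
Lemma bessel (g a : X -> R) :
  mu.-integrable setT (EFin \o g) -> measurable_fun setT a ->
  (\int[mu]_y (cosT g a y ^+ 2)%:E <= ((2 * pi) ^+ 3)%:E * \int[mu]_x (g x ^+ 2)%:E)%E.
Proof.
move=> ig ma; have mc := measurable_cosT ig ma.
apply: (@fatou_le _ _ _ mu setT (fun n y => (exp3 n.+1%:R^-1 y * cosT g a y * cosT g a y)%:E)) => //.
- move=> n; apply/measurable_EFinP; apply: measurable_funM => //.
  by apply: measurable_funM => //; exact: measurable_exp3.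
- by move=> n y _; rewrite lee_fin -mulrA mulr_ge0 ?exp3_ge0// -expr2 sqr_ge0.
- move=> y _; apply: cvg_EFin; first by apply: nearW.
  rewrite [X in _ --> X](_ : _ = 1 * cosT g a y * cosT g a y); last by rewrite mul1r expr2.
  by apply: cvgM; [apply: cvgM; [exact: exp3_cvg1|exact: cvg_cst]|exact: cvg_cst].
- by move=> n; apply: bessel_exp => //; rewrite invr_gt0.
Qed.

End bessel3.

Lemma Rdominated_cvg {d : measure_display} {T : measurableType d} {R : realType}
  (mu : {measure set T -> \bar R}) (D : set T) (f_ : (T -> R)^nat) (f h : T -> R) :
  measurable D -> (forall n, measurable_fun D (f_ n)) -> measurable_fun D f ->
  (forall x, D x -> f_ ^~ x @ \oo --> f x) -> mu.-integrable D (EFin \o h) ->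
  (forall n x, D x -> `|f_ n x| <= h x) ->
  mu.-integrable D (EFin \o f) /\
  \int[mu]_(x in D) f_ n x @[n --> \oo] --> \int[mu]_(x in D) f x.
Proof.
move=> mD mf_ mf ff ih fh.
have [] := @dominated_convergence _ _ R mu D mD (fun n => EFin \o f_ n) (EFin \o f) (EFin \o h) _ _ _ ih _.
- by move=> n; exact/measurable_EFinP.
- exact/measurable_EFinP.
- by apply: aeW => x Dx; apply: cvg_EFin; [exact: nearW|exact: ff].
- by apply: aeW => x n Dx /=; rewrite lee_fin fh.
- move=> intf _ H; split => //.
  by apply: fine_cvg; rewrite fineK ?integrable_fin_num.
Qed.

(** * Approximate identities and Parseval's identity *)

Section parseval.
Variable R : realType.
Local Notation mR := (measurableTypeR R).
Local Notation X := (mR * mR * mR)%type.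
Local Notation mu := (@mu3 R).
Implicit Types (x : X).

Let e_gt0 (n : nat) : 0 < n.+1%:R^-1 :> R. Proof. by rewrite invr_gt0. Qed.

Let pi3 : R := (2 * pi) ^+ 3.

Lemma pi3_gt0 : 0 < (2 * pi) ^+ 3 :> R.
Proof. by rewrite exprn_gt0// mulr_gt0// pi_gt0. Qed.

Lemma Rintegral_pk3 (e : R) x : 0 < e -> \int[mu]_y (pk3 e y x) = (2 * pi) ^+ 3.
Proof. by move=> e0; rewrite /Rintegral integral_pk3. Qed.

(** Inside a small box [psi] is close to [psi x]; outside, the factor [2 * B] meets only the kernel
    mass missing from the box, which tends to 0 by [integral_pk3_box]. Each part is allotted
    [eps / 2]. *)
Lemma approx_pk3 (psi : X -> R) x (B : R) : measurable_fun setT psi ->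
  (forall y, `|psi y| <= B) ->
  (forall k : R, 0 < k -> exists2 d : R, 0 < d & forall y, box3 x d y -> `|psi y - psi x| <= k) ->
  \int[mu]_y (psi y * pk3 n.+1%:R^-1 y x) @[n --> \oo] --> (2 * pi) ^+ 3 * psi x.
Proof.
move=> mpsi psiB cpsi.
have B0 : 0 <= B by exact: le_trans (psiB x).
apply/cvgrPdist_le => eps eps0.
have k0 : 0 < eps / 2 / pi3 by apply: divr_gt0; [exact: divr_gt0|exact: pi3_gt0].
have [d d0 dP] := cpsi _ k0.
have catan : (4 * atan (d / n.+1%:R^-1)) ^+ 3 @[n --> \oo] --> pi3.
  have H : atan (d / n.+1%:R^-1) @[n --> \oo] --> (pi / 2 : R).
    apply: (@cvg_comp _ _ _ (fun n : nat => n.+1%:R : R) (fun y : R => atan (d / y^-1)) _ +oo).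
      by rewrite (cvg_shiftS (fun n : nat => n%:R : R)); exact: cvgr_idn.
    apply: cvg_comp (@cvgy_atan R).
    rewrite (_ : (fun y : R => d / y^-1) = (fun y => d * y)); last first.
      by apply/funext => y; rewrite invrK.
    exact: (gt0_cvgMry (f := id)).
  rewrite /pi3 (_ : 2 * pi = 4 * (pi / 2)); last by field.
  have H2 : 4 * atan (d / n.+1%:R^-1) @[n --> \oo] --> (4 * (pi / 2) : R).
    by apply: cvgM => //; exact: cvg_cst.
  exact: (cvg_comp _ (fun x : R => x ^+ 3) H2 (@exprn_continuous R 3 _)).
(* The mass outside the box is multiplied by [2 * B]; the added 1 keeps the divisor positive when
   [B] is 0. *)
have K0 : 0 < eps / 2 / (2 * B + 1).
  by rewrite divr_gt0 ?divr_gt0// ltr_wpDl// mulr_ge0.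
move/cvgrPdist_le : catan => /(_ _ K0) near_atan.
near=> n.
have H : `|pi3 - (4 * atan (d / n.+1%:R^-1)) ^+ 3| <= eps / 2 / (2 * B + 1).
  by near: n; exact: near_atan.
have e0 := e_gt0 n; set e := n.+1%:R^-1.
have ip := integrable_pk3 x e0.
have ipsi : mu.-integrable setT (EFin \o (fun y => psi y * pk3 e y x)).
  rewrite (_ : EFin \o _ = EFin \o (fun y => pk3 e y x * psi y)); last first.
    by apply/funext => y /=; rewrite mulrC.
  exact: (integrableM_bounded (C := B)).
have mbox := measurable_box3 x d.
have ibox : mu.-integrable setT (EFin \o (fun y => pk3 e y x * \1_(box3 x d) y)).
  apply: (integrableM_bounded (C := 1)) => //.
  by move=> y _; rewrite indicE; case: (_ \in _); rewrite ?normr1 ?normr0.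
have Ibox : \int[mu]_y (pk3 e y x * \1_(box3 x d) y) = (4 * atan (d / e)) ^+ 3.
  rewrite /Rintegral -[RHS]/(fine ((4 * atan (d / e)) ^+ 3)%:E) -(integral_pk3_box x e0 d0).
  congr fine; rewrite [RHS]integral_mkcond; apply: eq_integral => y _.
  by rewrite patchE indicE; case: (_ \in _); rewrite ?mulr1 ?mulr0.
rewrite distrC -(Rintegral_pk3 x e0) mulrC -RintegralZl// -RintegralB//; last first.
  exact: (integrableZl measurableT (psi x) ip).
under eq_Rintegral do rewrite -mulrBl.
have iD : mu.-integrable setT (EFin \o (fun y => (psi y - psi x) * pk3 e y x)).
  rewrite (_ : EFin \o _ = EFin \o (fun y => pk3 e y x * (psi y - psi x))); last first.
    by apply/funext => y /=; rewrite mulrC.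
  apply: (integrableM_bounded (C := B + B)) => //; first exact: measurable_funB.
  by move=> y _; rewrite (le_trans (ler_normB _ _))// lerD.
apply: (le_trans (le_normr_Rintegral _ iD)) => //.
apply: (@le_trans _ _ (\int[mu]_y ((eps / 2 / pi3 + 2 * B) * pk3 e y x - 2 * B * (pk3 e y x * \1_(box3 x d) y)))).
  apply: le_Rintegral => //.
  - exact: integrable_norm.
  - have i1 := integrableZl measurableT (eps / 2 / pi3 + 2 * B) ip.
    have i2 := integrableZl measurableT (2 * B) ibox.
    exact: (integrableB measurableT i1 i2).
  - move=> y _; rewrite normrM (ger0_norm (pk3_ge0 _ _ e0)).
    rewrite [leRHS](_ : _ = (eps / 2 / pi3 + 2 * B - 2 * B * \1_(box3 x d) y) * pk3 e y x); last by ring.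
    apply: ler_wpM2r; first exact: pk3_ge0.
    rewrite indicE; case: (boolP (y \in box3 x d)) => yb.
      by rewrite mulr1 addrK; apply: dP; exact/set_mem.
    rewrite mulr0 subr0 (le_trans (ler_normB _ _))//.
    by have := (lerD (psiB y) (psiB x)); lra.
rewrite RintegralB//; last 2 first.
- exact: (integrableZl measurableT (eps / 2 / pi3 + 2 * B) ip).
- exact: (integrableZl measurableT (2 * B) ibox).
rewrite !RintegralZl// Ibox Rintegral_pk3//.
have pi3n0 : (2 * pi) ^+ 3 != 0 :> R by rewrite gt_eqF// pi3_gt0.
rewrite mulrDl -addrA -mulrBr /pi3 mulfVK//.
rewrite [leRHS](_ : _ = eps / 2 + eps / 2); last by field.
rewrite lerD2l.
apply: (@le_trans _ _ (2 * B * (eps / 2 / (2 * B + 1)))).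
  by rewrite ler_wpM2l ?mulr_ge0// (le_trans _ H)// ler_norm.
rewrite mulrCA ler_piMr ?divr_ge0 ?(ltW eps0)// ler_pdivrMr ?mul1r ?ltr_wpDl ?mulr_ge0//.
by rewrite lerDl.
Unshelve. all: by end_near. Qed.

(** Continuity tested on the boxes over which the mass of the kernel is known exactly. *)
Definition continuous3 (s : X -> R) x := forall k : R, 0 < k ->
  exists2 d : R, 0 < d & forall y, box3 x d y -> `|s y - s x| <= k.

Lemma continuous_continuous3 (s : R3 R -> R) x : continuous s -> continuous3 s x.
Proof.
move=> cs k k0; have /cvgrPdist_le /(_ k k0) /nbhs_ballP [d /= d0 dP] := cs x.
exists (d / 2); first by rewrite divr_gt0.
move=> y [[]] /=; rewrite !in_itv /= => /andP[y1 y1'] /andP[y2 y2'] /andP[y3 y3'].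
rewrite distrC; apply: dP; split; first split.
- by rewrite /ball/= ltr_norml; apply/andP; split; lra.
- by rewrite /ball/= ltr_norml; apply/andP; split; lra.
- by rewrite /ball/= ltr_norml; apply/andP; split; lra.
Qed.

Lemma continuous_dotr (x : R3 R) : continuous (fun y : R3 R => dot x y).
Proof.
move=> y; under eq_fun do rewrite dotE.
apply: cvgD; first apply: cvgD; apply: cvgM; try exact: cvg_cst.
- apply: (@continuous_comp (R * R * R)%type (R * R)%type R fst fst y).
    exact: cvg_fst.
  exact: cvg_fst.
- apply: (@continuous_comp (R * R * R)%type (R * R)%type R fst snd y).
    exact: cvg_fst.
  exact: cvg_snd.
- exact: cvg_snd.
Qed.

Let cos_psi (s : X -> R) (x0 : X) (t : R) (y : X) : R := s y * cos (t + dot x0 y).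

Let continuous_cos_psi (s : R3 R -> R) x0 t : continuous s -> continuous (cos_psi s x0 t : R3 R -> R).
Proof.
move=> cs y; apply: cvgM; first exact: cs.
apply: continuous_comp; last exact: continuous_cos.
by apply: cvgD; [exact: cvg_cst|exact: continuous_dotr].
Qed.

(* [s] is even, so that no reflection of the measure is needed: the kernel centred at [-x] is evaluated at [-x] only. *)
Lemma parseval (g a s : X -> R) (x0 : X) (B : R) :
  mu.-integrable setT (EFin \o g) -> measurable_fun setT a ->
  (\int[mu]_x (g x ^+ 2)%:E < +oo)%E ->
  mu.-integrable setT (EFin \o s) -> (forall y, `|s y| <= B) ->
  continuous (s : R3 R -> R) -> (forall x, s (oppx x) = s x) ->
  \int[mu]_y (cosT g a y * cosT s (fun z => - dot x0 z) y) =
  (2 * pi) ^+ 3 * cosT (fun x => g x * s x) a x0.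
Proof.
move=> ig ma g2 is_ sB cs se.
have ms : measurable_fun setT s by apply/measurable_EFinP; exact: measurable_int is_.
have mg : measurable_fun setT g by apply/measurable_EFinP; exact: measurable_int ig.
have mb : measurable_fun setT (fun z : X => - dot x0 z).
  apply: (measurableT_comp (f := (-%R : R -> R))) => //.
  exact: measurable_dot.
have B0 : 0 <= B by exact: le_trans (sB point).
pose b z := - dot x0 z.
have s2 : (\int[mu]_x (s x ^+ 2)%:E < +oo)%E.
  apply: (@le_lt_trans _ _ (\int[mu]_x (B * `|s x|)%:E)%E).
    apply: ge0_le_integral => //.
    - by move=> x _; rewrite lee_fin sqr_ge0.
    - by apply/measurable_EFinP; exact: measurable_funX.
    - by apply/measurable_EFinP; apply: measurable_funM => //; exact: measurableT_comp.
    - by move=> x _; rewrite lee_fin -(real_normK (num_real (s x))) expr2 ler_wpM2r.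
  under eq_integral do rewrite EFinM.
  have ins := integrable_norm is_.
  by rewrite integralZl// lte_mul_pinfty// ?lee_fin// integrable_lty.
have L2 (g' a' : X -> R) : mu.-integrable setT (EFin \o g') -> measurable_fun setT a' ->
    (\int[mu]_x (g' x ^+ 2)%:E < +oo)%E -> mu.-integrable setT (EFin \o (fun y => cosT g' a' y ^+ 2)).
  move=> ig' ma' g2'; apply/integrableP; split.
    by apply/measurable_EFinP; apply: measurable_funX; exact: measurable_cosT.
  under eq_integral do rewrite gee0_abs ?lee_fin ?sqr_ge0//.
  apply: (le_lt_trans (bessel ig' ma')).
  rewrite lte_mul_pinfty// ?lee_fin ?(ltW pi3_gt0)//.
have Lg := L2 _ _ ig ma g2.
have Ls := L2 _ _ is_ mb s2.
have mcs := measurable_cosT is_ mb.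
have mcg := measurable_cosT ig ma.
(* The damped left-hand side has two limits: directly, by dominated convergence, and after Fubini,
   as an integral of [g] against Poisson integrals of [s] times a cosine, which are approximate
   identities. *)
pose L (n : nat) := \int[mu]_y (exp3 n.+1%:R^-1 y * cosT s b y * cosT g a y).
have L1 : L n @[n --> \oo] --> \int[mu]_y (cosT g a y * cosT s b y).
  have := integrableD measurableT Lg Ls => iD.
  have [] := @Rdominated_cvg _ _ _ mu setT (fun n y => exp3 n.+1%:R^-1 y * cosT s b y * cosT g a y)
    (fun y => cosT g a y * cosT s b y) _ measurableT _ _ _ iD _.
  - move=> n; apply: measurable_funM => //; apply: measurable_funM => //.
    exact: measurable_exp3.
  - exact: measurable_funM.
  - move=> y _; rewrite [X in _ --> X](_ : _ = 1 * cosT s b y * cosT g a y); last by rewrite mul1r mulrC.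
    by apply: cvgM; [apply: cvgM; [exact: exp3_cvg1|exact: cvg_cst]|exact: cvg_cst].
  - move=> n y _; rewrite -mulrA normrM (ger0_norm (exp3_ge0 _ _)).
    apply: (@le_trans _ _ (1 * `|cosT s b y * cosT g a y|)).
      by rewrite ler_wpM2r// exp3_le1.
    rewrite mul1r normrM -(real_normK (num_real (cosT g a y))) -(real_normK (num_real (cosT s b y))).
    move: `|cosT g a y| `|cosT s b y| (normr_ge0 (cosT g a y)) (normr_ge0 (cosT s b y)) => u v u0 v0.
    by rewrite -subr_ge0 (_ : _ - _ = (u - v) ^+ 2 + u * v); [rewrite addr_ge0 ?sqr_ge0 ?mulr_ge0|ring].
  - by [].
have LE n : L n = \int[mu]_x (g x * (2^-1 * \int[mu]_y (s y * (cos (b y + a x) * pk3 n.+1%:R^-1 y (oppx x)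
    + cos (a x - b y) * pk3 n.+1%:R^-1 y x)))).
  have ies := integrable_exp3_cosT (e_gt0 n) is_ mb.
  rewrite /L (Rfubini ies ig (measurable_cosk ma) (cosk_le1 a)).
  apply: eq_Rintegral => x _; congr (_ * _).
  exact: (integral_exp3_cosT_cos x (a x) (e_gt0 n) is_ mb).
have mi n : measurable_fun setT (fun x => \int[mu]_y (s y * (cos (b y + a x) * pk3 n.+1%:R^-1 y (oppx x)
    + cos (a x - b y) * pk3 n.+1%:R^-1 y x))).
  have ies := integrable_exp3_cosT (e_gt0 n) is_ mb.
  have mk : measurable_fun setT (fun p : X * X => cosk a (p.2, p.1)).
    apply: (measurableT_comp (measurable_cosk ma)); exact: measurable_fun_pair.
  have := measurable_kernel ies mk (fun p => cosk_le1 a _).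
  have -> : (fun x => \int[mu]_y (exp3 n.+1%:R^-1 y * cosT s b y * cosk a (y, x))) =
    (fun x => 2^-1 * \int[mu]_y (s y * (cos (b y + a x) * pk3 n.+1%:R^-1 y (oppx x)
    + cos (a x - b y) * pk3 n.+1%:R^-1 y x))).
    by apply/funext => x; exact: (integral_exp3_cosT_cos x (a x) (e_gt0 n) is_ mb).
  move=> m1; have := measurable_funM (measurable_cst (2 : R)) m1.
  apply: eq_measurable_fun => x _ /=; rewrite mulrA mulfV ?mul1r//.
have ci n x : \int[mu]_y (s y * (cos (b y + a x) * pk3 n.+1%:R^-1 y (oppx x)
    + cos (a x - b y) * pk3 n.+1%:R^-1 y x)) =
  \int[mu]_y (cos_psi s (oppx x0) (a x) y * pk3 n.+1%:R^-1 y (oppx x)) +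
  \int[mu]_y (cos_psi s x0 (a x) y * pk3 n.+1%:R^-1 y x).
  have ik z t : mu.-integrable setT (EFin \o (fun y => cos_psi s z (a x) y * pk3 n.+1%:R^-1 y t)).
    rewrite (_ : EFin \o _ = EFin \o (fun y => pk3 n.+1%:R^-1 y t * cos_psi s z (a x) y)); last first.
      by apply/funext => y /=; rewrite mulrC.
    apply: (integrableM_bounded (C := B)) => //; first exact: integrable_pk3.
      apply: measurable_funM => //; apply: (measurableT_comp (f := @cos R)).
        by apply: continuous_measurable_fun; exact: continuous_cos.
      by apply: measurable_funD => //; exact: measurable_dot.
    by move=> y _; rewrite normrM -[leRHS]mulr1 ler_pM// cos_max.
  rewrite -RintegralD//; apply: eq_Rintegral => y _; rewrite /cos_psi /b.
  rewrite (_ : dot (oppx x0) y = - dot x0 y); last by rewrite !dotE /=; ring.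
  by rewrite opprK [- _ + a x]addrC; ring.
have pB z (t : R) y : `|cos_psi s z t y| <= B by rewrite normrM -[leRHS]mulr1 ler_pM// cos_max.
have mcp z t : measurable_fun setT (cos_psi s z t).
  apply: measurable_funM => //; apply: (measurableT_comp (f := @cos R)).
    by apply: continuous_measurable_fun; exact: continuous_cos.
  by apply: measurable_funD => //; exact: measurable_dot.
have cvi x : \int[mu]_y (s y * (cos (b y + a x) * pk3 n.+1%:R^-1 y (oppx x)
    + cos (a x - b y) * pk3 n.+1%:R^-1 y x)) @[n --> \oo] --> 2 * pi3 * (s x * cos (dot x0 x + a x)).
  rewrite (funext (fun n => ci n x)).
  rewrite [X in _ --> X](_ : _ = pi3 * cos_psi s (oppx x0) (a x) (oppx x) + pi3 * cos_psi s x0 (a x) x); last first.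
    rewrite /cos_psi se (_ : dot (oppx x0) (oppx x) = dot x0 x); last by rewrite !dotE /=; ring.
    by rewrite [a x + _]addrC; ring.
  apply: cvgD; apply: (approx_pk3 (B := B)) => //.
  - exact/continuous_continuous3/continuous_cos_psi.
  - exact/continuous_continuous3/continuous_cos_psi.
have L2' : L n @[n --> \oo] --> \int[mu]_x (g x * (2^-1 * (2 * pi3 * (s x * cos (dot x0 x + a x))))).
  rewrite (funext LE).
  have ih := integrableZl measurableT (B * pi3) (integrable_norm ig).
  have [] := @Rdominated_cvg _ _ _ mu setT (fun n x => g x * (2^-1 * \int[mu]_y (s y * (cos (b y + a x) * pk3 n.+1%:R^-1 y (oppx x)
    + cos (a x - b y) * pk3 n.+1%:R^-1 y x))))
    (fun x => g x * (2^-1 * (2 * pi3 * (s x * cos (dot x0 x + a x))))) (fun x => B * pi3 * `|g x|) measurableT _ _ _ ih _.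
  - by move=> n; apply: measurable_funM => //; apply: measurable_funM.
  - do 3 apply: measurable_funM => //; apply: measurable_funM => //.
    by apply: measurable_cos_dot.
  - move=> x _; apply: cvgM; first exact: cvg_cst.
    by apply: cvgM; [exact: cvg_cst|exact: cvi].
  - move=> n x _; rewrite normrM mulrC ler_wpM2r//.
    rewrite normrM ci ger0_norm ?invr_ge0//.
    have bd z t : `|\int[mu]_y (cos_psi s z (a x) y * pk3 n.+1%:R^-1 y t)| <= B * pi3.
      have ik : mu.-integrable setT (EFin \o (fun y => pk3 n.+1%:R^-1 y t * cos_psi s z (a x) y)).
        apply: (integrableM_bounded (C := B)) => //; exact: integrable_pk3.
      under eq_Rintegral do rewrite mulrC.
      apply: (le_trans (le_normr_Rintegral _ ik)) => //.
      rewrite /pi3 -(Rintegral_pk3 t (e_gt0 n)) -RintegralZl//; last exact: integrable_pk3.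
      apply: le_Rintegral => //; first exact: integrable_norm.
        exact: (integrableZl measurableT B (integrable_pk3 t (e_gt0 n))).
      by move=> y _; rewrite normrM (ger0_norm (pk3_ge0 _ _ _))// mulrC ler_wpM2r ?pk3_ge0 ?pB.
    rewrite (le_trans (ler_wpM2l _ (ler_normD _ _))) ?invr_ge0//.
    by have := (lerD (bd (oppx x0) (oppx x)) (bd x0 x)); lra.
  - by [].
rewrite -[LHS](cvg_lim _ L1)// (cvg_lim _ L2')// /cosT.
have icos : mu.-integrable setT (EFin \o (fun x => g x * s x * cos (dot x0 x + a x))).
  apply: integrable_cosT => //.
  by apply: (integrableM_bounded (C := B)).
by rewrite -RintegralZl//; apply: eq_Rintegral => x _; rewrite /pi3; field.
Qed.

End parseval.

(** * Transforms of square-integrable functions and multipliers *)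

Section riesz_fischer.
Context {d : measure_display} {T : measurableType d} {R : realType}.
Variable mu : {measure set T -> \bar R}.

Lemma ge0_integral_lty_ae (D : set T) (f : T -> \bar R) : measurable D ->
  measurable_fun D f -> (forall x, D x -> 0 <= f x)%E ->
  (\int[mu]_(x in D) f x < +oo)%E -> {ae mu, forall x, D x -> f x < +oo}%E.
Proof.
move=> mD mf f0 fy.
have intf : mu.-integrable D f.
  apply/integrableP; split => //.
  by under eq_integral => x /set_mem Dx do rewrite gee0_abs ?f0//.
by apply: filterS (integrable_ae mD intf) => x /[apply]; rewrite fin_numElt => /andP[].
Qed.

Lemma telescope_cvg (g : R^nat) (M : R) : 0 <= M ->
  (forall j, `|g j.+1 - g j| <= M * 2^-1 ^+ j) -> cvgn g.
Proof.
move=> M0 gM.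
have cs : cvgn (series (fun j => g j.+1 - g j)).
  apply: normed_cvg; apply: (series_le_cvg (v_ := geometric M 2^-1)) => //.
  - by move=> n; exact: normr_ge0.
  - by move=> n; rewrite /geometric /= mulr_ge0// exprn_ge0// invr_ge0.
  - by apply: is_cvg_geometric_series; rewrite ger0_norm ?invr_ge0// invf_lt1// ltr1n.
have -> : g = (fun n => series (fun j => g j.+1 - g j) n + g 0%N).
  by apply/funext => n; rewrite /series /= telescope_sumr// subrK.
by apply: is_cvgD => //; exact: is_cvg_cst.
Qed.

(** Along a subsequence with squared distances at most 8^-j, the sum [S] of the squared increments
    weighted by 4^j has finite integral. Where [S] is finite the increments are at most sqrt(S)
    2^-j, so the subsequence converges; Fatou's lemma compares its limit with the whole sequence. *)
Lemma riesz_fischer (f_ : (T -> R)^nat) :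
  (forall n, measurable_fun setT (f_ n)) ->
  (forall e : R, 0 < e -> exists N, forall n m, (N <= n)%N -> (N <= m)%N ->
     (\int[mu]_x ((f_ n x - f_ m x) ^+ 2)%:E <= e%:E)%E) ->
  exists2 F : T -> R, measurable_fun setT F &
    forall e : R, 0 < e -> exists N, forall n, (N <= n)%N ->
     (\int[mu]_x ((F x - f_ n x) ^+ 2)%:E <= e%:E)%E.
Proof.
move=> mf cf.
have /choice[N0 N0P] : forall j : nat, exists N, forall n m, (N <= n)%N -> (N <= m)%N ->
     (\int[mu]_x ((f_ n x - f_ m x) ^+ 2)%:E <= (8^-1 ^+ j)%:E)%E.
  by move=> j; apply: cf; rewrite exprn_gt0// invr_gt0.
(* The partial sums make [K] nondecreasing and at least [N0]; the summand [j] makes it unbounded. *)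
pose K j := (\sum_(i < j.+1) N0 i + j)%N.
have NK j : (N0 j <= K j)%N by rewrite /K big_ord_recr /= addnAC leq_addl.
have KS j : (K j <= K j.+1)%N by rewrite /K [in leqRHS]big_ord_recr /= leq_add// leq_addr.
have jK j : (j <= K j)%N by rewrite /K leq_addl.
have NKS j : (N0 j <= K j.+1)%N := leq_trans (NK j) (KS j).
pose g j := f_ (K j).
have mg j : measurable_fun setT (g j) by exact: mf.
have mdiff n m : measurable_fun setT (fun x => ((f_ n x - f_ m x) ^+ 2)%:E).
  by apply/measurable_EFinP; apply: measurable_funX; exact: measurable_funB.
pose t j (x : T) : \bar R := (4 ^+ j * (g j.+1 x - g j x) ^+ 2)%:E.
have t0 j x : (0 <= t j x)%E by rewrite lee_fin; apply: mulr_ge0; [exact: exprn_ge0|exact: sqr_ge0].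
have mt j : measurable_fun setT (t j).
  by apply/measurable_EFinP; apply: measurable_funM => //; apply: measurable_funX; exact: measurable_funB.
pose S x := (\sum_(j <oo) t j x)%E.
have mS : measurable_fun setT S by apply: ge0_emeasurable_sum => //.
have S0 x : (0 <= S x)%E by apply: nneseries_ge0.
have IS : (\int[mu]_x S x < +oo)%E.
  rewrite integral_nneseries//.
  apply: (@le_lt_trans _ _ (\sum_(j <oo) (2^-1 ^+ j)%:E)%E).
    apply: lee_nneseries => [*|j *]; first by apply: integral_ge0.
    rewrite /t; under eq_integral do rewrite EFinM.
    rewrite ge0_integralZl//; last 2 first.
      exact: mdiff.
      by move=> x _; rewrite lee_fin sqr_ge0.
    apply: (@le_trans _ _ ((4 ^+ j)%:E * (8^-1 ^+ j)%:E)%E).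
      by rewrite lee_wpmul2l ?lee_fin ?exprn_ge0//; apply: N0P.
    rewrite -EFinM lee_fin -exprMn (_ : 4 * 8^-1 = 2^-1)//; by field.
  rewrite (_ : (\sum_(j <oo) _)%E = 2%:E) ?ltry//.
  apply/cvg_lim => //.
  have -> : (fun n => \sum_(0 <= i < n) (2^-1 ^+ i)%:E)%E = EFin \o series (geometric 1 (2^-1 : R)).
    by apply/funext => n; rewrite /= /series /= -sumEFin; apply: eq_bigr => i _; rewrite mul1r.
  apply: cvg_EFin; first exact: nearW.
  have h : `|2^-1| < 1 :> R by rewrite ger0_norm ?invr_ge0// invf_lt1// ltr1n.
  have := @cvg_geometric_series R 1 2^-1 h.
  by rewrite (_ : 1 / (1 - 2^-1) = 2 :> R)//; field; lra.
pose D := [set x | (S x < +oo)%E].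
have mD : measurable D.
  by rewrite -[D]setTI; apply: emeasurable_fun_infty_o.
have aeD : {ae mu, forall x, D x}.
  by apply: filterS (ge0_integral_lty_ae measurableT mS _ IS) => // x; exact.
have DC0 : mu (~` D) = 0.
  by apply/eqP; rewrite -measure_le0; case: aeD => A [mA A0 DA]; rewrite -A0 le_measure ?inE//; exact: measurableC.
have cg x : D x -> cvgn (g ^~ x).
  move=> Dx.
  have Sf : S x \is a fin_num by rewrite ge0_fin_numE.
  apply: (@telescope_cvg _ (Num.sqrt (fine (S x)))) => // j.
  have tS : (t j x <= S x)%E.
    rewrite /S (@nneseriesD1 _ _ j xpredT)// leeDl//; exact: nneseries_ge0.
  have fS0 : 0 <= fine (S x) by apply: fine_ge0.
  have tS' : 4 ^+ j * (g j.+1 x - g j x) ^+ 2 <= fine (S x) by rewrite -lee_fin fineK.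
  have -> : 2^-1 ^+ j = Num.sqrt ((4^-1) ^+ j) :> R.
    rewrite (_ : 4^-1 = 2^-1 ^+ 2); last by field.
    by rewrite exprAC sqrtr_sqr ger0_norm// exprn_ge0// invr_ge0.
  rewrite -sqrtrM//.
  apply: (@le_trans _ _ (Num.sqrt ((g j.+1 x - g j x) ^+ 2))); first by rewrite sqrtr_sqr.
  rewrite ler_sqrt; last by rewrite mulr_ge0// exprn_ge0// invr_ge0.
  by rewrite exprVn ler_pdivlMr ?exprn_gt0// mulrC.
(* An upper limit is measurable on the whole space; its value off the full-measure set [D] does not
   matter. *)
pose F x := fine (limn_esup (fun j => (g j x)%:E)).
have mF : measurable_fun setT F.
  apply: (measurableT_comp (f := fine)) => //.
  by apply: measurable_fun_limn_esup => n; exact/measurable_EFinP.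
have gF z : D z -> (fun j => g j z) @ \oo --> F z.
  move=> Dz; have c := cg z Dz; rewrite /F is_cvg_limn_esupE; last first.
    by apply/cvg_ex; exists (limn (g ^~ z))%:E; apply: cvg_EFin => //; exact: nearW.
  rewrite (_ : limn _ = (limn (g ^~ z))%:E)//.
  by apply/cvg_lim => //; apply: cvg_EFin => //; exact: nearW.
exists F => // e e0.
have [N NP] := cf _ e0.
exists N => n Nn.
have mFn : measurable_fun setT (fun x => ((F x - f_ n x) ^+ 2)%:E).
  by apply/measurable_EFinP; apply: measurable_funX; exact: measurable_funB.
rewrite (@ge0_negligible_integral _ _ _ mu setT (~` D)); first last.
- exact: DC0.
- by move=> x _; rewrite lee_fin sqr_ge0.
- exact: mFn.
- exact: measurableT.
- exact: measurableC.
rewrite setTD setCK.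
apply: (@fatou_le _ _ _ mu D (fun j x => ((g (j + N)%N x - f_ n x) ^+ 2)%:E)) => //.
- by move=> j; apply: measurable_funTS; exact: mdiff.
- by move=> j x _; rewrite lee_fin sqr_ge0.
- move=> x Dx; apply: cvg_EFin; first exact: nearW.
  apply: (cvg_comp (fun j => g (j + N)%N x - f_ n x) (fun y : R => y ^+ 2) _ (@exprn_continuous R 2 _)).
  by apply: cvgB; [rewrite (cvg_shiftn N (g ^~ x)); exact: gF|exact: cvg_cst].
- move=> j; apply: (@le_trans _ _ (\int[mu]_x ((g (j + N)%N x - f_ n x) ^+ 2)%:E)%E).
    apply: ge0_subset_integral => //; first exact: mdiff.
    by move=> x ?; rewrite lee_fin sqr_ge0.
  by apply: NP => //; rewrite (leq_trans _ (jK _))// leq_addl.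
Qed.

End riesz_fischer.

Section plancherel.
Variable R : realType.
Local Notation mR := (measurableTypeR R).
Local Notation X := (mR * mR * mR)%type.
Local Notation mu := (@mu3 R).
Implicit Types (x : X).

Definition l2 (f : X -> R) := measurable_fun setT f /\ (\int[mu]_x (f x ^+ 2)%:E < +oo)%E.

Definition cut (f : X -> R) (n : nat) : X -> R := f \_ [set x | enorm x <= n%:R].

Lemma measurable_enorm : measurable_fun setT (@enorm R : X -> R).
Proof.
apply: (measurableT_comp (f := @Num.sqrt R)).
  by apply: continuous_measurable_fun; exact: sqrt_continuous.
by apply: measurable_dot.
Qed.

Lemma measurable_ball (r : R) : measurable [set x : X | enorm x <= r].
Proof.
rewrite -[X in measurable X]setTI.
have := measurable_enorm measurableT (measurable_itv `]-oo, r]).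
by congr (measurable (_ `&` _)); apply/seteqP; split => x /=; rewrite in_itv.
Qed.

Lemma crd_le_enorm (x : R3 R) : [/\ `|x.1.1| <= enorm x, `|x.1.2| <= enorm x & `|x.2| <= enorm x].
Proof.
rewrite /enorm dotE -!expr2.
by split; rewrite -sqrtr_sqr; apply: ler_wsqrtr; rewrite ?lerDr ?lerDl ?addr_ge0 ?sqr_ge0//;
  have := sqr_ge0 x.1.1; have := sqr_ge0 x.1.2; have := sqr_ge0 x.2; lra.
Qed.

Lemma mu3_ball (r : R) : 0 <= r -> (mu [set x : X | (enorm x <= r)%R] <= ((2 * r) ^+ 3)%:E)%E.
Proof.
move=> r0; rewrite -(mu3_box3 (0, 0, 0) r0); apply: le_measure; rewrite ?inE.
- exact: measurable_ball.
- exact: measurable_box3.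
- move=> x /= xr; have [h1 h2 h3] := crd_le_enorm x.
  rewrite /box3 /=; split => /=; first split => /=; rewrite in_itv /= ?sub0r ?add0r -ler_norml;
    exact: le_trans xr.
Qed.

Lemma measurable_cut f n : measurable_fun setT f -> measurable_fun setT (cut f n).
Proof.
move=> mf; apply/(measurable_restrictT _ _).1; first exact: measurable_ball.
exact: measurable_funTS.
Qed.

Lemma l2M_integrable (f g : X -> R) : l2 f -> l2 g -> mu.-integrable setT (EFin \o (fun x => f x * g x)).
Proof.
move=> [mf f2] [mg g2].
have i2 (h : X -> R) : measurable_fun setT h -> (\int[mu]_x (h x ^+ 2)%:E < +oo)%E ->
    mu.-integrable setT (EFin \o (fun x => h x ^+ 2)).
  move=> mh h2; apply/integrableP; split.
    by apply/measurable_EFinP; exact: measurable_funX.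
  by under eq_integral do rewrite gee0_abs ?lee_fin ?sqr_ge0//.
apply: (le_integrable _ _ _ (integrableD measurableT (i2 _ mf f2) (i2 _ mg g2))) => //.
  by apply/measurable_EFinP; exact: measurable_funM.
move=> x _ /=; rewrite lee_fin normrM [leRHS]ger0_norm ?addr_ge0 ?sqr_ge0//.
rewrite -(real_normK (num_real (f x))) -(real_normK (num_real (g x))).
move: `|f x| `|g x| (normr_ge0 (f x)) (normr_ge0 (g x)) => u v u0 v0.
by rewrite -subr_ge0 (_ : _ - _ = (u - v) ^+ 2 + u * v); [rewrite addr_ge0 ?sqr_ge0 ?mulr_ge0|ring].
Qed.

Lemma l2_indic_ball (r : R) : 0 <= r -> l2 (\1_[set x : X | enorm x <= r]).
Proof.
move=> r0; have mb := measurable_ball r.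
split => //.
apply: (@le_lt_trans _ _ (\int[mu]_(x in setT) (\1_[set x : X | (enorm x <= r)%R] x)%:E)%E).
  apply: ge0_le_integral => //.
  - by apply/measurable_EFinP; apply: measurable_funX.
  - exact/measurable_EFinP.
  - by move=> x _; rewrite lee_fin indicE; case: (_ \in _); rewrite ?expr1n ?expr0n.
rewrite integral_indic// setIT; exact: (le_lt_trans (mu3_ball r0) (ltry _)).
Qed.

Lemma integrable_cut f n : l2 f -> mu.-integrable setT (EFin \o cut f n).
Proof.
move=> fl2; have := l2M_integrable fl2 (@l2_indic_ball n%:R (ler0n _ _)).
apply: eq_integrable => // x _ /=; congr EFin.
by rewrite /cut patchE indicE; case: (_ \in _); rewrite ?mulr1 ?mulr0.
Qed.

(* Both components of the truncated transform are [cosT (cut f n)] up to a constant phase. *)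
Definition is_ft (f F1 F2 : X -> R) :=
  [/\ measurable_fun setT F1, measurable_fun setT F2 &
   forall e : R, 0 < e -> exists N, forall n, (N <= n)%N ->
    (\int[mu]_x ((F1 x - cosT (cut f n) (cst 0) x) ^+ 2 +
      (F2 x - cosT (cut f n) (cst (pi / 2)) x) ^+ 2)%:E <= e%:E)%E].

Lemma cosTB (g h a : X -> R) y : mu.-integrable setT (EFin \o g) -> mu.-integrable setT (EFin \o h) ->
  measurable_fun setT a -> cosT g a y - cosT h a y = cosT (fun x => g x - h x) a y.
Proof.
move=> ig ih ma; rewrite /cosT -RintegralB//; try exact: integrable_cosT.
by apply: eq_Rintegral => x _; rewrite mulrBl.
Qed.

Lemma cut_cauchy (f : X -> R) : l2 f -> forall e : R, 0 < e -> exists N, forall n m, (N <= n)%N -> (N <= m)%N ->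
  (\int[mu]_x ((cut f n x - cut f m x) ^+ 2)%:E <= e%:E)%E.
Proof.
move=> [mf f2] e e0.
have if2 : mu.-integrable setT (EFin \o (fun x => f x ^+ 2)).
  apply/integrableP; split; first by apply/measurable_EFinP; exact: measurable_funX.
  by under eq_integral do rewrite gee0_abs ?lee_fin ?sqr_ge0//.
pose t n x := (f x - cut f n x) ^+ 2.
have mt n : measurable_fun setT (t n).
  by apply: measurable_funX; apply: measurable_funB => //; exact: measurable_cut.
have tle n x : t n x <= f x ^+ 2.
  rewrite /t /cut patchE; case: ifP => _; first by rewrite subrr expr0n/= sqr_ge0.
  by rewrite subr0.
have : \int[mu]_x t n x @[n --> \oo] --> (0 : R).
  rewrite [X in _ --> X](_ : _ = \int[mu]_(x in setT) cst 0 x); last by rewrite Rintegral_cst// mul0r.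
  apply: (@Rdominated_cvg _ _ _ mu setT t (cst 0) (fun x => f x ^+ 2) measurableT mt
    (measurable_cst _) _ if2 _).2.
  - move=> x _; apply: cvg_near_cst; near=> n.
    rewrite /t /cut patchE mem_set ?subrr ?expr0n//=.
    by near: n; exact: nbhs_infty_ger.
  - by move=> n x _; rewrite ger0_norm ?sqr_ge0.
(* The quarter compensates (v - w)^2 <= 2 ((u - v)^2 + (u - w)^2), with two tails of size
   [e / 4]. *)
move=> /cvgrPdist_le /(_ (e / 4)); case; first by rewrite divr_gt0.
move=> N _ NP; exists N => n m Nn Nm.
have it k : mu.-integrable setT (EFin \o t k).
  apply: (le_integrable _ _ _ if2) => //; first exact/measurable_EFinP.
  by move=> x _; rewrite /= lee_fin !ger0_norm ?sqr_ge0.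
have tN k : (N <= k)%N -> (\int[mu]_x (t k x)%:E <= (e / 4)%:E)%E.
  move=> Nk; rewrite -(fineK (integrable_fin_num measurableT (it k))) lee_fin.
  by have := NP k Nk; rewrite sub0r normrN; apply: le_trans; exact: ler_norm.
apply: (@le_trans _ _ (\int[mu]_x (2%:E * ((t n x)%:E + (t m x)%:E)))%E).
  apply: ge0_le_integral => //.
  - by move=> x _; rewrite lee_fin sqr_ge0.
  - by apply/measurable_EFinP; apply: measurable_funX; apply: measurable_funB; exact: measurable_cut.
  - by apply: emeasurable_funM => //; apply: emeasurable_funD; exact/measurable_EFinP.
  - move=> x _; rewrite -EFinD -EFinM lee_fin /t.
    move: (f x) (cut f n x) (cut f m x) => u v w.
    rewrite -subr_ge0 (_ : _ - _ = ((u - v) + (u - w)) ^+ 2); last by ring.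
    exact: sqr_ge0.
rewrite ge0_integralZl//; last 2 first.
  by apply: emeasurable_funD; exact/measurable_EFinP.
  by move=> x _; rewrite adde_ge0// lee_fin sqr_ge0.
rewrite ge0_integralD//; [|by move=> x _; rewrite lee_fin sqr_ge0|exact/measurable_EFinP|by move=> x _; rewrite lee_fin sqr_ge0|exact/measurable_EFinP].
rewrite (_ : e%:E = 2%:E * ((e / 4)%:E + (e / 4)%:E))%E; last by rewrite -EFinD -EFinM; congr EFin; field.
by rewrite lee_wpmul2l// leeD// tN.
Unshelve. all: by end_near. Qed.

(** Bessel's inequality carries the Cauchy property of the truncations over to their transforms, and
    completeness of L^2 provides the limit. *)
Lemma cosT_cut_cauchy (f : X -> R) (a : R) : l2 f -> exists2 F : X -> R, measurable_fun setT F &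
  forall e : R, 0 < e -> exists N, forall n, (N <= n)%N ->
    (\int[mu]_x ((F x - cosT (cut f n) (cst a) x) ^+ 2)%:E <= e%:E)%E.
Proof.
move=> fl2; apply: riesz_fischer.
  by move=> n; apply: measurable_cosT => //; exact: integrable_cut.
move=> e e0; have [N NP] := cut_cauchy fl2 (divr_gt0 e0 (pi3_gt0 R)).
exists N => n m Nn Nm.
have [icn icm] := (integrable_cut n fl2, integrable_cut m fl2).
have ma : measurable_fun setT (cst a : X -> R) := measurable_cst a.
under eq_integral do rewrite (cosTB _ icn icm ma).
have ic : mu.-integrable setT (EFin \o (fun x => cut f n x - cut f m x)).
  exact: (integrableB measurableT (integrable_cut n fl2) (integrable_cut m fl2)).
apply: (le_trans (bessel ic (measurable_cst a))).
rewrite (_ : e%:E = ((2 * pi) ^+ 3)%:E * (e / (2 * pi) ^+ 3)%:E)%E; last first.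
  by rewrite -EFinM; congr EFin; rewrite mulrC mulfVK// gt_eqF// pi3_gt0.
by rewrite lee_wpmul2l ?lee_fin ?(ltW (pi3_gt0 R))//; exact: NP.
Qed.

Lemma is_ft_exists (f : X -> R) : l2 f -> exists F1 F2, is_ft f F1 F2.
Proof.
move=> fl2; have [F1 mF1 H1] := cosT_cut_cauchy 0 fl2.
have [F2 mF2 H2] := cosT_cut_cauchy (pi / 2) fl2.
exists F1, F2; split => // e e0.
have e20 : 0 < e / 2 by rewrite divr_gt0.
have [[N1 N1P] [N2 N2P]] := (H1 _ e20, H2 _ e20).
exists (maxn N1 N2) => n; rewrite geq_max => /andP[n1 n2].
have mc a : measurable_fun setT (cosT (cut f n) (cst a)).
  by apply: measurable_cosT => //; exact: integrable_cut.
under eq_integral do rewrite EFinD.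
rewrite ge0_integralD//; last 4 first.
- by move=> x _; rewrite lee_fin sqr_ge0.
- by apply/measurable_EFinP; apply: measurable_funX; exact: measurable_funB.
- by move=> x _; rewrite lee_fin sqr_ge0.
- by apply/measurable_EFinP; apply: measurable_funX; exact: measurable_funB.
by rewrite [e]splitr EFinD leeD// ?N1P ?N2P.
Qed.

End plancherel.

(** * Fourier multipliers as pairings *)

Section multiplier.
Variable R : realType.
Local Notation mR := (measurableTypeR R).
Local Notation X := (mR * mR * mR)%type.
Local Notation mu := (@mu3 R).
Implicit Types (x : X).

(* The real part of the integral of [t z * (F1 z + i F2 z) * exp (i (dot x z + a))]. *)
Definition mult (t F1 F2 : X -> R) (a : R) (x : X) : R :=
  \int[mu]_z (t z * (F1 z * cos (dot x z + a) - F2 z * sin (dot x z + a))).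

Lemma l2D (f g : X -> R) : l2 f -> l2 g -> l2 (fun x => f x + g x).
Proof.
move=> [mf f2] [mg g2]; split; first exact: measurable_funD.
apply: (@le_lt_trans _ _ (\int[mu]_x (2%:E * ((f x ^+ 2)%:E + (g x ^+ 2)%:E)))%E).
  apply: ge0_le_integral => //.
  - by move=> x _; rewrite lee_fin sqr_ge0.
  - by apply/measurable_EFinP; apply: measurable_funX; exact: measurable_funD.
  - by apply: emeasurable_funM => //; apply: emeasurable_funD; apply/measurable_EFinP; exact: measurable_funX.
  - move=> x _; rewrite -EFinD -EFinM lee_fin -subr_ge0.
    by rewrite (_ : _ - _ = (f x - g x) ^+ 2) ?sqr_ge0//; ring.
have mf2 : measurable_fun setT (fun x => (f x ^+ 2)%:E) by apply/measurable_EFinP; exact: measurable_funX.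
have mg2 : measurable_fun setT (fun x => (g x ^+ 2)%:E) by apply/measurable_EFinP; exact: measurable_funX.
rewrite ge0_integralZl//; last 2 first.
  exact: emeasurable_funD.
  by move=> x _; rewrite adde_ge0// lee_fin sqr_ge0.
rewrite ge0_integralD//; [|by move=> x _; rewrite lee_fin sqr_ge0|by move=> x _; rewrite lee_fin sqr_ge0].
by rewrite lte_mul_pinfty// lte_add_pinfty.
Qed.

Lemma l2N (f : X -> R) : l2 f -> l2 (fun x => - f x).
Proof.
move=> [mf f2]; split; first exact: measurableT_comp.
by under eq_integral do rewrite sqrrN.
Qed.

Lemma l2_cosT (g a : X -> R) : mu.-integrable setT (EFin \o g) -> l2 g -> measurable_fun setT a ->
  l2 (cosT g a).
Proof.
move=> ig [mg g2] ma; split; first exact: measurable_cosT.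
apply: (le_lt_trans (bessel ig ma)).
by rewrite lte_mul_pinfty// ?lee_fin ?(ltW (pi3_gt0 R)).
Qed.

Lemma l2M_bounded (f h : X -> R) (C : R) : l2 f -> measurable_fun setT h -> (forall x, `|h x| <= C) ->
  l2 (fun x => f x * h x).
Proof.
move=> [mf f2] mh hC; split; first exact: measurable_funM.
apply: (@le_lt_trans _ _ (\int[mu]_x ((C ^+ 2)%:E * (f x ^+ 2)%:E))%E).
  apply: ge0_le_integral => //.
  - by move=> x _; rewrite lee_fin sqr_ge0.
  - by apply/measurable_EFinP; apply: measurable_funX; exact: measurable_funM.
  - by apply: emeasurable_funM => //; apply/measurable_EFinP; exact: measurable_funX.
  - move=> x _; rewrite -EFinM lee_fin exprMn mulrC ler_wpM2r ?sqr_ge0//.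
    by rewrite -(real_normK (num_real (h x))) lerXn2r ?nnegrE// (le_trans _ (hC x)).
rewrite ge0_integralZl//; last 3 first.
- by apply/measurable_EFinP; exact: measurable_funX.
- by move=> x _; rewrite lee_fin sqr_ge0.
- by rewrite lee_fin sqr_ge0.
by rewrite lte_mul_pinfty// lee_fin sqr_ge0.
Qed.

Lemma l2_cut (f : X -> R) n : l2 f -> l2 (cut f n).
Proof.
move=> fl2.
have := l2M_bounded (C := 1) fl2 (l2_indic_ball (ler0n R n)).1 _.
rewrite (_ : (fun x => _) = cut f n); first apply.
  by move=> x; rewrite indicE; case: (_ \in _); rewrite ?normr1 ?normr0.
by apply/funext => x; rewrite /cut patchE indicE; case: (_ \in _); rewrite ?mulr1 ?mulr0.
Qed.

Lemma le_l2 (f g : X -> R) : measurable_fun setT f -> l2 g -> (forall x, `|f x| <= `|g x|) -> l2 f.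
Proof.
move=> mf [mg g2] fg; split => //; apply: le_lt_trans g2; apply: ge0_le_integral => //.
- by move=> x _; rewrite lee_fin sqr_ge0.
- by apply/measurable_EFinP; exact: measurable_funX.
- by apply/measurable_EFinP; exact: measurable_funX.
- by move=> x _; rewrite lee_fin -(real_normK (num_real (f x))) -(real_normK (num_real (g x))) lerXn2r ?nnegrE.
Qed.

Lemma is_ft_l2 (f F1 F2 : X -> R) : l2 f -> is_ft f F1 F2 -> l2 F1 /\ l2 F2.
Proof.
move=> fl2 [mF1 mF2 H]; have [N /(_ N (leqnn N)) HN] := H 1 ltr01.
have l2c a : l2 (cosT (cut f N) (cst a)).
  by apply: l2_cosT => //; [exact: integrable_cut|exact: l2_cut].
have mc a := (l2c a).1.
have h (F C G D : X -> R) : measurable_fun setT F -> measurable_fun setT C ->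
   measurable_fun setT G -> measurable_fun setT D ->
   (\int[mu]_x ((F x - C x) ^+ 2 + (G x - D x) ^+ 2)%:E <= 1)%E -> l2 (fun x => F x - C x).
  move=> mF mC mG mD H1; split; first exact: measurable_funB.
  apply: (@le_lt_trans _ _ 1%E); last exact: ltry.
  apply: le_trans H1; apply: ge0_le_integral => //.
  - by move=> x _; rewrite lee_fin sqr_ge0.
  - by apply/measurable_EFinP; apply: measurable_funX; exact: measurable_funB.
  - by apply/measurable_EFinP; apply: measurable_funD; apply: measurable_funX; exact: measurable_funB.
  - by move=> x _; rewrite lee_fin lerDl sqr_ge0.
split.
- have := l2D (h _ _ _ _ mF1 (mc 0) mF2 (mc (pi / 2)) HN) (l2c 0).
  by under [X in l2 X -> _]eq_fun do rewrite subrK.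
- have HN' : (\int[mu]_x ((F2 x - cosT (cut f N) (cst (pi / 2)) x) ^+ 2 + (F1 x - cosT (cut f N) (cst 0) x) ^+ 2)%:E <= 1)%E.
    by under eq_integral do rewrite addrC.
  have := l2D (h _ _ _ _ mF2 (mc (pi / 2)) mF1 (mc 0) HN') (l2c (pi / 2)).
  by under [X in l2 X -> _]eq_fun do rewrite subrK.
Qed.

Lemma measurable_cosd (x : X) (a : R) : measurable_fun setT (fun z : X => cos (dot x z + a)).
Proof. by apply: measurable_cos_dot. Qed.

Lemma measurable_sind (x : X) (a : R) : measurable_fun setT (fun z : X => sin (dot x z + a)).
Proof.
apply: (measurableT_comp (f := @sin R)).
  by apply: continuous_measurable_fun; exact: continuous_sin.
by apply: measurable_funD => //; exact: measurable_dot.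
Qed.

Lemma integrable_mult (t F1 F2 : X -> R) a x : l2 t -> l2 F1 -> l2 F2 ->
  mu.-integrable setT (EFin \o (fun z => t z * (F1 z * cos (dot x z + a) - F2 z * sin (dot x z + a)))).
Proof.
move=> lt l1 l2_; apply: l2M_integrable => //; apply: l2D.
  by apply: (l2M_bounded (C := 1)) => //; [exact: measurable_cosd|move=> z; exact: cos_max].
apply: l2N; apply: (l2M_bounded (C := 1)) => //; [exact: measurable_sind|move=> z; exact: sin_max].
Qed.

Let mult_cut (f t : X -> R) (a : R) x n : l2 f -> l2 t -> mu.-integrable setT (EFin \o t) ->
  mult t (cosT (cut f n) (cst 0)) (cosT (cut f n) (cst (pi / 2))) a x =
  \int[mu]_y (cut f n y * cosT t (fun z => - dot x z - a) y).
Proof.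
move=> fl2 tl2 it.
have ic := integrable_cut n fl2.
pose kk (p : X * X) := cos (dot p.1 p.2 + (- dot x p.1 - a)).
have mkk : measurable_fun setT kk.
  apply: (measurable_cos_dot (f := fst) (g := snd) (a := fun p : X * X => - dot x p.1 - a)) => //.
  apply: measurable_funB => //; apply: (measurableT_comp (f := (-%R : R -> R))) => //.
  exact: measurable_dot.
have := Rfubini it ic mkk (fun p => cos_max _).
rewrite (_ : \int[mu]_y (cut f n y * \int[mu]_x0 (t x0 * kk (x0, y))) =
   \int[mu]_y (cut f n y * cosT t (fun z => - dot x z - a) y)); last first.
  apply: eq_Rintegral => y _; congr (_ * _); apply: eq_Rintegral => z _.
  by rewrite /kk /= dotC.
move=> <-; apply: eq_Rintegral => z _; congr (_ * _).
have i0 := integrable_cosT z ic (measurable_cst (0 : R)).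
have i1 := integrable_cosT z ic (measurable_cst (pi / 2 : R)).
rewrite /cosT -!RintegralZr// -RintegralB//; last 2 first.
- exact: (integrableZr measurableT _ i0).
- exact: (integrableZr measurableT _ i1).
apply: eq_Rintegral => y _; rewrite /kk /= addr0 cosDpihalf.
rewrite (_ : dot z y + _ = dot z y - (dot x z + a)); last by ring.
by rewrite cosB; ring.
Qed.

(** For the truncations [cut f n], which are integrable, the identity is Fubini's theorem. Both
    sides pass to the limit: the left by L^2 convergence of the transforms, the right by dominated
    convergence. *)
Lemma mult_rep (f F1 F2 t : X -> R) (a : R) x : l2 f -> is_ft f F1 F2 -> l2 t ->
  mu.-integrable setT (EFin \o t) ->
  mult t F1 F2 a x = \int[mu]_y (f y * cosT t (fun z => - dot x z - a) y).
Proof.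
move=> fl2 Ff tl2 it.
have [l1 l2_] := is_ft_l2 fl2 Ff; have [mF1 mF2 H] := Ff.
have mb : measurable_fun setT (fun z : X => - dot x z - a).
  apply: measurable_funB => //; apply: (measurableT_comp (f := (-%R : R -> R))) => //.
  exact: measurable_dot.
pose k := cosT t (fun z => - dot x z - a).
have kl2 : l2 k by exact: l2_cosT.
have ifk := l2M_integrable fl2 kl2.
have l2c n b : l2 (cosT (cut f n) (cst b)).
  by apply: l2_cosT => //; [exact: integrable_cut|exact: l2_cut].
have H1 : \int[mu]_y (cut f n y * k y) @[n --> \oo] --> \int[mu]_y (f y * k y).
  apply: (@Rdominated_cvg _ _ _ mu setT (fun n y => cut f n y * k y) (fun y => f y * k y)
    (fun y => `|f y * k y|) measurableT _ _ _ (integrable_norm ifk) _).2.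
  - by move=> n; apply: measurable_funM => //; [exact: measurable_cut fl2.1|exact: kl2.1].
  - by apply: measurable_funM => //; [exact: fl2.1|exact: kl2.1].
  - move=> y _; apply: cvgM; last exact: cvg_cst.
    apply: cvg_near_cst; near=> n; rewrite /cut patchE mem_set//=.
    by near: n; exact: nbhs_infty_ger.
  - move=> n y _; rewrite /cut patchE; case: ifP => // _.
    by rewrite mul0r normr0.
have H2 : mult t (cosT (cut f n) (cst 0)) (cosT (cut f n) (cst (pi / 2))) a x @[n --> \oo] --> mult t F1 F2 a x.
  apply/cvgrPdist_le => e e0.
  pose T2 := fine (\int[mu]_z (t z ^+ 2)%:E)%E.
  have T20 : 0 <= T2 by rewrite fine_ge0// integral_ge0// => z _; rewrite lee_fin sqr_ge0.
  (* The weight in p (q + r) <= dl p^2 + (q^2 + r^2) / (2 dl), with p = |t z|. As the transforms are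
     taken within [dl * e], each of the two terms integrates to at most [e / 2]. *)
  pose dl := e / 2 / (T2 + 1).
  have dl0 : 0 < dl by rewrite !divr_gt0// ltr_wpDl.
  have [N NP] := H (dl * e) (mulr_gt0 dl0 e0).
  exists N => // n Nn; have {NP}Hn := NP n Nn.
  set C := cosT _ (cst 0); set S := cosT _ (cst (pi / 2)).
  have [Cl2 Sl2] : l2 C /\ l2 S by split; exact: l2c.
  rewrite -RintegralB//; [|exact: integrable_mult|exact: integrable_mult].
  under eq_Rintegral do rewrite -mulrBr.
  have iD : mu.-integrable setT (EFin \o (fun z => t z * (F1 z * cos (dot x z + a) - F2 z * sin (dot x z + a) -
     (C z * cos (dot x z + a) - S z * sin (dot x z + a))))).
    apply: (eq_integrable _ _ _ _ (integrableB measurableT (integrable_mult a x tl2 l1 l2_) (integrable_mult a x tl2 Cl2 Sl2))) => //.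
    by move=> z _ /=; congr EFin; ring.
  apply: (le_trans (le_normr_Rintegral _ iD)) => //.
  have t2f : (\int[mu]_z (t z ^+ 2)%:E)%E \is a fin_num.
    by rewrite ge0_fin_numE; [exact: tl2.2|apply: integral_ge0 => z _; rewrite lee_fin sqr_ge0].
  rewrite -lee_fin fineK; last exact: (integrable_fin_num measurableT (integrable_norm iD)).
  have mt2 : measurable_fun setT (fun z => (t z ^+ 2)%:E).
    by apply/measurable_EFinP; apply: measurable_funX; exact: tl2.1.
  have mh2 : measurable_fun setT (fun z => ((F1 z - C z) ^+ 2 + (F2 z - S z) ^+ 2)%:E).
    apply/measurable_EFinP; apply: measurable_funD; apply: measurable_funX; apply: measurable_funB => //.
      exact: Cl2.1.
    exact: Sl2.1.
  apply: (@le_trans _ _ (\int[mu]_z (dl%:E * (t z ^+ 2)%:E + ((2 * dl)^-1)%:E * ((F1 z - C z) ^+ 2 + (F2 z - S z) ^+ 2)%:E))%E).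
    apply: ge0_le_integral => //.
    - exact: (measurable_int mu (integrable_norm iD)).
    - by apply: emeasurable_funD; exact: emeasurable_funM.
    - move=> z _; rewrite -!EFinM -EFinD lee_fin normrM.
      rewrite (_ : F1 z * _ - _ - _ = (F1 z - C z) * cos (dot x z + a) - (F2 z - S z) * sin (dot x z + a)); last by ring.
      apply: (@le_trans _ _ (`|t z| * (`|F1 z - C z| + `|F2 z - S z|))).
        rewrite ler_wpM2l// (le_trans (ler_normB _ _))// !normrM.
        by rewrite lerD// ler_piMr// ?cos_max ?sin_max.
      rewrite -(real_normK (num_real (t z))) -(real_normK (num_real (F1 z - C z))) -(real_normK (num_real (F2 z - S z))).
      move: `|t z| `|F1 z - C z| `|F2 z - S z| => p q r.
      rewrite -subr_ge0 (_ : _ - _ = (2 * dl)^-1 * ((q - dl * p) ^+ 2 + (r - dl * p) ^+ 2)); last by field; rewrite gt_eqF.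
      by apply: mulr_ge0; [rewrite invr_ge0 mulr_ge0// ltW|apply: addr_ge0; exact: sqr_ge0].
  rewrite ge0_integralD//; last 4 first.
  - by move=> z _; rewrite mule_ge0// lee_fin ?sqr_ge0// ltW.
  - exact: emeasurable_funM.
  - by move=> z _; rewrite mule_ge0// lee_fin ?addr_ge0 ?sqr_ge0// invr_ge0 mulr_ge0// ltW.
  - exact: emeasurable_funM.
  rewrite ge0_integralZl//; [|by move=> z _; rewrite lee_fin sqr_ge0|by rewrite lee_fin ltW].
  rewrite ge0_integralZl//; [|by move=> z _; rewrite lee_fin addr_ge0 ?sqr_ge0|by rewrite lee_fin invr_ge0 mulr_ge0// ltW].
  apply: (@le_trans _ _ (dl%:E * T2%:E + ((2 * dl)^-1)%:E * (dl * e)%:E)%E).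
    rewrite leeD//; first by rewrite fineK.
    by rewrite lee_wpmul2l// lee_fin invr_ge0 mulr_ge0// ltW.
  rewrite -!EFinM -EFinD lee_fin (_ : (2 * dl)^-1 * (dl * e) = e / 2); last by field; rewrite gt_eqF.
  rewrite [leRHS](_ : _ = e / 2 + e / 2); last by field.
  rewrite lerD2r /dl mulrAC ler_pdivrMr ?ltr_wpDl// ler_wpM2l ?divr_ge0 ?(ltW e0)//.
  by rewrite lerDl.
rewrite -(cvg_lim _ H2)// -(cvg_lim _ H1)//; congr (lim (_ @ \oo)).
by apply/funext => n; exact: mult_cut.
Unshelve. all: by end_near. Qed.

End multiplier.

Section fourier_facts.
Variable R : realType.
Local Notation mR := (measurableTypeR R).
Local Notation X := (mR * mR * mR)%type.
Local Notation mu := (@mu3 R).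
Implicit Types (x : X).

Lemma ge0_cvge0P (u : (\bar R)^nat) : (forall n, 0 <= u n)%E ->
  (u @ \oo --> 0%E) <-> (forall e : R, 0 < e -> exists N, forall n, (N <= n)%N -> (u n <= e%:E)%E).
Proof.
move=> u0; split=> [/fine_cvgP[[N1 _ N1P] uc] e e0|H].
  move/cvgrPdist_le : uc => /(_ _ e0)[N2 _ N2P].
  exists (maxn N1 N2) => n; rewrite geq_max => /andP[n1 n2].
  rewrite -(fineK (N1P _ n1)) lee_fin.
  by have := N2P _ n2; rewrite /= sub0r normrN; apply: le_trans; exact: ler_norm.
apply/fine_cvgP; split.
  have [N NP] := H 1 ltr01; exists N => // n /= Nn.
  by rewrite ge0_fin_numE// (le_lt_trans (NP _ Nn))// ltry.
apply/cvgrPdist_le => e e0; have [N NP] := H e e0; exists N => // n /= Nn.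
rewrite sub0r normrN ger0_norm ?fine_ge0// -lee_fin fineK ?NP//.
by rewrite ge0_fin_numE// (le_lt_trans (NP _ Nn))// ltry.
Qed.

Lemma le_poweR_half (A : \bar R) (e : R) : (0 <= A)%E -> 0 <= e ->
  (poweR A 2^-1 <= e%:E)%E = (A <= (e ^+ 2)%:E)%E.
Proof.
move=> A0 e0.
have A0' : A \in `[0, +oo]%E by rewrite in_itv/= A0 leey.
have E : (poweR (e ^+ 2)%:E 2^-1 = e%:E)%E.
  by rewrite poweR_EFin powR12_sqrt ?sqr_ge0// sqrtr_sqr ger0_norm.
have h20 : 0 <= 2^-1 :> R by rewrite invr_ge0.
apply/idP/idP => [H|H].
  have h2 : 0 <= 2 :> R by [].
  have p0 : (poweR A 2^-1)%E \in `[0, +oo]%E by rewrite in_itv/= poweR_ge0 leey.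
  have e0' : e%:E \in `[0, +oo]%E by rewrite in_itv/= lee_fin e0 leey.
  have := gt0_ler_poweR h2 p0 e0' H.
  by rewrite -poweRrM mulVf// poweRe1// poweR_EFin -(powR_mulrn 2).
rewrite -E; apply: gt0_ler_poweR => //.
by rewrite in_itv/= lee_fin sqr_ge0 leey.
Qed.

Lemma Lnorm2E (h : X -> R) : Lnorm mu 2%:E (EFin \o h) = poweR (\int[mu]_x (h x ^+ 2)%:E)%E 2^-1.
Proof.
rewrite unlock /Lnorm; congr poweR; apply: eq_integral => x _ /=.
by rewrite powR_mulrn// real_normK ?num_real.
Qed.

Lemma trunc_fourierE (f : X -> R) n (z : X) :
  trunc_fourier f n z = Complex (cosT (cut f n) (cst 0) z) (cosT (cut f n) (cst (pi / 2)) z).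
Proof.
rewrite /trunc_fourier /cintegral; congr Complex.
  rewrite Rintegral_mkcond; apply: eq_Rintegral => x _.
  rewrite /cut !patchE; case: ifP => _; last by rewrite mul0r.
  by rewrite /= mul0r subr0 addr0 cosN dotC.
rewrite Rintegral_mkcond; apply: eq_Rintegral => x _.
rewrite /cut !patchE; case: ifP => _; last by rewrite mul0r.
by rewrite /= mul0r addr0 cosDpihalf sinN dotC.
Qed.

Lemma is_fourierP (f : X -> R) (F : R3 R -> R[i]) : l2 f ->
  is_fourier f F <-> is_ft f (fun z => complex.Re (F z)) (fun z => complex.Im (F z)).
Proof.
move=> fl2.
pose A n := (\int[mu]_x ((complex.Re (F x) - cosT (cut f n) (cst 0) x) ^+ 2 +
      (complex.Im (F x) - cosT (cut f n) (cst (pi / 2)) x) ^+ 2)%:E)%E.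
have A0 n : (0 <= A n)%E by apply: integral_ge0 => x _; rewrite lee_fin addr_ge0 ?sqr_ge0.
have E n : Lnorm mu 2%:E (fun xi => (Normc.normc (F xi - trunc_fourier f n xi))%:E) = poweR (A n) 2^-1.
  rewrite [LHS](Lnorm2E (fun xi => Normc.normc (F xi - trunc_fourier f n xi))).
  congr poweR; apply: eq_integral => x _; congr EFin; rewrite trunc_fourierE.
  by case: (F x) => a b /=; rewrite sqr_sqrtr// addr_ge0 ?sqr_ge0.
split=> [[m1 m2 H]|[m1 m2 H]]; split=> //.
  move=> e e0; move: H; under eq_fun do rewrite E.
  move=> /(@ge0_cvge0P _ (fun n => poweR_ge0 _ _))/(_ (Num.sqrt e)); rewrite sqrtr_gt0 => /(_ e0)[N NP].
  exists N => n Nn; have := NP _ Nn; rewrite le_poweR_half ?sqrtr_ge0// sqr_sqrtr//; exact: ltW.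
under eq_fun do rewrite E.
apply/(@ge0_cvge0P _ (fun n => poweR_ge0 _ _)) => e e0.
have [N NP] := H (e ^+ 2) (exprn_gt0 _ e0).
by exists N => n Nn; rewrite le_poweR_half ?(ltW e0)//; exact: NP.
Qed.

(** [fourier] is a choice with default value 0, so it has the defining property only once a
    transform is known to exist. *)
Lemma fourier_ft (f : X -> R) : l2 f ->
  is_ft f (fun z => complex.Re (fourier f z)) (fun z => complex.Im (fourier f z)).
Proof.
move=> fl2; apply/is_fourierP => //; apply: (@xgetPex _ (fun=> 0) [set F | is_fourier f F]).
have [F1 [F2 H]] := is_ft_exists fl2.
by exists (fun z => Complex (F1 z) (F2 z)); apply/is_fourierP.
Qed.

(** The multiplier with symbol [t] applied to [f]. The phase [a] multiplies the symbol by exp(i a);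
    with [a = pi / 2] it supplies the factor i of a derivative, as in [Delta_curl_fmult]. *)
Definition fmult (f t : X -> R) (a : R) (x : X) : R :=
  (2 * pi) ^- 3 * mult t (fun z => complex.Re (fourier f z)) (fun z => complex.Im (fourier f z)) a x.

Lemma fmult_rep (f t : X -> R) (a : R) x : l2 f -> l2 t -> mu.-integrable setT (EFin \o t) ->
  fmult f t a x = (2 * pi) ^- 3 * \int[mu]_y (f y * cosT t (fun z => - dot x z - a) y).
Proof.
move=> fl2 tl2 it; rewrite /fmult; congr (_ * _).
by apply: mult_rep => //; exact: fourier_ft.
Qed.

Lemma Delta_fmult (chi : R3 R -> R) q (f : vfield R) i (x : X) :
  Delta chi q f i x = fmult (f i) (lp_symbol chi q) 0 x.
Proof.
rewrite /Delta /lp_block /inv_fourier /cintegral /fmult /mult /= mul0r subr0; congr (_ * _).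
apply: eq_Rintegral => z _; case: (fourier (f i) z) => a b /=.
by rewrite addr0; ring.
Qed.

Lemma Delta_curl_fmult (chi : R3 R -> R) q (f : vfield R) i (x : X) :
  (forall j, l2 (f j)) -> (forall j, l2 (fun z => lp_symbol chi q z * crd z j)) ->
  Delta_curl chi q f i x =
  fmult (f (i + 2%:R)) (fun z => lp_symbol chi q z * crd z (i + 1)) (pi / 2) x -
  fmult (f (i + 1)) (fun z => lp_symbol chi q z * crd z (i + 2%:R)) (pi / 2) x.
Proof.
move=> fl2 tl2.
have fl j := is_ft_l2 (fl2 j) (fourier_ft (fl2 j)).
rewrite /fmult -mulrBr /Delta_curl /lp_block /inv_fourier /cintegral /mult /= mul0r subr0; congr (_ * _).
rewrite -RintegralB//; last 2 first.
- by apply: integrable_mult => //; [exact: (fl _).1|exact: (fl _).2].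
- by apply: integrable_mult => //; [exact: (fl _).1|exact: (fl _).2].
apply: eq_Rintegral => z _; rewrite /curl_hat.
case: (fourier (f (i + 2%:R)) z) => a b; case: (fourier (f (i + 1)) z) => c d /=.
by rewrite cosDpihalf sinDpihalf; ring.
Qed.

Lemma vLnorm2_l2 (f : vfield R) : L2 f -> forall i, l2 (f i).
Proof.
move=> [mf]; rewrite /vLnorm [Lnorm _ _ _](Lnorm2E (vabs f)) => H i.
have mf' j : measurable_fun setT (f j : X -> R) by exact: mf.
split; first exact: mf'.
have : (\int[mu]_x (vabs f x ^+ 2)%:E < +oo)%E.
  rewrite ltey; apply/negP => /eqP E; move: H.
  by rewrite E poweRyr ?invr_eq0// ltxx.
apply: le_lt_trans; apply: ge0_le_integral => //.
- by move=> x _; rewrite lee_fin sqr_ge0.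
- by apply/measurable_EFinP; exact: measurable_funX.
- apply/measurable_EFinP; apply: measurable_funX.
  apply: (measurableT_comp (f := @Num.sqrt R)).
    by apply: continuous_measurable_fun; exact: sqrt_continuous.
  by apply: measurable_sum => j; exact: measurable_funX.
- move=> x _; rewrite lee_fin /vabs sqr_sqrtr; last by apply: sumr_ge0 => j _; exact: sqr_ge0.
  by rewrite (bigD1 i)//= lerDl; apply: sumr_ge0 => j _; exact: sqr_ge0.
Qed.

Lemma l2_vLnorm2 (f : vfield R) : (forall i, l2 (f i)) -> L2 f.
Proof.
move=> fl2; have mf j := (fl2 j).1; split => //.
rewrite /vLnorm [Lnorm _ _ _](Lnorm2E (vabs f)).
have vE x : vabs f x ^+ 2 = \sum_i f i x ^+ 2.
  by rewrite /vabs sqr_sqrtr//; apply: sumr_ge0 => j _; exact: sqr_ge0.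
under eq_integral do rewrite vE -sumEFin.
rewrite ge0_integral_sum//; last 2 first.
- by move=> i; apply/measurable_EFinP; exact: measurable_funX.
- by move=> i x _; rewrite lee_fin sqr_ge0.
set S := (\sum_(i < 3) _)%E.
have S0 : (0 <= S)%E by apply: sume_ge0 => i _; apply: integral_ge0 => x _; rewrite lee_fin sqr_ge0.
have Sy : (S < +oo)%E by apply: lte_sum_pinfty => i _; exact: (fl2 i).2.
by rewrite -(fineK (_ : S \is a fin_num)) ?poweR_EFin ?ltry// ge0_fin_numE.
Qed.

End fourier_facts.

(** * Symbols of the Littlewood-Paley blocks *)

Section symbols.
Variable R : realType.
Local Notation mR := (measurableTypeR R).
Local Notation X := (mR * mR * mR)%type.
Local Notation mu := (@mu3 R).
Implicit Types (x : X).

Definition bounded_symbol (t : X -> R) (B r : R) :=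
  [/\ measurable_fun setT t, forall z, `|t z| <= B & forall z, r < enorm z -> t z = 0].

Lemma bounded_symbol_le (t : X -> R) (B r : R) z : bounded_symbol t B r ->
  `|t z| <= B * \1_[set x : X | enorm x <= r] z.
Proof.
move=> [mt tB t0]; rewrite indicE; case: (boolP (z \in _)) => [_|]; first by rewrite mulr1.
by rewrite notin_setE /= => /negP; rewrite -ltNge => /t0 ->; rewrite normr0 mulr0.
Qed.

Lemma bounded_symbol_l2 (t : X -> R) (B r : R) : 0 <= r -> bounded_symbol t B r -> l2 t.
Proof.
move=> r0 tt; have il := l2_indic_ball r0.
have B0 : 0 <= B by have [_ tB _] := tt; exact: le_trans (tB point).
apply: (@le_l2 _ _ (fun z => \1_[set x : X | enorm x <= r] z * B)); first by case: tt.
  by apply: (l2M_bounded (C := B)) => // z; rewrite ger0_norm.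
move=> z; apply: (le_trans (bounded_symbol_le z tt)).
by rewrite mulrC ler_norm.
Qed.

Lemma bounded_symbol_integrable (t : X -> R) (B r : R) : 0 <= r -> bounded_symbol t B r ->
  mu.-integrable setT (EFin \o t).
Proof.
move=> r0 tt; have tl2 := bounded_symbol_l2 r0 tt.
have := l2M_integrable tl2 (l2_indic_ball r0); apply: eq_integrable => // z _ /=.
congr EFin; rewrite indicE; case: (boolP (z \in _)) => [_|]; first by rewrite mulr1.
by rewrite notin_setE /= => /negP; rewrite -ltNge mulr0; case: tt => _ _ t0 /t0 ->.
Qed.

Lemma measurable_crd i : measurable_fun setT (fun z : X => crd z i).
Proof.
case: i => -[|[|[|//]]] /= ?; rewrite /crd /=.
- exact: measurable_fst3.
- exact: measurable_snd3.
- exact: measurable_thd3.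
Qed.

Lemma crd_enorm (x : R3 R) i : `|crd x i| <= enorm x.
Proof. by have [h1 h2 h3] := crd_le_enorm x; case: i => -[|[|[|//]]] /= ?; rewrite /crd. Qed.

Lemma bounded_symbol_crd (t : X -> R) (B r : R) i : 0 <= r -> bounded_symbol t B r ->
  bounded_symbol (fun z => t z * crd z i) (B * r) r.
Proof.
move=> r0 [mt tB t0]; split.
- by apply: measurable_funM => //; exact: measurable_crd.
- move=> z; have B0 : 0 <= B by exact: le_trans (tB point).
  have [zr|zr] := leP (enorm z) r; last by rewrite t0// mul0r normr0 mulr_ge0.
  by rewrite normrM ler_pM// (le_trans (crd_enorm z i)).
- by move=> z /t0 ->; rewrite mul0r.
Qed.

Lemma enormZ (a : R) (x : R3 R) : enorm (a *: x) = `|a| * enorm x.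
Proof.
rewrite /enorm !dotE /=.
rewrite (_ : _ + _ = a ^+ 2 * (x.1.1 * x.1.1 + x.1.2 * x.1.2 + x.2 * x.2)); last first.
  by rewrite -![_ *: _]/(_ * _); ring.
by rewrite sqrtrM ?sqr_ge0// sqrtr_sqr.
Qed.

Lemma enorm_oppx x : enorm (oppx x) = enorm x.
Proof. by rewrite /enorm !dotE /=; congr Num.sqrt; ring. Qed.

Lemma enorm_ge0 (x : R3 R) : 0 <= enorm x. Proof. exact: sqrtr_ge0. Qed.

Variable chi : R3 R -> R.
Hypothesis hchi : cutoff chi.

Lemma cutoff_continuous : continuous chi.
Proof. by case: hchi => /(_ [::]) []. Qed.

Let chi0 (s : R) := chi (s, 0, 0).

Let chi0E x : chi x = chi0 (enorm x).
Proof.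
apply: cutoff_radial => //; rewrite {2}/enorm dotE /= !mulr0 !addr0 -expr2 sqrtr_sqr.
by rewrite ger0_norm ?enorm_ge0.
Qed.

Let continuous_chi0 : continuous chi0.
Proof.
move=> s; apply: (@continuous_comp R (R * R * R)%type R (fun s => (s, 0, 0)) chi).
  apply: (@cvg_pair _ _ _ (nbhs s) (nbhs (s, 0 : R)) (nbhs (0 : R)) _ _ _ (fun s : R => (s, 0 : R)) (fun=> 0)); last exact: cvg_cst.
  apply: (@cvg_pair _ _ _ (nbhs s) (nbhs s) (nbhs (0 : R)) _ _ _ (fun s : R => s) (fun=> 0)); [exact: cvg_id|exact: cvg_cst].
exact: cutoff_continuous.
Qed.

(** Since [chi] is radial and vanishes from radius 1 on, the extreme value theorem for its profile
    on [0, 1] is enough. *)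
Lemma cutoff_bounded : exists2 B : R, 0 <= B & forall x : R3 R, `|chi x| <= B.
Proof.
have [c cI cP] : exists2 c, c \in `[0, 1]%R & forall t, t \in `[0, 1]%R -> chi0 t <= chi0 c.
  by apply: EVT_max => //; apply: continuous_subspaceT => s; exact: continuous_chi0.
exists (chi0 c); first exact: cutoff_ge0.
move=> x; rewrite ger0_norm; last exact: cutoff_ge0.
have [x1|x1] := ltP (enorm x) 1.
  by rewrite chi0E cP// in_itv/= enorm_ge0 ltW.
by rewrite cutoff_outer//; exact: cutoff_ge0.
Qed.

Definition chis (s : R) (x : X) : R := chi (s *: (x : R3 R)).

(** Radial symmetry gives measurability for the product sigma-algebra: the function is a continuous
    profile composed with the measurable [enorm]. *)
Lemma measurable_chis s : measurable_fun setT (chis s).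
Proof.
rewrite (_ : chis s = chi0 \o (fun x => `|s| * enorm x)); last first.
  by apply/funext => x; rewrite /chis chi0E enormZ.
apply: measurableT_comp; first by apply: continuous_measurable_fun; exact: continuous_chi0.
by apply: measurable_funM => //; exact: measurable_enorm.
Qed.

Lemma continuous_chis s : continuous (chis s : R3 R -> R).
Proof.
move=> x; apply: (@continuous_comp _ _ _ (fun x : R3 R => s *: x) chi).
  exact: scaler_continuous.
exact: cutoff_continuous.
Qed.

Lemma chis_oppx s x : chis s (oppx x) = chis s x.
Proof. by rewrite /chis chi0E enormZ enorm_oppx [RHS]chi0E enormZ. Qed.

Lemma chis_outer s x : 0 < s -> s^-1 <= enorm x -> chis s x = 0.
Proof.
by move=> s0 sx; rewrite /chis cutoff_outer// enormZ gtr0_norm// -(@mulfV _ s) ?gt_eqF// ler_pM2l.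
Qed.

Lemma chis_inner s x : 0 < s -> enorm x <= 3 / 4 * s^-1 -> chis s x = 1.
Proof.
move=> s0 sx; rewrite /chis cutoff_inner// enormZ gtr0_norm//.
by rewrite mulrC -ler_pdivlMr.
Qed.

Lemma bounded_symbol_chis : exists2 B : R, 0 <= B & forall s, 0 < s -> bounded_symbol (chis s) B s^-1.
Proof.
have [B B0 BP] := cutoff_bounded; exists B => // s s0; split.
- exact: measurable_chis.
- by move=> z; exact: BP.
- by move=> z zs; apply: chis_outer => //; exact: ltW.
Qed.

Lemma lambda_gt0 q : 0 < lambda R q. Proof. by rewrite exprz_gt0. Qed.

Lemma lambdaS q : lambda R (q + 1) = 2 * lambda R q.
Proof. by rewrite /lambda expfzDr ?expr1z 1?mulrC. Qed.

(** A difference of dilated cutoffs for every [q >= -1], with the subtracted one absent for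
    [q = -1]; in this form sums of symbols telescope. *)
Lemma lp_symbolE q x : (-1 <= q) -> lp_symbol chi q x =
  chis (lambda R (q + 1))^-1 x - (if 0 <= q then chis (lambda R q)^-1 x else 0).
Proof.
move=> q1; rewrite /lp_symbol; case: ifPn => q0.
  by rewrite /lp_phi /chis scalerA lambdaS invfM.
have -> : q = -1 by lia.
by rewrite /= subr0 /chis /lambda expr0z invr1 scale1r.
Qed.

Lemma lp_symbol_bounded : exists2 B : R, 0 <= B & forall q, -1 <= q ->
  bounded_symbol (lp_symbol chi q) B (2 * lambda R q).
Proof.
have [B B0 BP] := bounded_symbol_chis.
exists (B + B); first exact: addr_ge0.
move=> q q1.
have l0 p : 0 < (lambda R p)^-1 by rewrite invr_gt0 lambda_gt0.
have [m1 b1 z1] := BP _ (l0 (q + 1)); have [m2 b2 z2] := BP _ (l0 q).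
split.
- rewrite (_ : lp_symbol chi q = (fun x : X => chis (lambda R (q + 1))^-1 x - (if 0 <= q then chis (lambda R q)^-1 x else 0))); last by apply/funext => x; exact: lp_symbolE.
  by case: (0 <= q); exact: measurable_funB.
- move=> z; rewrite lp_symbolE// (le_trans (ler_normB _ _))// lerD//.
  by case: ifP => // _; rewrite normr0.
- move=> z zq; rewrite lp_symbolE// z1 ?invrK ?lambdaS// sub0r; case: ifP => _; rewrite ?oppr0//.
  rewrite z2 ?oppr0// invrK; apply: le_lt_trans zq.
  by rewrite ler_peMl ?(ltW (lambda_gt0 _))// ler1n.
Qed.

Lemma lp_symbol_inner q x : 0 <= q -> enorm x <= 3 / 4 * lambda R q -> lp_symbol chi q x = 0.
Proof.
move=> q0 xq; rewrite lp_symbolE ?q0; last by lia.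
have l0 p : 0 < (lambda R p)^-1 by rewrite invr_gt0 lambda_gt0.
rewrite !chis_inner ?invrK ?subrr// lambdaS (le_trans xq)//.
by have := lambda_gt0 q; lra.
Qed.

Lemma lp_symbol_oppx q x : -1 <= q -> lp_symbol chi q (oppx x) = lp_symbol chi q x.
Proof. by move=> q1; rewrite !lp_symbolE// !chis_oppx. Qed.

Lemma lp_symbol_continuous q : -1 <= q -> continuous (lp_symbol chi q).
Proof.
move=> q1 x; rewrite (_ : lp_symbol chi q = (fun x : X => chis (lambda R (q + 1))^-1 x - (if 0 <= q then chis (lambda R q)^-1 x else 0))); last by apply/funext => z; exact: lp_symbolE.
apply: cvgB; first exact: continuous_chis.
by case: (0 <= q); [exact: continuous_chis|exact: cvg_cst].
Qed.

Lemma sum_lp_symbol n x : \sum_(0 <= k < n.+1) lp_symbol chi (k%:Z - 1) x = chis (lambda R n%:Z)^-1 x.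
Proof.
elim: n => [|n IH].
  by rewrite big_nat1 lp_symbolE//= subr0.
rewrite big_nat_recr//= IH lp_symbolE; last by lia.
have -> : (n.+1%:Z - 1 : int) = n%:Z by lia.
rewrite /= (_ : n%:Z + 1 = n.+1%:Z); last by lia.
by rewrite addrC subrK.
Qed.

End symbols.

(** * Bernstein and Nikol'skii inequalities *)

Section arcsin.
Variable R : realType.
Implicit Types (x : R) (n N : nat).

(* [asin_sum N x] is a Taylor sum of arcsin evaluated at [sin x]; its second
   derivative [- asin_tail N x] is a single term because the sum telescopes. *)
Fixpoint asin_coef n : R :=
  if n is m.+1 then asin_coef m * ((2 * m + 1)%:R / (2 * m + 2)%:R) else 1.

Definition asin_sum N x : R := \sum_(n < N) asin_coef n / (2 * n + 1)%:R * sin x ^+ (2 * n + 1).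
Definition asin_sum' N x : R := \sum_(n < N) asin_coef n * (cos x * sin x ^+ (2 * n)).
Definition asin_tail n x : R := (2 * n)%:R * asin_coef n * sin x ^+ (2 * n).-1.

Lemma asin_coef_bounds n : 0 <= asin_coef n <= 1.
Proof.
elim: n => [|n /andP[h0 h1]] /=; first by rewrite ler01 lexx.
rewrite mulr_ge0 ?divr_ge0//= mulr_ile1// ?divr_ge0//.
by rewrite ler_pdivrMr ?ltr0n ?addnS// mul1r ler_nat; lia.
Qed.

Lemma is_derive_sinX n x : is_derive x (1 : R) (fun y => sin y ^+ n) (n%:R * sin x ^+ n.-1 * cos x).
Proof.
elim: n => [|n IH].
  by under eq_fun do rewrite expr0; rewrite !mul0r; exact: is_derive_cst.
have E : (fun y => sin y ^+ n.+1) = (sin : R -> R) * (fun y => sin y ^+ n).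
  by apply/funext => y; rewrite exprS.
rewrite E; apply: (is_derive_eq (is_deriveM (is_derive_sin x) IH)).
rewrite -[LHS]/(sin x * (n%:R * sin x ^+ n.-1 * cos x) + sin x ^+ n * cos x).
by case: n {IH E} => [|n]; rewrite /= ?expr0 ?exprS -?natr1; ring.
Qed.

Lemma is_derive_asin_sum N x : is_derive x (1 : R) (asin_sum N) (asin_sum' N x).
Proof.
elim: N => [|N IH].
  rewrite /asin_sum /asin_sum' big_ord0; under eq_fun do rewrite big_ord0.
  exact: is_derive_cst.
have h := is_deriveZ (asin_coef N / (2 * N + 1)%:R) (is_derive_sinX (2 * N + 1) x).
have -> : asin_sum N.+1 = asin_sum N + ((asin_coef N / (2 * N + 1)%:R) \*: (fun y : R => sin y ^+ (2 * N + 1))).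
  by apply/funext => y; rewrite /asin_sum big_ord_recr.
apply: (is_derive_eq (is_deriveD IH h)); rewrite /asin_sum' big_ord_recr /=; congr (_ + _).
rewrite -[LHS]/(_ * _) addn1 /= -addn1.
have ? : (2 * N + 1)%:R != 0 :> R by rewrite pnatr_eq0 addn1.
by field.
Qed.

(** By cos^2 = 1 - sin^2 and the recursion of the coefficients, the derivative of the summand of
    index [N] is [asin_tail N x - asin_tail N.+1 x]. *)
Lemma is_derive_asin_sum' N x : is_derive x (1 : R) (asin_sum' N) (- asin_tail N x).
Proof.
elim: N => [|N IH].
  rewrite /asin_sum' /asin_tail /= !mul0r oppr0; under eq_fun do rewrite big_ord0.
  exact: is_derive_cst.
have h := is_deriveZ (asin_coef N) (is_deriveM (is_derive_cos x) (is_derive_sinX (2 * N) x)).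
have -> : asin_sum' N.+1 = asin_sum' N + (asin_coef N \*: ((cos : R -> R) * (fun y : R => sin y ^+ (2 * N)))).
  by apply/funext => y; rewrite /asin_sum' big_ord_recr.
apply: (is_derive_eq (is_deriveD IH h)); rewrite -[X in _ + X]/(_ * (_ * _ + _ * _)).
rewrite /asin_tail [asin_coef N.+1]/=.
have ? : (2 * N + 2)%:R != 0 :> R by rewrite pnatr_eq0 addn2.
have -> : (2 * N.+1)%N = (2 * N + 2)%N by lia.
have -> : (2 * N + 2).-1 = (2 * N + 1)%N by lia.
have -> : (2 * N + 2)%:R * (asin_coef N * ((2 * N + 1)%:R / (2 * N + 2)%:R)) = (2 * N + 1)%:R * asin_coef N by field.
have c2 : cos x * cos x = 1 - sin x ^+ 2 by rewrite -(cos2Dsin2 x); ring.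
have [->|N0] := posnP N; first by rewrite muln0 /= !mul0r; ring.
set m := (2 * N).-1; have -> : (2 * N)%N = m.+1 by rewrite /m; lia.
rewrite natrD (_ : cos x * (m.+1%:R * sin x ^+ m * cos x) = m.+1%:R * sin x ^+ m * (cos x * cos x)); last by ring.
rewrite c2 addn1 /= !exprS; ring.
Qed.

Lemma asin_tail_ge0 N x : 0 <= sin x -> 0 <= asin_tail N x.
Proof.
move=> s0; have /andP[? _] := asin_coef_bounds N.
by rewrite /asin_tail mulr_ge0 ?exprn_ge0// mulr_ge0.
Qed.

Lemma asin_sum'0 N : (0 < N)%N -> asin_sum' N 0 = 1.
Proof.
case: N => // N _; rewrite /asin_sum' big_ord_recl /= muln0 expr0 !mulr1 cos0 mulr1.
rewrite big1 ?addr0// => i _; rewrite sin0 /bump /= expr0n.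
by rewrite mulr0 mulr0.
Qed.

Lemma asin_sum0 N : asin_sum N 0 = 0.
Proof.
by rewrite /asin_sum big1// => i _; rewrite sin0 expr0n addn1 mulr0.
Qed.

Lemma MVT_is_derive (f df : R -> R) (a b : R) : a < b -> (forall x, is_derive x (1 : R) f (df x)) ->
  exists2 c, a < c < b & f b - f a = df c * (b - a).
Proof.
move=> ab fdf.
have [|c cab E] := @MVT R f df a b ab (fun x _ => fdf x).
  apply: continuous_subspaceT => x; apply/differentiable_continuous/derivable1_diffP.
  by case: (fdf x).
by exists c => //; move: cab; rewrite in_itv.
Qed.

Lemma sin_le_id x : 0 <= x -> sin x <= x.
Proof.
rewrite le_eqVlt => /predU1P[<-|x0]; first by rewrite sin0.
have [c _] := MVT_is_derive x0 (fun y => is_derive_sin y).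
by rewrite sin0 !subr0 => ->; rewrite ler_piMl ?cos_le1// ltW.
Qed.

Let sin_ge0_pihalf x : 0 <= x <= pi / 2 -> 0 <= sin x.
Proof.
move=> /andP[x0 xp]; apply: sin_ge0_pi; rewrite x0 (le_trans xp)//.
by have := pi_gt0 R; lra.
Qed.

(** The value at 0 is 1, and on [0, pi/2] the sine is nonnegative, so the derivative [- asin_tail]
    is at most 0. *)
Lemma asin_sum'_le1 N x : 0 <= x <= pi / 2 -> asin_sum' N x <= 1.
Proof.
case: N => [|N]; first by rewrite /asin_sum' big_ord0.
move=> /andP[]; rewrite le_eqVlt => /predU1P[<- _|x0 xp]; first by rewrite asin_sum'0.
have [c /andP[c0 cx]] := MVT_is_derive x0 (fun y => is_derive_asin_sum' N.+1 y).
rewrite asin_sum'0// subr0 => /eqP; rewrite subr_eq => /eqP ->.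
rewrite -lerBrDr subrr mulNr oppr_le0 mulr_ge0 ?(ltW x0)//.
by apply/asin_tail_ge0/sin_ge0_pihalf; rewrite (ltW c0) (le_trans (ltW cx)).
Qed.

(** At pi/2 the sine is 1, so the sum is the value of [asin_sum] there; the mean value theorem
    applies because its derivative is at most 1 on [0, pi/2]. *)
Lemma asin_coef_sum_le N : \sum_(n < N) asin_coef n / (2 * n + 1)%:R <= pi / 2.
Proof.
have p0 : 0 < pi / 2 :> R by rewrite divr_gt0// pi_gt0.
have [c /andP[c0 cx]] := MVT_is_derive p0 (fun y => is_derive_asin_sum N y).
rewrite asin_sum0 !subr0 /asin_sum sin_pihalf.
under eq_bigr do rewrite expr1n mulr1.
move=> ->; rewrite ler_piMl ?(ltW p0)//; apply: asin_sum'_le1.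
by rewrite (ltW c0) ltW.
Qed.

Let asin_tail_le N x : (0 < N)%N -> 0 <= x <= 2^-1 -> asin_tail N x <= 4 * 2^-1 ^+ N.
Proof.
move=> N0 /andP[x0 x1].
have xp : 0 <= x <= pi / 2 by rewrite x0/= (le_trans x1)// (le_trans _ (pihalf_ge1 R))// invf_le1// ler1n.
have s0 := sin_ge0_pihalf xp.
have s1 : sin x <= 2^-1 by rewrite (le_trans (sin_le_id x0)).
have /andP[? ?] := asin_coef_bounds N.
rewrite /asin_tail; apply: (@le_trans _ _ ((2 * N)%:R * 2^-1 ^+ (2 * N).-1)).
  apply: ler_pM; rewrite ?exprn_ge0 ?mulr_ge0//; first by rewrite ler_piMr.
  by rewrite lerXn2r ?nnegrE ?invr_ge0.
(* The tail is at most 4 N 4^-N; one factor 2^-N absorbs [N] and the other one is kept. *)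
have NN : N%:R <= 2 ^+ N :> R by rewrite -natrX ler_nat ltnW// ltn_expl.
have -> : 2^-1 ^+ (2 * N).-1 = 2 * (2^-1 ^+ N * 2^-1 ^+ N) :> R.
  rewrite -exprD (_ : (N + N)%N = (2 * N).-1.+1); last by lia.
  by rewrite exprS mulrA mulfV// mul1r.
rewrite natrM (_ : _ * _ = 4 * (2^-1 ^+ N) * (2^-1 ^+ N * N%:R)); last by ring.
by rewrite ler_piMr ?mulr_ge0 ?exprn_ge0 ?invr_ge0// exprVn ler_pdivrMl ?exprn_gt0// mulr1.
Qed.

(** At 0 the function [asin_sum N] agrees with the identity to first order, so two applications of
    the mean value theorem bound the difference by the second derivative, which is minus
    [asin_tail N]. *)
Let asin_sum_approx_ge0 N x : (0 < N)%N -> 0 <= x <= 2^-1 -> `|asin_sum N x - x| <= 4 * 2^-1 ^+ N.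
Proof.
move=> N0 /andP[]; rewrite le_eqVlt => /predU1P[<- _|x0 x1].
  by rewrite asin_sum0 subrr normr0 mulr_ge0// exprn_ge0// invr_ge0.
have K0 : 0 <= 4 * 2^-1 ^+ N :> R by rewrite mulr_ge0// exprn_ge0// invr_ge0.
have [c /andP[c0 cx]] := MVT_is_derive x0 (fun y => is_derive_asin_sum N y).
rewrite asin_sum0 !subr0 => ->.
rewrite -{2}[x]mul1r -mulrBl normrM (ger0_norm (ltW x0)) -[leRHS]mulr1.
have x1' : x <= 1 by rewrite (le_trans x1)// invf_le1// ler1n.
apply: ler_pM; rewrite ?(ltW x0)//.
have [d /andP[d0 dc]] := MVT_is_derive c0 (fun y => is_derive_asin_sum' N y).
rewrite asin_sum'0// subr0 => ->.
have dx : 0 <= d <= 2^-1 by rewrite (ltW d0) (le_trans (ltW dc))// (le_trans (ltW cx)).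
have s0 : 0 <= sin d.
  apply: sin_ge0_pihalf; have /andP[-> h] := dx; rewrite (le_trans h)//.
  by rewrite (le_trans _ (pihalf_ge1 R))// invf_le1// ler1n.
rewrite normrM normrN (ger0_norm (asin_tail_ge0 N s0)) (gtr0_norm c0) -[leRHS]mulr1.
apply: ler_pM => //; rewrite ?asin_tail_ge0 ?(ltW c0) ?asin_tail_le//.
by rewrite (le_trans (ltW cx)).
Qed.

Lemma asin_sum_approx N x : (0 < N)%N -> `|x| <= 2^-1 -> `|asin_sum N x - x| <= 4 * 2^-1 ^+ N.
Proof.
move=> N0 xb; have [x0|x0] := leP 0 x.
  by apply: asin_sum_approx_ge0 => //; rewrite x0 -(ger0_norm x0).
have E : asin_sum N (- x) = - asin_sum N x.
  rewrite /asin_sum -sumrN; apply: eq_bigr => i _.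
  by rewrite sinN addn1 [in LHS]exprS exprM sqrrN -exprM mulNr mulrN -exprS.
have := @asin_sum_approx_ge0 N (- x) N0; rewrite E oppr_ge0 (ltW x0) -(ltr0_norm x0) xb => /(_ isT).
by rewrite -opprD normrN.
Qed.

End arcsin.

(** * Derivatives of band-limited functions *)

Section bernstein.
Variable R : realType.
Local Notation mR := (measurableTypeR R).
Local Notation X := (mR * mR * mR)%type.
Local Notation mu := (@mu3 R).
Implicit Types (x : X).

Definition shift3 x (j : 'I_3) (h : R) : X :=
  (x.1.1 + h * (j == 0 :> nat)%:R, x.1.2 + h * (j == 1 :> nat)%:R, x.2 + h * (j == 2 :> nat)%:R).

Lemma dot_shift3 x j h z : dot (shift3 x j h) z = dot x z + h * crd z j.
Proof. by rewrite !dotE /crd /shift3; case: j => -[|[|[|//]]] ? /=; ring. Qed.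

Lemma shift3D x j h k : shift3 (shift3 x j h) j k = shift3 x j (h + k).
Proof. by rewrite /shift3 /= -!addrA !mulrDl. Qed.

Lemma shift30 x j : shift3 x j 0 = x.
Proof. by case: x => -[a b] c; rewrite /shift3 /= !mul0r !addr0. Qed.

Lemma sin_approx (u : R) : `|sin u - u| <= u ^+ 2.
Proof.
wlog u0 : u / 0 < u => [H|].
  have [/H//|u0|<-] := ltgtP 0 u; last by rewrite sin0 subrr normr0 expr0n.
  by have := H (- u); rewrite oppr_gt0 sinN sqrrN -opprD normrN; apply.
have [c /andP[c0 cu]] := MVT_is_derive u0 (fun y => is_derive_sin y).
rewrite sin0 !subr0 => ->; rewrite -{2}[u]mul1r -mulrBl normrM (gtr0_norm u0) expr2.
rewrite ler_pM2r// (le_trans _ (ltW cu))//.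
have [d _] := MVT_is_derive c0 (fun y => is_derive_cos y).
rewrite cos0 subr0 => ->; rewrite normrM normrN (gtr0_norm c0).
by rewrite ler_piMl ?(ltW c0)// sin_max.
Qed.

Variables F1 F2 : X -> R.
Hypotheses (F1l2 : l2 F1) (F2l2 : l2 F2).
Local Notation M t a x := (mult t F1 F2 a x).
Implicit Types (t : X -> R).

(** A bound for [mult] that depends on the transform and not on the supremum of the result. It
    serves for bare boundedness and for error terms that are sent to 0, so it enters no final
    constant. *)
Definition mult_mass t : R := \int[mu]_z (`|t z| * (`|F1 z| + `|F2 z|)).

Lemma l2_norm (f : X -> R) : l2 f -> l2 (fun z => `|f z|).
Proof.
move=> fl2; apply: (le_l2 _ fl2); first by apply: measurableT_comp => //; case: fl2.
by move=> z; rewrite normr_id.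
Qed.

Lemma integrable_mult_mass t : l2 t ->
  mu.-integrable setT (EFin \o (fun z => `|t z| * (`|F1 z| + `|F2 z|))).
Proof. by move=> tl2; apply: l2M_integrable; [exact: l2_norm|apply: l2D; exact: l2_norm]. Qed.

Lemma mult_mass_ge0 t : 0 <= mult_mass t.
Proof. by apply: Rintegral_ge0 => z _; apply: mulr_ge0 => //; exact: addr_ge0. Qed.

Lemma mult_le t t' e a x : l2 t -> l2 t' -> 0 <= e -> (forall z, `|t' z| <= e * `|t z|) ->
  `|M t' a x| <= e * mult_mass t.
Proof.
move=> tl2 t'l2 e0 tt'.
have i1 := integrable_mult a x t'l2 F1l2 F2l2.
have i2 := integrable_mult_mass tl2.
apply: (le_trans (le_normr_Rintegral measurableT i1)).
rewrite /mult_mass -(@RintegralZl _ _ _ _ _ _ e measurableT i2).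
apply: le_Rintegral => //; first exact: (integrable_norm i1).
  exact: (@integrableZl _ _ _ _ _ measurableT e _ i2).
move=> z _; rewrite normrM mulrA; apply: ler_pM => //.
apply: (le_trans (ler_normB _ _)); apply: lerD; rewrite normrM ler_piMr ?cos_max ?sin_max//.
Qed.

Lemma multD t1 t2 a x : l2 t1 -> l2 t2 -> M (fun z => t1 z + t2 z) a x = M t1 a x + M t2 a x.
Proof.
move=> h1 h2; rewrite /mult -RintegralD//; [|exact: integrable_mult..].
by apply: eq_Rintegral => z _; rewrite mulrDl.
Qed.

Lemma multZ t c a x : l2 t -> M (fun z => t z * c) a x = c * M t a x.
Proof.
move=> h1; rewrite /mult -(@RintegralZl _ _ _ _ _ _ c measurableT (integrable_mult _ _ h1 F1l2 F2l2)).
by apply: eq_Rintegral => z _; ring.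
Qed.

Lemma l2Z t c : l2 t -> l2 (fun z => t z * c).
Proof. by move=> tl2; apply: (l2M_bounded (C := `|c|)) => // z. Qed.

Lemma multDpi t a x : l2 t -> M t (a + pi) x = - M t a x.
Proof.
move=> tl2.
rewrite -[RHS]mulN1r /mult -(@RintegralZl _ _ _ _ _ _ (-1) measurableT (integrable_mult _ _ tl2 F1l2 F2l2)).
by apply: eq_Rintegral => z _; rewrite addrA cosDpi sinDpi; ring.
Qed.

Lemma measurable_sin_crd (h : R) j : measurable_fun setT (fun z : X => sin (h * crd z j)).
Proof.
apply: (measurableT_comp (f := @sin R)).
  by apply: continuous_measurable_fun; exact: continuous_sin.
by apply: measurable_funM => //; exact: measurable_crd.
Qed.

Lemma l2_sin t h j : l2 t -> l2 (fun z => t z * sin (h * crd z j)).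
Proof.
move=> tl2; apply: (l2M_bounded (C := 1)) => //; first exact: measurable_sin_crd.
by move=> z; exact: sin_max.
Qed.

(* A factor [sin (h * xi_j)] in the symbol is a central difference with step [h],
   and does not increase the supremum norm. *)
Lemma mult_sin t h j a x : l2 t ->
  M (fun z => t z * sin (h * crd z j)) (a + pi / 2) x =
  (M t a (shift3 x j h) - M t a (shift3 x j (- h))) / 2.
Proof.
move=> tl2; apply: (@mulIf _ 2) => //; rewrite divfK// mulrC.
have il := integrable_mult (a + pi / 2) x (l2_sin h j tl2) F1l2 F2l2.
rewrite {1}/mult -(@RintegralZl _ _ _ _ _ _ 2 measurableT il).
rewrite /mult -RintegralB//; [|exact: integrable_mult..].
apply: eq_Rintegral => z _; rewrite !dot_shift3 !addrA cosDpihalf sinDpihalf.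
rewrite (_ : dot x z + h * crd z j + a = (dot x z + a) + h * crd z j); last by ring.
rewrite (_ : dot x z + - h * crd z j + a = (dot x z + a) - h * crd z j); last by ring.
by move: (dot x z + a) (h * crd z j) => p q; rewrite cosB cosD sinB sinD; ring.
Qed.

(** By [mult_sin], each sine is a central difference once it is accompanied by i; hence the phase
    advances by [pi / 2] with every factor. *)
Lemma mult_sinX t h j a (B : R) n : l2 t -> (forall x, `|M t a x| <= B) ->
  l2 (fun z => t z * sin (h * crd z j) ^+ n) /\
  forall x, `|M (fun z => t z * sin (h * crd z j) ^+ n) (a + n%:R * (pi / 2)) x| <= B.
Proof.
move=> tl2 tB; elim: n => [|n [IHl IH]].
  by under [X in l2 X]eq_fun do rewrite mulr1; split => // x; rewrite mul0r addr0;
    under [X in mult X]eq_fun do rewrite mulr1.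
have E : (fun z => t z * sin (h * crd z j) ^+ n.+1) =
         (fun z => t z * sin (h * crd z j) ^+ n * sin (h * crd z j)).
  by apply/funext => z; rewrite exprSr mulrA.
rewrite E; split; first exact: l2_sin.
move=> x; rewrite -natr1 mulrDl mul1r addrA mult_sin// normrM.
rewrite (ger0_norm (_ : 0 <= 2^-1))// ler_pdivrMr// mulr_natr mulr2n.
by apply: (le_trans (ler_normB _ _)); apply: lerD.
Qed.

(** The power 2n + 1 of the sine comes with the phase pi/2 + n pi. Shifting the phase by pi only
    changes the sign, so all terms are bounded at the common phase pi/2 and the bounds add up. *)
Lemma mult_asin t h j a (B : R) N : l2 t -> (forall x, `|M t a x| <= B) ->
  l2 (fun z => t z * asin_sum N (h * crd z j)) /\
  forall x, `|M (fun z => t z * asin_sum N (h * crd z j)) (a + pi / 2) x| <=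
    (\sum_(n < N) asin_coef R n / (2 * n + 1)%:R) * B.
Proof.
move=> tl2 tB; elim: N => [|N [IHl IH]].
  rewrite big_ord0 mul0r; under [X in l2 X]eq_fun do rewrite /asin_sum big_ord0.
  split; first exact: l2Z.
  move=> x; under [X in mult X]eq_fun do rewrite /asin_sum big_ord0.
  by rewrite multZ// mul0r normr0.
have [sl sB] := @mult_sinX t h j a B (2 * N + 1) tl2 tB.
set c := asin_coef R N / (2 * N + 1)%:R.
have c0 : 0 <= c by rewrite divr_ge0//; case/andP: (asin_coef_bounds R N).
have E : (fun z => t z * asin_sum N.+1 (h * crd z j)) =
  (fun z => t z * asin_sum N (h * crd z j) + t z * sin (h * crd z j) ^+ (2 * N + 1) * c).
  by apply/funext => z; rewrite /asin_sum big_ord_recr /= -/c; ring.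
rewrite E; split; first by apply: l2D => //; exact: l2Z.
move=> x; rewrite multD//; last exact: l2Z.
apply: (le_trans (ler_normD _ _)); rewrite big_ord_recr [leRHS]mulrDl; apply: lerD; first exact: IH.
rewrite multZ// normrM (ger0_norm c0) ler_wpM2l//.
have := sB x; rewrite natrD natrM mulrDl mul1r addrA.
rewrite (_ : 2 * N%:R * (pi / 2) = N%:R * pi); last by field.
rewrite (_ : a + N%:R * pi + pi / 2 = a + pi / 2 + N%:R * pi); last by ring.
suff -> k : `|M (fun z => t z * sin (h * crd z j) ^+ (2 * N + 1)) (a + pi / 2 + k%:R * pi) x| =
            `|M (fun z => t z * sin (h * crd z j) ^+ (2 * N + 1)) (a + pi / 2) x| by [].
elim: k => [|k <-]; first by rewrite mul0r addr0.
have -> : a + pi / 2 + k.+1%:R * pi = a + pi / 2 + k%:R * pi + pi by rewrite -natr1; ring.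
by rewrite multDpi// normrN.
Qed.

(* For [`|xi_j| <= L], [xi_j] is [2 * L * arcsin (sin (xi_j / (2 * L)))], and the
   coefficients of arcsin are nonnegative with sum [pi / 2]. *)
Lemma bernstein t j a (B L : R) : l2 t -> 0 < L -> (forall z, L < `|crd z j| -> t z = 0) ->
  (forall x, `|M t a x| <= B) ->
  l2 (fun z => t z * crd z j) /\
  forall x, `|M (fun z => t z * crd z j) (a + pi / 2) x| <= pi * L * B.
Proof.
move=> tl2 L0 tL tB.
have B0 : 0 <= B by rewrite (le_trans _ (tB point)).
have lc : l2 (fun z => t z * crd z j).
  apply: (@le_l2 _ _ (fun z => t z * L)); last first.
  - move=> z; rewrite !normrM; have [zL|/tL->] := leP `|crd z j| L; last by rewrite !normr0 !mul0r.
    by rewrite ler_wpM2l// (gtr0_norm L0).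
  - exact: l2Z.
  - by apply: measurable_funM; [case: tl2|exact: measurable_crd].
(* With this step [h * xi_j] stays within [-1/2, 1/2], where [asin_sum_approx] applies. *)
split => // x; pose h := (2 * L)^-1.
have h0 : 0 < h by rewrite invr_gt0 mulr_gt0.
have key : `|M (fun z => t z * crd z j * h) (a + pi / 2) x| <= pi / 2 * B.
  apply/ler_addgt0Pr => e e0.
  have K0 : 0 < 4 * (mult_mass t + 1) by rewrite mulr_gt0// ltr_wpDl// mult_mass_ge0.
  have [N [N0 Ne]] : exists N, (0 < N)%N /\ 4 * 2^-1 ^+ N * mult_mass t <= e.
    exists (Num.bound (4 * (mult_mass t + 1) / e)).+1; split => //.
    have /ltW b : 4 * (mult_mass t + 1) / e < 2 ^+ (Num.bound (4 * (mult_mass t + 1) / e)).+1.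
      apply: (lt_trans (archi_boundP _)); first by rewrite divr_ge0// ltW.
      by rewrite -natrX ltr_nat (leq_trans (ltnSn _))// ltnW// ltn_expl.
    rewrite exprVn mulrAC ler_pdivrMr ?exprn_gt0//.
    move: b; rewrite ler_pdivrMr// => b; rewrite [leRHS]mulrC; apply: le_trans b.
    by rewrite ler_pM2l// lerDl.
  have [al aB] := @mult_asin t h j a B N tl2 tB.
  have El : l2 (fun z => t z * (crd z j * h - asin_sum N (h * crd z j))).
    have := l2D (l2Z h lc) (l2N al); congr l2; apply/funext => z; ring.
  rewrite (_ : (fun z => t z * crd z j * h) = (fun z => t z * asin_sum N (h * crd z j) +
     t z * (crd z j * h - asin_sum N (h * crd z j)))); last by apply/funext => z; ring.
  rewrite multD//; apply: (le_trans (ler_normD _ _)); apply: lerD.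
    by apply: (le_trans (aB x)); rewrite ler_wpM2r// asin_coef_sum_le.
  apply: le_trans Ne; apply: mult_le => //.
  move=> z; rewrite normrM mulrC; have [zL|/tL->] := leP `|crd z j| L; last by rewrite !normr0 !mulr0.
  rewrite ler_wpM2r// distrC (mulrC _ h); apply: asin_sum_approx => //.
  by rewrite normrM (gtr0_norm h0) /h invfM -mulrA ler_piMr// ler_pdivrMl// mulr1.
move: key; rewrite multZ// normrM (gtr0_norm h0) /h ler_pdivrMl ?mulr_gt0// => key.
apply: (le_trans key); by rewrite le_eqVlt; apply/orP; left; apply/eqP; field.
Qed.

End bernstein.

Section lipschitz.
Variable R : realType.
Local Notation mR := (measurableTypeR R).
Local Notation X := (mR * mR * mR)%type.
Local Notation mu := (@mu3 R).
Implicit Types (x : X) (t : X -> R).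
Variables F1 F2 : X -> R.
Hypotheses (F1l2 : l2 F1) (F2l2 : l2 F2).
Local Notation M t a x := (mult t F1 F2 a x).

Lemma mult_cosT t a x : l2 t -> M t a x =
  cosT (fun z => t z * F1 z) (cst a) x + cosT (fun z => t z * F2 z) (cst (a + pi / 2)) x.
Proof.
move=> tl2; have i1 := integrable_cosT x (l2M_integrable tl2 F1l2) (measurable_cst a).
have i2 := integrable_cosT x (l2M_integrable tl2 F2l2) (measurable_cst (a + pi / 2)).
rewrite /mult /cosT -RintegralD//; apply: eq_Rintegral => z _.
by rewrite /cst addrA cosDpihalf; ring.
Qed.

Lemma measurable_mult t a : l2 t -> measurable_fun setT (fun x => M t a x).
Proof.
move=> tl2; under eq_fun do rewrite mult_cosT//.
apply: measurable_funD; apply: measurable_cosT => //; exact: l2M_integrable.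
Qed.

Lemma l2_mult t (C : R) a : l2 t -> (forall z, `|t z| <= C) -> l2 (fun x => M t a x).
Proof.
move=> tl2 tC; under [X in l2 X]eq_fun do rewrite mult_cosT//.
have h F : l2 F -> l2 (fun z => t z * F z).
  by move=> Fl2; under [X in l2 X]eq_fun do rewrite mulrC; apply: (l2M_bounded Fl2 _ tC); case: tl2.
by apply: l2D; apply: l2_cosT => //; [exact: l2M_integrable|exact: h|exact: l2M_integrable|exact: h].
Qed.

Lemma mult_bounded t a x : l2 t -> `|M t a x| <= mult_mass F1 F2 t.
Proof. by move=> tl2; rewrite -[leRHS]mul1r; apply: mult_le => // z; rewrite mul1r. Qed.

(** The difference of [mult] at the ends of a segment has a sine in its symbol, centred at the
    midpoint. Replacing the sine by its argument gives the derivative, with an error quadratic in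
    [d] but depending on [mult_mass]. *)
Let mult_lip_step t j a (D L : R) : l2 t -> 0 < L -> (forall z, L < `|crd z j| -> t z = 0) ->
  l2 (fun z => t z * crd z j) ->
  (forall x, `|M (fun z => t z * crd z j) (a + pi / 2) x| <= D) ->
  forall x d, `|M t a (shift3 x j d) - M t a x| <= `|d| * D + d ^+ 2 * (L ^+ 2 * mult_mass F1 F2 t).
Proof.
move=> tl2 L0 tL lc tD x d; pose y := shift3 x j (d / 2).
have -> : M t a (shift3 x j d) - M t a x =
    2 * M (fun z => t z * sin (d / 2 * crd z j)) (a + pi / 2) y.
  rewrite mult_sin// /y !shift3D subrr shift30 -splitr mulrC divfK//.
have El : l2 (fun z => t z * (sin (d / 2 * crd z j) - d / 2 * crd z j)).
  have := l2D (l2_sin (d / 2) j tl2) (l2N (l2Z (d / 2) lc)); congr l2; apply/funext => z; ring.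
rewrite (_ : (fun z => t z * sin (d / 2 * crd z j)) = (fun z => t z * crd z j * (d / 2) +
  t z * (sin (d / 2 * crd z j) - d / 2 * crd z j))); last by apply/funext => z; ring.
rewrite multD//; last exact: l2Z.
rewrite multZ// normrM (ger0_norm (_ : 0 <= 2))//.
apply: (@le_trans _ _ (2 * (`|d| / 2 * D + (d / 2 * L) ^+ 2 * mult_mass F1 F2 t))); last first.
  have := mulr_ge0 (mulr_ge0 (sqr_ge0 d) (sqr_ge0 L)) (mult_mass_ge0 F1 F2 t); lra.
rewrite ler_pM2l//; apply: (le_trans (ler_normD _ _)); apply: lerD.
  by rewrite !normrM (ger0_norm (_ : 0 <= 2^-1))// ler_wpM2l// mulr_ge0.
apply: mult_le => //; first exact: sqr_ge0.
move=> z; rewrite normrM mulrC; have [zL|/tL->] := leP `|crd z j| L; last by rewrite !normr0 !mulr0.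
rewrite ler_wpM2r//; apply: (le_trans (sin_approx _)).
rewrite -[leLHS]ger0_norm ?sqr_ge0// -[leRHS]ger0_norm ?sqr_ge0// !normrX.
by rewrite lerXn2r ?nnegrE// !normrM ler_wpM2l// (gtr0_norm L0).
Qed.

(** Cutting the displacement into n equal steps divides the total quadratic error by n; letting n
    grow removes [mult_mass] and leaves Bernstein's constant. *)
Lemma mult_lip t j a (B L : R) : l2 t -> 0 < L -> (forall z, L < `|crd z j| -> t z = 0) ->
  (forall x, `|M t a x| <= B) ->
  forall x d, `|M t a (shift3 x j d) - M t a x| <= pi * L * `|d| * B.
Proof.
move=> tl2 L0 tL tB x d.
have [lc cB] := bernstein F1l2 F2l2 tl2 L0 tL tB.
pose K := d ^+ 2 * (L ^+ 2 * mult_mass F1 F2 t).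
have K0 : 0 <= K by apply: mulr_ge0; [exact: sqr_ge0|apply: mulr_ge0; [exact: sqr_ge0|exact: mult_mass_ge0]].
have H (n : nat) : (0 < n)%N -> `|M t a (shift3 x j d) - M t a x| <= `|d| * (pi * L * B) + K / n%:R.
  move=> n0; have n0' : n%:R != 0 :> R by rewrite pnatr_eq0 -lt0n.
  have Hk k : `|M t a (shift3 x j (k%:R * (d / n%:R))) - M t a x| <=
      k%:R * (`|d / n%:R| * (pi * L * B) + (d / n%:R) ^+ 2 * (L ^+ 2 * mult_mass F1 F2 t)).
    elim: k => [|k IH]; first by rewrite !mul0r shift30 subrr normr0.
    rewrite -(subrK (M t a (shift3 x j (k%:R * (d / n%:R)))) (M t a (shift3 x j (k.+1%:R * (d / n%:R))))).
    rewrite -addrA; apply: (le_trans (ler_normD _ _)).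
    rewrite -[X in _ <= X * _]natr1 [leRHS]mulrDl [leRHS]addrC; apply: lerD => //.
    rewrite -natr1 [X in shift3 _ _ X]mulrDl mul1r -shift3D mul1r.
    exact: (mult_lip_step tl2 L0 tL lc cB).
  have := Hk n; rewrite mulrC divfK// => /le_trans; apply.
  rewrite mulrDr normrM normfV (ger0_norm (_ : 0 <= n%:R))// /K.
  by rewrite le_eqVlt; apply/orP; left; apply/eqP; field.
rewrite (_ : pi * L * `|d| * B = `|d| * (pi * L * B)); last by ring.
apply/ler_addgt0Pr => e e0; apply: (le_trans (H (Num.bound (K / e)).+1 _)) => //.
rewrite lerD2l ler_pdivrMr// mulrC -ler_pdivrMr//.
apply/ltW/(lt_trans (archi_boundP _)); first by rewrite divr_ge0// ltW.
by rewrite ltr_nat.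
Qed.

End lipschitz.

(** * Vector norms and Nikol'skii's inequality *)

Section nikolskii.
Variable R : realType.
Local Notation mR := (measurableTypeR R).
Local Notation X := (mR * mR * mR)%type.
Local Notation mu := (@mu3 R).
Implicit Types (x : X) (v : vfield R) (r : \bar R).

Lemma mu3_setT_gt0 : (0 < mu setT)%E.
Proof.
apply: (@lt_le_trans _ _ (mu (box3 ((0, 0, 0) : X) 1))).
  by rewrite mu3_box3// lte_fin exprn_gt0// mulr1.
by apply: le_measure; rewrite ?inE//; exact: measurable_box3.
Qed.

Lemma vabs_ge0 v x : 0 <= vabs v x. Proof. exact: sqrtr_ge0. Qed.

Lemma vLnormE (r : R) v : vLnorm r%:E v = poweR (\int[mu]_x (vabs v x `^ r)%:E)%E r^-1.
Proof.
rewrite /vLnorm unlock; under eq_integral do rewrite abse_EFin (ger0_norm (vabs_ge0 _ _)) poweR_EFin.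
by [].
Qed.

Lemma vLnormy v : vLnorm +oo%E v = ess_sup mu (fun x => (vabs v x)%:E).
Proof.
rewrite /vLnorm unlock mu3_setT_gt0; congr ess_sup; apply/funext => x /=.
by rewrite ger0_norm// vabs_ge0.
Qed.

Lemma vLnorm_ge0 r v : (0 <= vLnorm r v)%E. Proof. exact: Lnorm_ge0. Qed.

Lemma measurable_vabs v : (forall i, measurable3 (v i)) -> measurable_fun setT (vabs v : X -> R).
Proof.
move=> mv; apply: (measurableT_comp (f := @Num.sqrt R)).
  by apply: continuous_measurable_fun; exact: sqrt_continuous.
apply: measurable_sum => i; apply: measurable_funX; exact: mv.
Qed.

Lemma crd_le_vabs v i x : `|v i x| <= vabs v x.
Proof.
rewrite /vabs -sqrtr_sqr ler_wsqrtr// (bigD1 i)//= lerDl sumr_ge0// => j _; exact: sqr_ge0.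
Qed.

Lemma vabs_le_sum v x : vabs v x <= \sum_i `|v i x|.
Proof.
rewrite /vabs -[leRHS]ger0_norm ?sumr_ge0// -sqrtr_sqr ler_wsqrtr//.
rewrite !big_ord_recr !big_ord0 /= !add0r -![v _ x ^+ 2]real_normK ?num_real//.
move: (normr_ge0 (v (widen_ord (leqnSn 2) (widen_ord (leqnSn 1) ord_max)) x)).
move: (normr_ge0 (v (widen_ord (leqnSn 2) ord_max) x)) (normr_ge0 (v ord_max x)).
move: `|v _ _| `|v (widen_ord _ ord_max) _| `|v ord_max _| => p q s p0 q0 s0.
have := mulr_ge0 p0 q0; have := mulr_ge0 p0 s0; have := mulr_ge0 q0 s0; lra.
Qed.

Lemma three_over_ge0 r : (2%:E <= r)%E -> 0 <= three_over r <= 2.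
Proof.
case: r => [r||]//=; rewrite ?lee_fin => r2; last by rewrite lexx ler0n.
have r0 : 0 < r by exact: lt_le_trans r2.
by rewrite divr_ge0 ?(ltW r0)//= ler_pdivrMr//; lra.
Qed.

Lemma vLnorm_ge_box r v x (d s : R) : (2%:E <= r)%E -> 0 < d -> 0 <= s ->
  (forall i, measurable3 (v i)) -> (forall y, box3 x d y -> s <= vabs v y) ->
  ((s * (2 * d) `^ three_over r)%:E <= vLnorm r v)%E.
Proof.
move=> r2 d0 s0 mv sv; case: r r2 => [r||]// r2.
- have r0 : 0 < r by rewrite lee_fin in r2; exact: lt_le_trans r2.
  have mvr : measurable_fun setT (fun y : X => (vabs v y `^ r)%:E).
    by apply/measurable_EFinP; apply: (measurableT_comp (measurable_powR r)); exact: measurable_vabs.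
  rewrite vLnormE (_ : (_)%:E = poweR (s `^ r * (2 * d) ^+ 3)%:E r^-1); last first.
    rewrite poweR_EFin [in RHS]powRM ?powR_ge0 ?exprn_ge0 ?mulr_ge0 ?(ltW d0)//.
    rewrite -powRrM mulfV ?gt_eqF// powRr1// -powR_mulrn ?mulr_ge0 ?(ltW d0)//.
    by rewrite -powRrM.
  apply: gt0_ler_poweR; rewrite ?in_itv/= ?andbT ?leey ?andbT//.
  + by rewrite invr_ge0 ltW.
  + by rewrite lee_fin mulr_ge0 ?powR_ge0 ?exprn_ge0 ?mulr_ge0 ?(ltW d0).
  + by rewrite integral_ge0// => y _; rewrite lee_fin powR_ge0.
  apply: (@le_trans _ _ (\int[mu]_(y in box3 x d) (vabs v y `^ r)%:E)%E); last first.
    apply: ge0_subset_integral => //; first exact: measurable_box3.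
    by move=> y _; rewrite lee_fin powR_ge0.
  rewrite EFinM -(mu3_box3 x (ltW d0)) -integral_cst; last exact: measurable_box3.
  apply: ge0_le_integral => //; first exact: measurable_box3.
  + by move=> y _; rewrite lee_fin powR_ge0.
  + exact: measurable_funS mvr.
  + move=> y xy; rewrite lee_fin ge0_ler_powR ?nnegrE ?(ltW r0) ?vabs_ge0//; exact: sv.
- rewrite /three_over powRr0 mulr1 vLnormy leNgt; apply/negP => sm.
  have [N [mN N0 sN]] := ess_sup_ge mu (fun x => (vabs v x)%:E).
  have : (mu (box3 x d) <= mu N)%E.
    apply: le_measure; rewrite ?inE//; first exact: measurable_box3.
    move=> y /sv sy; apply: sN => /= h.
    by have := le_lt_trans h sm; rewrite lte_fin ltNge sy.
  by rewrite mu3_box3 ?(ltW d0)// N0 lee_fin leNgt exprn_gt0// mulr_gt0.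
Qed.

(** Start at a point where a component exceeds 3/4 of the supremum [S]. With [d = 1 / (12 A)],
    moving by at most [d] along each of the three axes loses at most S/12 per axis, so the component
    stays above S/2 on a box of side [2 * d = 1 / (6 A)], and the L^r norm over this box bounds
    [S]. *)
Lemma nikolskii r v (A : R) : (2%:E <= r)%E -> 0 < A ->
  (forall i, measurable3 (v i)) -> (exists B, forall i x, `|v i x| <= B) ->
  (forall B, (forall i x, `|v i x| <= B) ->
     forall i j x d, `|v i (shift3 x j d) - v i x| <= A * `|d| * B) ->
  forall i x, (`|v i x|%:E <= (2 * (6 * A) `^ three_over r)%:E * vLnorm r v)%E.
Proof.
move=> r2 A0 mv [B0 vB0] vlip.
pose E := [set y | exists i x, y = `|v i x|].
have Eub : has_ubound E by exists B0 => _ [i [x ->]].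
have Ene : E !=set0 by exists `|v 0 point|, 0, point.
pose S := sup E.
have vS i x : `|v i x| <= S by apply: ub_le_sup => //; exists i, x.
have S0 : 0 <= S by rewrite (le_trans _ (vS 0 point)).
suff H : (S%:E <= (2 * (6 * A) `^ three_over r)%:E * vLnorm r v)%E.
  by move=> i x; apply: le_trans H; rewrite lee_fin.
move: S0; rewrite le_eqVlt => /predU1P[<-|S0].
  by rewrite mule_ge0 ?lee_fin ?mulr_ge0 ?powR_ge0// vLnorm_ge0.
have [_ [i [x ->]] xS] : exists2 y, E y & S - S / 4 < y.
  by apply: sup_adherent => //; rewrite divr_gt0.
pose d := (12 * A)^-1; have d0 : 0 < d by rewrite invr_gt0 mulr_gt0.
have dE : A * d * S = S / 12 by rewrite /d; field; rewrite gt_eqF.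
have : ((S / 2 * (2 * d) `^ three_over r)%:E <= vLnorm r v)%E.
  apply: (@vLnorm_ge_box r v x d) => //; first by rewrite divr_ge0// ltW.
  move=> y [[y1 y2] y3]; apply: le_trans (crd_le_vabs v i y).
  have ytr (j : 'I_3) x' e : `|e| <= d -> `|v i (shift3 x' j e) - v i x'| <= S / 12.
    move=> ed; apply: (le_trans (vlip S vS i j x' e)); rewrite -dE.
    by rewrite ler_pM2r// ler_pM2l.
  pose x1 := shift3 x 0 (y.1.1 - x.1.1); pose x2 := shift3 x1 1 (y.1.2 - x.1.2).
  have yE : y = shift3 x2 2%:R (y.2 - x.2).
    rewrite /x2 /x1 /shift3 /= !mulr1 !mulr0 !addr0 !subrKC.
    by case: (y) => -[].
  have h1 : `|y.1.1 - x.1.1| <= d by move: y1; rewrite /= in_itv/= ler_distl.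
  have h2 : `|y.1.2 - x.1.2| <= d by move: y2; rewrite /= in_itv/= ler_distl.
  have h3 : `|y.2 - x.2| <= d by move: y3; rewrite /= in_itv/= ler_distl.
  have := ytr 0 x _ h1; have := ytr 1 x1 _ h2; have := ytr 2%:R x2 _ h3.
  rewrite -yE -/x2 -/x1 => k3 k2 k1.
  have : `|v i x| <= `|v i y| + `|v i y - v i x2| + `|v i x2 - v i x1| + `|v i x1 - v i x|.
    rewrite {1}(_ : v i x = v i y - (v i y - v i x2) - (v i x2 - v i x1) - (v i x1 - v i x)); last by ring.
    by rewrite (le_trans (ler_normB _ _))// lerD2r (le_trans (ler_normB _ _))// lerD2r ler_normB.
  lra.
move=> H; apply: (@le_trans _ _ ((2 * (6 * A) `^ three_over r)%:E * (S / 2 * (2 * d) `^ three_over r)%:E)%E).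
  have -> : 2 * d = (6 * A)^-1 by rewrite /d; field; rewrite gt_eqF.
  rewrite -EFinM lee_fin -powR_inv1 ?mulr_ge0 ?(ltW A0)// powRAC powR_inv1 ?powR_ge0//.
  have p0 : 0 < (6 * A) `^ three_over r by rewrite powR_gt0// mulr_gt0.
  by rewrite le_eqVlt; apply/orP; left; apply/eqP; field; rewrite gt_eqF.
by rewrite lee_pmul2l// lte_fin mulr_gt0// powR_gt0// mulr_gt0.
Qed.

End nikolskii.

(** * Vorticity blocks against velocity blocks *)

Section blocks.
Variable R : realType.
Local Notation mR := (measurableTypeR R).
Local Notation X := (mR * mR * mR)%type.
Local Notation mu := (@mu3 R).
Implicit Types (x : X) (t : X -> R) (f : X -> R) (r : \bar R).

Let c3 : R := (2 * pi) ^- 3.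

Let c3_gt0 : 0 < c3. Proof. by rewrite invr_gt0 pi3_gt0. Qed.

Let ft_l2 f : l2 f -> l2 (fun z => complex.Re (fourier f z)) /\ l2 (fun z => complex.Im (fourier f z)).
Proof. by move=> fl2; exact: is_ft_l2 fl2 (fourier_ft fl2). Qed.

Lemma measurable_fmult f t a : l2 f -> l2 t -> measurable_fun setT (fmult f t a).
Proof. by move=> /ft_l2[h1 h2] tl2; apply: measurable_funM => //; exact: measurable_mult. Qed.

Lemma l2_fmult f t a (C : R) : l2 f -> l2 t -> (forall z, `|t z| <= C) -> l2 (fmult f t a).
Proof.
move=> /ft_l2[h1 h2] tl2 tC; have := l2Z c3 (l2_mult h1 h2 a tl2 tC).
by congr l2; apply/funext => z; rewrite mulrC.
Qed.

Lemma fmult_bounded f t a : l2 f -> l2 t -> exists B, forall x, `|fmult f t a x| <= B.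
Proof.
move=> /ft_l2[h1 h2] tl2; pose m := mult_mass (fun z => complex.Re (fourier f z)) (fun z => complex.Im (fourier f z)) t.
exists (c3 * m) => x; rewrite normrM (gtr0_norm c3_gt0).
by rewrite ler_pM2l//; exact: mult_bounded.
Qed.

Let fmult_mult f t a (B : R) :
  (forall x, `|fmult f t a x| <= B) -> forall x, `|mult t (fun z => complex.Re (fourier f z)) (fun z => complex.Im (fourier f z)) a x| <= c3^-1 * B.
Proof.
by move=> H x; have := H x; rewrite normrM (gtr0_norm c3_gt0) ler_pdivlMl.
Qed.

Lemma fmult_lip f t j a (B L : R) : l2 f -> l2 t -> 0 < L -> (forall z, L < `|crd z j| -> t z = 0) ->
  (forall x, `|fmult f t a x| <= B) ->
  forall x d, `|fmult f t a (shift3 x j d) - fmult f t a x| <= pi * L * `|d| * B.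
Proof.
move=> /ft_l2[h1 h2] tl2 L0 tL /fmult_mult tB x d.
have := mult_lip h1 h2 tl2 L0 tL tB x d.
rewrite -mulrBr normrM (gtr0_norm c3_gt0) => H.
rewrite -(ler_pM2l c3_gt0) in H; apply: (le_trans H).
by rewrite mulrCA (mulrA c3) mulfV ?mul1r// gt_eqF.
Qed.

Lemma fmult_bernstein f t j a (B L : R) : l2 f -> l2 t -> 0 < L -> (forall z, L < `|crd z j| -> t z = 0) ->
  (forall x, `|fmult f t a x| <= B) ->
  forall x, `|fmult f (fun z => t z * crd z j) (a + pi / 2) x| <= pi * L * B.
Proof.
move=> /ft_l2[h1 h2] tl2 L0 tL /fmult_mult tB x.
have [_ /(_ x) H] := bernstein h1 h2 tl2 L0 tL tB.
rewrite normrM (gtr0_norm c3_gt0) -ler_pdivlMl//.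
by apply: (le_trans H); rewrite mulrCA.
Qed.

Lemma fmult_nikolskii (f : vfield R) t (L C : R) r : (2%:E <= r)%E -> 0 < L ->
  bounded_symbol t C L -> (forall i, l2 (f i)) ->
  forall i x, (`|fmult (f i) t 0 x|%:E <=
    (2 * (6 * (pi * L)) `^ three_over r)%:E * vLnorm r (fun i => fmult (f i) t 0))%E.
Proof.
move=> r2 L0 tb fl2 i x; have tl2 := bounded_symbol_l2 (ltW L0) tb.
have [_ _ t0] := tb.
apply: (@nikolskii R r (fun i => fmult (f i) t 0) (pi * L)) => //.
- by rewrite mulr_gt0// pi_gt0.
- by move=> j; exact: measurable_fmult.
- have h j := fmult_bounded 0 (fl2 j) tl2.
  have [B0 H0] := h 0; have [B1 H1] := h 1; have [B2 H2] := h 2%:R.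
  exists (Num.max B0 (Num.max B1 B2)) => j y; rewrite !le_max.
  have [->|->|->] : [\/ j = 0, j = 1 | j = 2%:R].
    by case: j => -[|[|[|//]]] ?; [apply: Or31|apply: Or32|apply: Or33]; exact: val_inj.
  + by rewrite H0.
  + by rewrite H1 orbT.
  + by rewrite H2 !orbT.
- move=> B vB k j y d; apply: fmult_lip => // z zL.
  by apply: t0; apply: lt_le_trans zL _; exact: crd_enorm.
Qed.

Variable chi : R3 R -> R.
Hypothesis hchi : cutoff chi.

Lemma Delta_tfield q (f : vfield R) : Delta chi q f = fun i => fmult (f i) (lp_symbol chi q) 0.
Proof. by apply/funext => i; apply/funext => x; rewrite Delta_fmult. Qed.

(** The factor 24 pi collects the six terms of the curl, the bound pi L with L = 2 lambda_q, and the
    2 of [nikolskii]; (12 pi)^2 bounds (12 pi)^(3/r), since 3/r <= 2. *)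
Definition bernstein_const : R := 24 * pi * (12 * pi) ^+ 2.

Lemma bernstein_const_gt0 : 0 < bernstein_const.
Proof. by rewrite mulr_gt0 ?exprn_gt0 ?mulr_gt0 ?pi_gt0. Qed.

(** The first-order symbol of the curl costs one power of lambda_q by Bernstein's inequality, and
    passing from L^r to the supremum costs lambda_q^(3/r) by Nikol'skii's. *)
Lemma vort_le r (f : vfield R) (q : nat) : (2%:E <= r)%E -> (forall i, l2 (f i)) ->
  (vLnorm +oo (Delta_curl chi q%:Z f) <=
   (bernstein_const * lambda R q%:Z `^ (1 + three_over r))%:E * vLnorm r (Delta chi q%:Z f))%E.
Proof.
move=> r2 fl2; have l0 := lambda_gt0 R q%:Z.
have C0 : 0 < bernstein_const * lambda R q%:Z `^ (1 + three_over r).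
  by rewrite mulr_gt0 ?bernstein_const_gt0// powR_gt0.
have [A A0 /(_ q%:Z isT) tb] := lp_symbol_bounded hchi.
set t := lp_symbol chi q%:Z in tb *; set L := 2 * lambda R q%:Z in tb *.
have L0 : 0 < L by rewrite mulr_gt0.
have tl2 := bounded_symbol_l2 (ltW L0) tb.
have := fmult_nikolskii r2 L0 tb fl2; rewrite -Delta_tfield.
case E : (vLnorm r (Delta chi q%:Z f)) => [N||]; last 2 first.
- by move=> _; rewrite gt0_muley ?lte_fin// leey.
- by have := vLnorm_ge0 r (Delta chi q%:Z f); rewrite E.
have N0 : 0 <= N by have := vLnorm_ge0 r (Delta chi q%:Z f); rewrite E.
move=> tB; pose B := 2 * (6 * (pi * L)) `^ three_over r * N.
have cB i j x : `|fmult (f i) (fun z => t z * crd z j) (pi / 2) x| <= pi * L * B.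
  rewrite -[pi / 2]add0r; apply: fmult_bernstein => //; first last.
    by move=> y; have := tB i y; rewrite lee_fin.
  by move=> z zL; case: tb => _ _; apply; apply: lt_le_trans zL _; exact: crd_enorm.
rewrite vLnormy; apply/ess_supP; apply: aeW => x; rewrite -EFinM lee_fin.
apply: (@le_trans _ _ (6 * (pi * L * B))).
  apply: (le_trans (vabs_le_sum _ _)).
  apply: (@le_trans _ _ (\sum_(i < 3) (pi * L * B + pi * L * B))).
    apply: ler_sum => i _; rewrite Delta_curl_fmult//.
      by apply: (le_trans (ler_normB _ _)); apply: lerD.
    by move=> j; exact: bounded_symbol_l2 (ltW L0) (bounded_symbol_crd j (ltW L0) tb).
  by rewrite sumr_const card_ord -!mulr2n -mulrnA mulr_natl.
have /andP[r0 r3] := three_over_ge0 r2.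
have p0 := @pi_gt0 R; have p2 := @pi_ge2 R.
have ll : lambda R q%:Z `^ (1 + three_over r) = lambda R q%:Z * lambda R q%:Z `^ three_over r.
  by rewrite powRD ?powRr1 ?(ltW l0)//; apply/implyP => _; rewrite gt_eqF.
have LE : (6 * (pi * L)) `^ three_over r = (12 * pi) `^ three_over r * lambda R q%:Z `^ three_over r.
  by rewrite (_ : 6 * (pi * L) = 12 * pi * lambda R q%:Z) ?powRM ?mulr_ge0 ?(ltW p0) ?(ltW l0)// /L; ring.
rewrite ll /bernstein_const /B LE /L.
have Y : (12 * pi) `^ three_over r <= (12 * pi : R) ^+ 2.
  by rewrite -powR_mulrn ?mulr_ge0 ?(ltW p0)//; apply: ler_powR => //; lra.
move: Y; set Y := _ `^ _; set Z := lambda _ _ `^ _; set Y2 := _ ^+ 2 => Y2Y.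
rewrite (_ : 6 * _ = 24 * pi * lambda R q%:Z * Z * N * Y); last by ring.
rewrite (_ : 24 * pi * Y2 * _ * N = 24 * pi * lambda R q%:Z * Z * N * Y2); last by ring.
apply: ler_wpM2l => //; apply: mulr_ge0 => //; apply: mulr_ge0; last exact: powR_ge0.
by apply: mulr_ge0; [apply: mulr_ge0 => //; exact: ltW|exact: ltW].
Qed.

End blocks.

(** * Measurability in time *)

Section lower_semicontinuity.
Variable R : realType.
Local Notation mR := (measurableTypeR R).
Local Notation X := (mR * mR * mR)%type.
Local Notation mu := (@mu3 R).
Implicit Types (x : X) (v : vfield R).

Lemma vLnorm_le (r a : R) v : 0 < r -> 0 <= a ->
  (vLnorm r%:E v <= a%:E)%E = (\int[mu]_x (vabs v x `^ r)%:E <= (a `^ r)%:E)%E.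
Proof.
move=> r0 a0; rewrite vLnormE.
have : (0 <= \int[mu]_x (vabs v x `^ r)%:E)%E.
  by apply: integral_ge0 => x _; rewrite lee_fin powR_ge0.
case: (\int[mu]_x _)%E => [b||] b0; last 2 first.
- by rewrite poweRyr ?invr_neq0 ?gt_eqF// !leye_eq.
- by [].
rewrite poweR_EFin !lee_fin.
have rr : b = b `^ r^-1 `^ r by rewrite -powRrM mulVf ?powRr1// gt_eqF.
rewrite [in RHS]rr; apply/idP/idP => h.
  by rewrite ge0_ler_powR ?nnegrE ?powR_ge0// ltW.
rewrite leNgt; apply/negP => ab; move: h; rewrite leNgt.
by rewrite gt0_ltr_powR ?nnegrE ?powR_ge0.
Qed.

Lemma vabs_cvg (W : nat -> vfield R) v x : (forall i, W ^~ i ^~ x @ \oo --> v i x) ->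
  (fun n => vabs (W n) x) @ \oo --> vabs v x.
Proof.
move=> Wv; rewrite /vabs.
apply: (@continuous_cvg nat R R \oo _ (fun n => \sum_i W n i x ^+ 2) (@Num.sqrt R) (\sum_i v i x ^+ 2) (@sqrt_continuous R _)).
rewrite !big_ord_recl !big_ord0.
under eq_fun do rewrite !big_ord_recl !big_ord0.
by do 3! [apply: cvgD; first by under eq_fun do rewrite expr2; rewrite expr2; apply: cvgM; exact: Wv];
  exact: cvg_cst.
Qed.

Lemma powR_cvg (g : nat -> R) (y r : R) : 0 < r -> (forall n, 0 <= g n) -> g @ \oo --> y ->
  (fun n => g n `^ r) @ \oo --> y `^ r.
Proof.
move=> r0 g0 gy.
have y0 : 0 <= y by apply: (closed_cvg _ (@closed_ge R 0) _ _ gy); exact: nearW.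
move: y0 gy; rewrite le_eqVlt => /predU1P[<-|y0] gy.
  rewrite powR0 ?gt_eqF//; apply/cvgrPdist_lt => e e0.
  have d0 : 0 < e `^ r^-1 by rewrite powR_gt0.
  move/cvgrPdist_lt/(_ _ d0) : gy; apply: filterS => n; rewrite !sub0r !normrN.
  rewrite (ger0_norm (g0 n)) (ger0_norm (powR_ge0 _ _)) => h.
  have := gt0_ltr_powR r0 (g0 n) (powR_ge0 e r^-1) h.
  by rewrite -powRrM mulVf ?gt_eqF// powRr1// ltW.
apply: (@continuous_cvg nat R R \oo _ g (fun y => y `^ r) y) gy.
apply/differentiable_continuous/derivable1_diffP.
by apply: derivable_powR; rewrite in_itv/= y0.
Qed.

(** Fatou's lemma for finite [r]; for [r = +oo], the exceptional null sets of the sequence have a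
    null union. *)
Lemma vLnorm_liminf (r : \bar R) (W : nat -> vfield R) v (a : R) : (2%:E <= r)%E ->
  (forall n i, measurable3 (W n i)) -> (forall i, measurable3 (v i)) ->
  (forall i x, W ^~ i ^~ x @ \oo --> v i x) ->
  (forall n, vLnorm r (W n) <= a%:E)%E -> (vLnorm r v <= a%:E)%E.
Proof.
move=> r2 mW mv Wv Wa.
have a0 : 0 <= a by have := le_trans (vLnorm_ge0 r (W 0%N)) (Wa 0%N); rewrite lee_fin.
have Wvx x := vabs_cvg (fun i => Wv i x).
case: r r2 Wa => [r||]// r2 Wa.
- have r0 : 0 < r by rewrite lee_fin in r2; exact: lt_le_trans r2.
  have mr w : (forall i, measurable3 (w i)) -> measurable_fun setT (fun y : X => (vabs w y `^ r)%:E).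
    move=> mw; apply/measurable_EFinP.
    by apply: (measurableT_comp (measurable_powR r)); exact: measurable_vabs.
  rewrite vLnorm_le//; apply: (@fatou_le _ _ _ mu setT (fun n x => (vabs (W n) x `^ r)%:E)) => //.
  + by move=> n; exact: mr.
  + by move=> n x _; rewrite lee_fin powR_ge0.
  + move=> x _; apply: cvg_EFin; first by apply: nearW.
    by apply: powR_cvg => // n; exact: vabs_ge0.
  + by move=> n; rewrite -vLnorm_le.
- rewrite vLnormy; apply/ess_supP.
  have /ae_foralln : forall n, \forall x \ae mu, ((vabs (W n) x)%:E <= a%:E)%E.
    by move=> n; apply/ess_supP; rewrite -vLnormy.
  apply: filterS => x Hx; rewrite lee_fin.
  apply: (closed_cvg _ (@closed_le R a) _ _ (Wvx x)).
  by apply: nearW => n; have := Hx n; rewrite lee_fin.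
Qed.

(** Continuity in [s] at each fixed point [x] suffices: if lower semicontinuity failed at [s], some
    sequence tending to [s] would keep norms at most [a], contradicting [vLnorm_liminf]. *)
Lemma vLnorm_lsc (r : \bar R) (W : R -> vfield R) : (2%:E <= r)%E ->
  (forall s i, measurable3 (W s i)) -> (forall i x, continuous (fun s => W s i x)) ->
  measurable_fun setT (fun s => vLnorm r (W s)).
Proof.
move=> r2 mW cW; apply: lower_semicontinuous_measurable => s a aN.
apply: contrapT => H.
have /choice[y yP] : forall n : nat, exists y, `|s - y| < n.+1%:R^-1 /\ (vLnorm r (W y) <= a%:E)%E.
  move=> n; apply: contrapT => Hn; apply: H.
  exists (ball s n.+1%:R^-1); first exact: nbhsx_ballx.
  move=> y sy; rewrite ltNge; apply/negP => ya; apply: Hn; exists y; split => //.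
have ys : y @ \oo --> s.
  apply/cvgrPdist_lt => e e0; near=> n; apply: (lt_trans (yP n).1).
  by near: n; exact: near_infty_natSinv_lt (PosNum e0).
suff : (vLnorm r (W s) <= a%:E)%E by rewrite leNgt aN.
apply: (@vLnorm_liminf r (fun n => W (y n))) => //.
- by move=> i x; apply: (@continuous_cvg nat R R \oo _ y (fun s => W s i x) s) ys; exact: cW.
- by move=> n; exact: (yP n).2.
Unshelve. all: by end_near. Qed.

End lower_semicontinuity.

Section weak_continuity.
Variable R : realType.
Local Notation mR := (measurableTypeR R).
Local Notation X := (mR * mR * mR)%type.
Local Notation mu := (@mu3 R).
Implicit Types (x : X) (t : X -> R).

(* [fun t => u (clamp T t)] extends [u] from [0, T] to the real line. *)
Definition clamp (T s : R) : R := Num.max 0 (Num.min s T).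

Lemma clamp_itv T s : 0 <= T -> 0 <= clamp T s <= T.
Proof. by move=> T0; rewrite /clamp le_max lexx ge_max T0 ge_min lexx orbT. Qed.

Lemma clamp_id T s : 0 <= s <= T -> clamp T s = s.
Proof. by move=> /andP[s0 sT]; rewrite /clamp min_l// max_r. Qed.

Lemma clamp_continuous T : continuous (clamp T).
Proof.
have lip s y : `|clamp T s - clamp T y| <= `|s - y|.
  wlog sy : s y / s <= y => [H|].
    by have [/H//|/ltW/H] := leP s y; rewrite distrC (distrC y).
  rewrite distrC (distrC s) (ger0_norm (_ : 0 <= y - s)) ?subr_ge0//.
  rewrite ger0_norm /clamp; case: (leP s T) => h4; case: (leP y T) => h5;
    case: (leP 0 s) => ?; case: (leP 0 y) => ?; case: (leP 0 T) => ?; lra.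
move=> s; apply/cvgrPdist_lt => e e0; apply/nbhs_ballP; exists e => //= y sy.
exact: le_lt_trans (lip s y) sy.
Qed.

Variables (T : R) (u : R -> vfield R).
Hypotheses (T0 : 0 <= T) (uC : in_Cw_L2 T u).

Lemma Cw_l2 s i : l2 (u (clamp T s) i).
Proof. by apply: vLnorm2_l2; apply: uC.1; exact: clamp_itv. Qed.

(* By [mult_rep] this is the pairing of [u] with a fixed square-integrable field. *)
Lemma fmult_continuous t a i x : l2 t -> mu.-integrable setT (EFin \o t) ->
  continuous (fun s => fmult (u (clamp T s) i) t a x).
Proof.
move=> tl2 it.
pose k := cosT t (fun z : X => - dot x z - a).
have kl2 : l2 k.
  apply: l2_cosT => //; apply: measurable_funB => //.
  by apply: (measurableT_comp (f := (-%R : R -> R))) => //; exact: measurable_dot.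
(* Weak continuity is tested against vector fields; the kernel is placed in the component [i]
   alone. *)
pose psi : vfield R := fun j y => if j == i then k y else 0.
have psiL2 : L2 psi.
  apply: l2_vLnorm2 => j; rewrite /psi; have [_|_] := eqVneq j i; first exact: kl2.
  apply: (@le_l2 _ _ k) => // z; by rewrite normr0.
have innerE s : fmult (u (clamp T s) i) t a x = (2 * pi) ^- 3 * inner (u (clamp T s)) psi.
  rewrite fmult_rep//; last exact: Cw_l2.
  congr (_ * _); apply: eq_Rintegral => y _.
  rewrite (bigD1 i)//= /psi eqxx big1 ?addr0// => j /negPf ->; by rewrite mulr0.
rewrite (funext innerE) => s; apply: cvgM; first exact: cvg_cst.
have /subspace_continuousP H := uC.2 _ psiL2.
have cT y : `[0, T]%classic (clamp T y) by rewrite /= in_itv/= clamp_itv.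
apply: (@cvg_comp _ _ _ (clamp T) (fun s => inner (u s) psi) (nbhs s)
  (within `[0, T] (nbhs (clamp T s)))); last exact: H.
move=> P /= hP.
have hP' : nbhs (clamp T s) (fun y => `[0, T]%classic y -> P y) by exact: hP.
have : nbhs s (clamp T @^-1` (fun y => `[0, T]%classic y -> P y)) by exact: (@clamp_continuous T s).
by apply: filterS => y Hy; exact: Hy (cT y).
Qed.

End weak_continuity.

(** * The dissipation wavenumber *)

Section wavenumber_facts.
Variable R : realType.
Local Notation mR := (measurableTypeR R).
Local Notation X := (mR * mR * mR)%type.
Local Notation mu := (@mu3 R).
Implicit Types (x : X) (t : X -> R).

Lemma lambdaX (n : nat) : lambda R n%:Z = 2 ^+ n. Proof. by []. Qed.

Lemma intr_nat (n : nat) : (n%:Z)%:~R = n%:R :> R. Proof. by []. Qed.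

Variables (chi : R3 R -> R) (r : \bar R).

(** The x_p of the overview, which [Lambda_r] compares with its threshold. *)
Definition block_size (p : nat) (f : vfield R) : \bar R :=
  ((lambda R p%:Z `^ (-1 + three_over r))%:E * vLnorm r (Delta chi p%:Z f))%E.

Lemma block_size_ge0 p f : (0 <= block_size p f)%E.
Proof. by rewrite mule_ge0 ?lee_fin ?powR_ge0 ?vLnorm_ge0. Qed.

Lemma le_Q_rE (q : nat) theta f : ((q%:Z)%:~R%:E <= Q_r chi r theta f)%E =
  (((2 : R) ^+ q)%:E <= Lambda_r chi r theta f)%E.
Proof.
rewrite /Q_r intr_nat; set L := Lambda_r _ _ _ _.
have : (1 <= L)%E.
  by apply: le_ereal_inf_tmp => _ [k _ <-]; rewrite lee_fin lambdaX exprn_ege1// ler1n.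
have l2 : 0 < ln 2 :> R by rewrite ln_gt0// ltr1n.
case: L => [l||]// l1; last by rewrite gt0_mulye ?lte_fin ?invr_gt0// !leey.
have l0 : 0 < l by rewrite lee_fin in l1; exact: lt_le_trans l1.
rewrite lne_EFin// -EFinM !lee_fin ler_pdivlMr// mulr_natl -lnXn//.
by rewrite ler_ln ?posrE ?exprn_gt0.
Qed.

Lemma le_Q_r (q : nat) theta f : ((q%:Z)%:~R%:E <= Q_r chi r theta f)%E <->
  (forall k, (k < q)%N -> exists2 p, (k < p)%N & (theta%:E <= block_size p f)%E).
Proof.
rewrite le_Q_rE; split=> [qL k kq|H].
  apply: contrapT => Hk; have : (Lambda_r chi r theta f <= (lambda R k%:Z)%:E)%E.
    apply: ereal_inf_lbound; exists k => // p kp; rewrite ltNge; apply/negP => h.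
    by apply: Hk; exists p.
  by move=> /(le_trans qL); rewrite lee_fin lambdaX ler_eXn2l ?ltr1n// leqNgt kq.
apply: le_ereal_inf_tmp => _ [k kP <-]; rewrite lee_fin lambdaX ler_eXn2l ?ltr1n// leqNgt.
by apply/negP => /H[p /kP]; rewrite ltNge => /negP.
Qed.

(** This is [le_Q_r] at the index [q - 1]. The case [q = 0] is excluded because 0 <= Q_r always
    holds, whatever the blocks. *)
Lemma le_Q_r_witness (q : nat) theta f : (0 < q)%N -> ((q%:Z)%:~R%:E <= Q_r chi r theta f)%E ->
  exists2 p, (q <= p)%N & (theta%:E <= block_size p f)%E.
Proof. by case: q => // q _ /le_Q_r/(_ q (ltnSn q)). Qed.

Lemma block_size_le_Q_r (q p : nat) theta f : (theta%:E <= block_size p f)%E -> (q <= p)%N ->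
  ((q%:Z)%:~R%:E <= Q_r chi r theta f)%E.
Proof. by move=> h qp; apply/le_Q_r => k kq; exists p => //; exact: leq_trans qp. Qed.

(** Some index is admissible, so the infimum defining [Lambda_r] is attained at the least one. A
    natural value of Q_r is what turns [lp_low] into a finite sum. *)
Lemma Q_r_nat (q0 : nat) theta f : (forall p, (q0 <= p)%N -> (block_size p f < theta%:E)%E) ->
  exists2 n : nat, (n <= q0)%N & Q_r chi r theta f = n%:R%:E.
Proof.
move=> H.
have ex : exists n, `[< forall p, (n < p)%N -> (block_size p f < theta%:E)%E >].
  by exists q0; apply/asboolP => p /ltnW; exact: H.
exists (ex_minn ex).
  by case: ex_minnP => n _; apply; apply/asboolP => p /ltnW; exact: H.
case: ex_minnP => n /asboolP nP nmin; rewrite /Q_r.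
have -> : Lambda_r chi r theta f = (lambda R n%:Z)%:E.
  apply/eqP; rewrite eq_le; apply/andP; split; first by apply: ereal_inf_lbound; exists n.
  apply: le_ereal_inf_tmp => _ [k kP <-]; rewrite lee_fin !lambdaX ler_eXn2l ?ltr1n//.
  by apply: nmin; apply/asboolP.
rewrite lne_EFin ?lambda_gt0// -EFinM lambdaX lnXn// -[ln 2 *+ n]mulr_natl mulfK//.
by rewrite gt_eqF// ln_gt0// ltr1n.
Qed.

Hypothesis hchi : cutoff chi.
Hypothesis r2 : (2%:E <= r)%E.
Variables (T : R) (u : R -> vfield R).
Hypotheses (T0 : 0 <= T) (uC : in_Cw_L2 T u).
Local Notation U s := (u (clamp T s)).

Lemma lp_symbol_l2 q : -1 <= q -> l2 (lp_symbol chi q) /\ mu.-integrable setT (EFin \o lp_symbol chi q).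
Proof.
move=> q1; have [A A0 /(_ q q1) tb] := lp_symbol_bounded hchi.
have L0 : 0 <= 2 * lambda R q by rewrite mulr_ge0// ltW// lambda_gt0.
by split; [exact: bounded_symbol_l2 L0 tb|exact: bounded_symbol_integrable L0 tb].
Qed.

Lemma lp_symbol_crd_l2 q j : -1 <= q -> l2 (fun z => lp_symbol chi q z * crd z j) /\
  mu.-integrable setT (EFin \o (fun z => lp_symbol chi q z * crd z j)).
Proof.
move=> q1; have [A A0 /(_ q q1) tb] := lp_symbol_bounded hchi.
have L0 : 0 <= 2 * lambda R q by rewrite mulr_ge0// ltW// lambda_gt0.
by split; [exact: bounded_symbol_l2 L0 (bounded_symbol_crd j L0 tb)|
  exact: bounded_symbol_integrable L0 (bounded_symbol_crd j L0 tb)].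
Qed.

Lemma measurable_block (q : int) : -1 <= q ->
  measurable_fun setT (fun s => vLnorm r (Delta chi q (U s))).
Proof.
move=> q1; have [sl2 si] := lp_symbol_l2 q1; apply: vLnorm_lsc => //.
- by move=> s i; rewrite Delta_tfield; apply: measurable_fmult => //; exact: Cw_l2.
- by move=> i x; rewrite (funext (fun s => Delta_fmult chi q (U s) i x)); exact: fmult_continuous.
Qed.

Lemma measurable_block_curl (q : int) : -1 <= q ->
  measurable_fun setT (fun s => vLnorm +oo (Delta_curl chi q (U s))).
Proof.
move=> q1; have sl2 j := lp_symbol_crd_l2 j q1.
have E s i : Delta_curl chi q (U s) i = (fun x =>
  fmult (U s (i + 2%:R)) (fun z => lp_symbol chi q z * crd z (i + 1)) (pi / 2) x -
  fmult (U s (i + 1)) (fun z => lp_symbol chi q z * crd z (i + 2%:R)) (pi / 2) x).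
  apply/funext => x; apply: Delta_curl_fmult; first by move=> j; exact: Cw_l2.
  by move=> j; exact: (sl2 j).1.
apply: vLnorm_lsc => //; first by rewrite leey.
- move=> s i; rewrite E; apply: measurable_funB; apply: measurable_fmult; try exact: Cw_l2.
  + exact: (sl2 _).1.
  + exact: (sl2 _).1.
- move=> i x; under eq_fun do rewrite E.
  move=> s; apply: cvgB; apply: fmult_continuous => //.
  + exact: (sl2 _).1.
  + exact: (sl2 _).2.
  + exact: (sl2 _).1.
  + exact: (sl2 _).2.
Qed.

Lemma measurable_block_size (q : nat) : measurable_fun setT (fun s => block_size q (U s)).
Proof. by apply: emeasurable_funM => //; exact: measurable_block. Qed.

(** By [le_Q_r_witness], for positive indices the set is a countable union of superlevel sets of
    block sizes, which are measurable in time. *)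
Lemma measurable_le_Q_r (q : nat) theta : measurable [set s | ((q%:Z)%:~R%:E <= Q_r chi r theta (U s))%E].
Proof.
case: q => [|q].
  rewrite (_ : [set _ | _] = setT) ?predeqE//= => s; split => // _; exact/le_Q_r.
rewrite (_ : [set _ | _] = \bigcup_p [set s | (q < p)%N /\ (theta%:E <= block_size p (U s))%E]).
  apply: bigcup_measurable => p _; case: (ltnP q p) => qp.
    rewrite (_ : [set _ | _] = [set s | (theta%:E <= block_size p (U s))%E]).
      rewrite -[X in measurable X]setTI; apply: emeasurable_fun_c_infty => //.
      exact: measurable_block_size.
    by apply/seteqP; split => s //= -[].
  by rewrite (_ : [set _ | _] = set0)//; apply/seteqP; split => s //= -[].
apply/seteqP; split => s /=.
  by move=> /le_Q_r_witness-/(_ isT)[p qp h]; exists p.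
by move=> [p _ [qp h]]; exact: block_size_le_Q_r h _.
Qed.

End wavenumber_facts.

(** * Littlewood-Paley blocks *)

Section sobolev.
Variable R : realType.
Local Notation mR := (measurableTypeR R).
Local Notation X := (mR * mR * mR)%type.
Local Notation mu := (@mu3 R).
Implicit Types (x : X) (t : X -> R).

Let c3 : R := (2 * pi) ^- 3.

Let c3_gt0 : 0 < c3. Proof. by rewrite invr_gt0 pi3_gt0. Qed.

Lemma normc_sqr (z : R[i]) : Normc.normc z ^+ 2 = complex.Re z ^+ 2 + complex.Im z ^+ 2.
Proof. by case: z => a b /=; rewrite sqr_sqrtr// addr_ge0 ?sqr_ge0. Qed.

Lemma measurable_normc_fourier (f : X -> R) : l2 f ->
  measurable_fun setT (fun z : X => Normc.normc (fourier f z) ^+ 2).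
Proof.
move=> fl2; have [[m1 _] [m2 _]] := is_ft_l2 fl2 (fourier_ft fl2).
under eq_fun do rewrite normc_sqr.
by apply: measurable_funD; apply: measurable_funX.
Qed.

Lemma measurable_japanese (s : R) : measurable_fun setT (fun z : X => (1 + enorm z ^+ 2) `^ s).
Proof.
apply: (measurableT_comp (measurable_powR s)); apply: measurable_funD => //.
by apply: measurable_funX; exact: measurable_enorm.
Qed.

(** The multiplier is a sum of two cosine transforms, each controlled by Bessel's inequality. The
    factor 2 comes from (a + b)^2 <= 2 (a^2 + b^2), and one of the two factors [c3] cancels the (2
    pi)^3 of Bessel's inequality. *)
Lemma fmult_l2_le (f t w : X -> R) (K : R) : l2 f -> l2 t ->
  mu.-integrable setT (EFin \o t) -> (exists A, forall z, `|t z| <= A) ->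
  0 <= K -> measurable_fun setT w -> (forall z, 0 <= w z) -> (forall z, t z ^+ 2 <= K * w z) ->
  (\int[mu]_x (fmult f t 0 x ^+ 2)%:E <=
   (2 * c3 * K)%:E * \int[mu]_z (w z * Normc.normc (fourier f z) ^+ 2)%:E)%E.
Proof.
move=> fl2 tl2 it [A tA] K0 mw w0 tw.
have [F1l2 F2l2] := is_ft_l2 fl2 (fourier_ft fl2).
set F1 := (fun z : R3 R => complex.Re (fourier f z)) in F1l2.
set F2 := (fun z : R3 R => complex.Im (fourier f z)) in F2l2.
pose g1 := cosT (fun z : X => t z * F1 z) (cst 0).
pose g2 := cosT (fun z : X => t z * F2 z) (cst (0 + pi / 2)).
have i1 := l2M_integrable tl2 F1l2; have i2 := l2M_integrable tl2 F2l2.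
have m0 : measurable_fun setT (cst 0 : X -> R) by exact: measurable_cst.
have mp : measurable_fun setT (cst (0 + pi / 2) : X -> R) by exact: measurable_cst.
have mt : measurable_fun setT t by case: tl2.
have mF1 : measurable_fun setT F1 by case: F1l2.
have mF2 : measurable_fun setT F2 by case: F2l2.
have mg1 : measurable_fun setT g1 by exact: measurable_cosT.
have mg2 : measurable_fun setT g2 by exact: measurable_cosT.
have msq (h : X -> R) : measurable_fun setT h -> measurable_fun setT (fun x : X => (h x ^+ 2)%:E).
  by move=> mh; apply/measurable_EFinP; exact: measurable_funX.
have sq0 (h : X -> R) (x : X) : setT x -> (0%R <= (h x ^+ 2)%:E)%E by rewrite lee_fin sqr_ge0.
apply: (@le_trans _ _ ((2 * c3 ^+ 2)%:E * (\int[mu]_x (g1 x ^+ 2)%:E + \int[mu]_x (g2 x ^+ 2)%:E))%E).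
  rewrite -ge0_integralD//; [|exact: sq0|exact: msq|exact: sq0|exact: msq].
  rewrite -ge0_integralZl//; last 3 first.
  - by apply: emeasurable_funD; exact: msq.
  - by move=> x _; rewrite adde_ge0// sq0.
  - by rewrite lee_fin mulr_ge0// sqr_ge0.
  apply: ge0_le_integral => //.
  - by move=> x _; exact: sq0.
  - by apply: msq; exact: measurable_fmult.
  - by apply: emeasurable_funM => //; apply: emeasurable_funD; exact: msq.
  - move=> x _; rewrite -EFinD -EFinM lee_fin /fmult (mult_cosT F1l2 F2l2)//.
    rewrite -/c3 -/(g1 x) -/(g2 x) exprMn [leRHS](_ : _ = c3 ^+ 2 * (2 * (g1 x ^+ 2 + g2 x ^+ 2))); last by ring.
    rewrite ler_wpM2l ?sqr_ge0// -subr_ge0.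
    by rewrite (_ : _ - _ = (g1 x - g2 x) ^+ 2) ?sqr_ge0//; ring.
have b1 := bessel i1 m0; have b2 := bessel i2 mp.
have t2w (F : X -> R) : measurable_fun setT F ->
    (\int[mu]_z ((t z * F z) ^+ 2)%:E <= K%:E * \int[mu]_z (w z * F z ^+ 2)%:E)%E.
  move=> mF; have mwF : measurable_fun setT (fun z => (w z * F z ^+ 2)%:E).
    by apply/measurable_EFinP; apply: measurable_funM => //; exact: measurable_funX.
  rewrite -ge0_integralZl//; last by move=> z _; rewrite lee_fin mulr_ge0 ?sqr_ge0.
  apply: ge0_le_integral => //.
  - by move=> z _; exact: (sq0 (fun z => t z * F z)).
  - by apply: (msq (fun z => t z * F z)); exact: measurable_funM.
  - by apply: emeasurable_funM.
  - by move=> z _; rewrite -EFinM lee_fin exprMn [leRHS]mulrA ler_wpM2r ?sqr_ge0.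
have -> : (\int[mu]_z (w z * Normc.normc (fourier f z) ^+ 2)%:E =
  \int[mu]_z (w z * F1 z ^+ 2)%:E + \int[mu]_z (w z * F2 z ^+ 2)%:E)%E.
  rewrite -ge0_integralD//; last 4 first.
  - by move=> z _; rewrite lee_fin mulr_ge0 ?sqr_ge0.
  - by apply/measurable_EFinP; apply: measurable_funM => //; exact: measurable_funX.
  - by move=> z _; rewrite lee_fin mulr_ge0 ?sqr_ge0.
  - by apply/measurable_EFinP; apply: measurable_funM => //; exact: measurable_funX.
  by apply: eq_integral => z _; rewrite normc_sqr mulrDr EFinD.
have P0 := pi3_gt0 R.
have bb (F : X -> R) g : measurable_fun setT F ->
  (\int[mu]_y (g y ^+ 2)%:E <= ((2 * pi) ^+ 3)%:E * \int[mu]_x ((t x * F x) ^+ 2)%:E)%E ->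
  ((2 * c3 ^+ 2)%:E * \int[mu]_y (g y ^+ 2)%:E <= (2 * c3 * K)%:E * \int[mu]_z (w z * F z ^+ 2)%:E)%E.
  move=> mF gF; apply: (@le_trans _ _ ((2 * c3 ^+ 2)%:E * (((2 * pi) ^+ 3)%:E *
     (K%:E * \int[mu]_z (w z * F z ^+ 2)%:E)))%E).
    apply: lee_wpmul2l; first by rewrite lee_fin mulr_ge0// sqr_ge0.
    apply: (le_trans gF); apply: lee_wpmul2l; first by rewrite lee_fin ltW.
    exact: t2w.
  rewrite !muleA -!EFinM (_ : 2 * c3 ^+ 2 * _ * _ = 2 * c3 * K)//.
  rewrite (_ : _ * _ = 2 * c3 * K * (c3 * (2 * pi) ^+ 3)); last by ring.
  by rewrite /c3 mulVf ?mulr1// gt_eqF.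
have I0 (h : X -> R) : (0 <= \int[mu]_z (h z ^+ 2)%:E)%E by apply: integral_ge0 => z _; exact: sq0.
have J0 (h : X -> R) : (0 <= \int[mu]_z (w z * h z ^+ 2)%:E)%E.
  by apply: integral_ge0 => z _; rewrite lee_fin mulr_ge0// sqr_ge0.
rewrite (ge0_muleDr _ (I0 g1) (I0 g2)) (ge0_muleDr _ (J0 F1) (J0 F2)).
by apply: leeD; apply: bb.
Qed.

Lemma vLnorm2_le_sum (v : vfield R) (a : R) : 0 <= a -> (forall i, measurable3 (v i)) ->
  (\sum_i \int[mu]_x (v i x ^+ 2)%:E <= (a ^+ 2)%:E)%E -> (vLnorm 2%:E v <= a%:E)%E.
Proof.
move=> a0 mv; rewrite vLnorm_le//.
have E x : (vabs v x `^ 2)%:E = (\sum_i (v i x ^+ 2)%:E)%E.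
  rewrite sumEFin (powR_mulrn 2)// ?vabs_ge0// /vabs sqr_sqrtr// sumr_ge0// => i _; exact: sqr_ge0.
under [in X in _ -> X]eq_integral do rewrite E.
rewrite (powR_mulrn 2)// ge0_integral_sum//.
- by move=> i; apply/measurable_EFinP; apply: measurable_funX; exact: mv.
- by move=> i x _; rewrite lee_fin sqr_ge0.
Qed.

End sobolev.

(** * Decay of blocks from Sobolev regularity *)

Section sobolev_blocks.
Variable R : realType.
Local Notation mR := (measurableTypeR R).
Local Notation X := (mR * mR * mR)%type.
Local Notation mu := (@mu3 R).
Implicit Types (x : X) (t : X -> R).

Lemma poweR_half_le (J : \bar R) (M : R) : (0 <= J)%E -> (poweR J 2^-1 <= M%:E)%E -> (J <= (M ^+ 2)%:E)%E.
Proof.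
case: J => [b||]// b0; last by rewrite poweRyr ?invr_neq0// leye_eq.
rewrite poweR_EFin !lee_fin => bM; have M0 : 0 <= M by rewrite (le_trans _ bM)// powR_ge0.
have -> : b = (b `^ 2^-1) ^+ 2 by rewrite powR12_sqrt// sqr_sqrtr.
by rewrite lerXn2r ?nnegrE ?powR_ge0.
Qed.

(** Interpolation between L^2 and the supremum. The exponent 2/r is written as 2/3 of [three_over r]
    so that the case [r = +oo] is included. *)
Lemma vLnorm_interp (r : \bar R) (v : vfield R) (S b : R) : (2%:E <= r)%E -> 0 <= S -> 0 <= b ->
  (forall i, measurable3 (v i)) -> (forall x, vabs v x <= S) -> (vLnorm 2%:E v <= b%:E)%E ->
  (vLnorm r v <= (S `^ (1 - 2 / 3 * three_over r) * b `^ (2 / 3 * three_over r))%:E)%E.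
Proof.
move=> r2 S0 b0 mv vS; rewrite vLnorm_le//.
case: r r2 => [r||]// r2 vb; last first.
  rewrite /= mulr0 subr0 powRr0 mulr1 powRr1// vLnormy; apply/ess_supP.
  by apply: aeW => x; rewrite lee_fin.
rewrite lee_fin in r2; have r0 : 0 < r by exact: lt_le_trans r2.
rewrite vLnorm_le ?mulr_ge0 ?powR_ge0//.
have mr (p : R) : measurable_fun setT (fun y : X => (vabs v y `^ p)%:E).
  by apply/measurable_EFinP; apply: (measurableT_comp (measurable_powR p)); exact: measurable_vabs.
apply: (@le_trans _ _ ((S `^ (r - 2))%:E * \int[mu]_x (vabs v x `^ 2)%:E)%E).
  rewrite -ge0_integralZl//; last 2 first.
  - by move=> x _; rewrite lee_fin powR_ge0.
  - by rewrite lee_fin powR_ge0.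
  apply: ge0_le_integral => //.
  - by move=> x _; rewrite lee_fin powR_ge0.
  - by apply: emeasurable_funM.
  - move=> x _; rewrite -EFinM lee_fin -[X in _ `^ X <= _](subrK 2 r) [leLHS]powRD; last first.
      by rewrite subrK (gt_eqF r0).
    by rewrite ler_wpM2r ?powR_ge0// ge0_ler_powR ?nnegrE ?vabs_ge0 ?subr_ge0.
apply: (@le_trans _ _ ((S `^ (r - 2))%:E * (b `^ 2)%:E)%E).
  by rewrite lee_wpmul2l// lee_fin powR_ge0.
rewrite -EFinM lee_fin powRM ?powR_ge0// -!powRrM /=.
rewrite (_ : (1 - 2 / 3 * (3 / r)) * r = r - 2); last by field; rewrite gt_eqF.
by rewrite (_ : 2 / 3 * (3 / r) * r = 2)//; field; rewrite gt_eqF.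
Qed.

Variables (chi : R3 R -> R).
Hypothesis hchi : cutoff chi.

(** The symbol vanishes for |xi| <= 3/4 lambda_p, so on its support the Sobolev weight is at least
    [G] lambda_p^(2s) with G = (9/16)^s. *)
Lemma Delta_L2_sobolev (s : R) : 0 <= s -> exists2 C : R, 0 <= C & forall (f : vfield R) (M : R) (p : nat),
  (forall i, l2 (f i)) -> (Hs_norm s f <= M%:E)%E ->
  (vLnorm 2%:E (Delta chi p%:Z f) <= (C * lambda R p%:Z `^ (- s) * M)%:E)%E.
Proof.
move=> s0; have [A A0 tb] := lp_symbol_bounded hchi.
pose G : R := (9 / 16) `^ s; have G0 : 0 < G by rewrite powR_gt0// divr_gt0.
pose c3 : R := (2 * pi) ^- 3; have c30 : 0 < c3 by rewrite invr_gt0 pi3_gt0.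
pose C := Num.sqrt (2 * c3 * (A ^+ 2 / G)).
have C2 : C ^+ 2 = 2 * c3 * (A ^+ 2 / G).
  rewrite sqr_sqrtr//; apply: mulr_ge0; first by apply: mulr_ge0 => //; exact: ltW.
  by apply: mulr_ge0; [exact: sqr_ge0|rewrite invr_ge0 ltW].
exists C; first exact: sqrtr_ge0.
move=> f M p fl2 HM.
have M0 : 0 <= M by have := le_trans (poweR_ge0 _ _) HM; rewrite lee_fin.
have l0 := lambda_gt0 R p%:Z; have tbp := tb p%:Z isT.
have L0 : 0 <= 2 * lambda R p%:Z by rewrite mulr_ge0// ltW.
have [tl2 ti] := @lp_symbol_l2 R chi hchi p%:Z isT.
have [mt tA _] := tbp.
set l := lambda R p%:Z in l0 L0 *; set t := lp_symbol chi p%:Z in tl2 ti mt tA.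
pose w (z : X) := (1 + enorm z ^+ 2) `^ s.
have w0 z : 0 <= w z by exact: powR_ge0.
have mw : measurable_fun setT w by exact: measurable_japanese.
pose K := A ^+ 2 / G * (l `^ (- s)) ^+ 2.
have K0 : 0 <= K by rewrite mulr_ge0 ?sqr_ge0// divr_ge0 ?sqr_ge0// ltW.
have lG : G * (l `^ s) ^+ 2 = (9 / 16 * l ^+ 2) `^ s.
  by rewrite powRM ?divr_ge0 ?exprn_ge0 ?(ltW l0)// -powR_mulrn ?powR_ge0// powRAC powR_mulrn ?(ltW l0).
have tw z : t z ^+ 2 <= K * w z.
  have [zl|zl] := leP (enorm z) (3 / 4 * l).
    by rewrite /t lp_symbol_inner// expr0n mulr_ge0.
  have : (9 / 16 * l ^+ 2) `^ s <= w z.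
    apply: ge0_ler_powR => //.
    - by rewrite nnegrE; apply: mulr_ge0; [rewrite divr_ge0|exact: sqr_ge0].
    - by rewrite nnegrE; apply: addr_ge0 => //; exact: sqr_ge0.
    have : (3 / 4 * l) ^+ 2 <= enorm z ^+ 2.
      by rewrite lerXn2r ?nnegrE ?(ltW zl) ?enorm_ge0// mulr_ge0 ?(ltW l0)// divr_ge0.
    rewrite exprMn (_ : (3 / 4) ^+ 2 = 9 / 16 :> R); last by field.
    by move=> h; apply: (le_trans h); rewrite lerDr.
  rewrite -lG => h; apply: (@le_trans _ _ (A ^+ 2)).
    by rewrite -real_normK ?num_real// lerXn2r ?nnegrE.
  apply: (@le_trans _ _ (K * (G * (l `^ s) ^+ 2))); last by rewrite ler_wpM2l.
  have p0 : l `^ s != 0 by rewrite gt_eqF// powR_gt0.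
  rewrite /K powRN le_eqVlt; apply/orP; left; apply/eqP; field.
  by rewrite p0 gt_eqF.
have b0 : 0 <= C * l `^ (- s) * M by rewrite !mulr_ge0 ?powR_ge0 ?sqrtr_ge0.
rewrite Delta_tfield -/t; apply: vLnorm2_le_sum => //; first by move=> i; exact: measurable_fmult.
have mF i : measurable_fun setT (fun z : X => (w z * Normc.normc (fourier (f i) z) ^+ 2)%:E).
  apply/measurable_EFinP; apply: measurable_funM => //; exact: measurable_normc_fourier.
have F0 i (z : X) : setT z -> (0 <= (w z * Normc.normc (fourier (f i) z) ^+ 2)%:E)%E.
  by rewrite lee_fin mulr_ge0// sqr_ge0.
apply: (@le_trans _ _ (\sum_i (2 * c3 * K)%:E *
   \int[mu]_z (w z * Normc.normc (fourier (f i) z) ^+ 2)%:E)%E).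
  by apply: lee_sum => i _; apply: fmult_l2_le => //; exists A.
have cK0 : 0 <= 2 * c3 * K by rewrite mulr_ge0// mulr_ge0// ltW.
rewrite -ge0_sume_distrr; last by move=> i _; apply: integral_ge0 => z _; exact: F0.
rewrite -ge0_integral_sum//.
have /poweR_half_le J : (0 <= \int[mu]_xi ((1 + enorm xi ^+ 2) `^ s *
        \sum_i Normc.normc (fourier (f i) xi) ^+ 2)%:E)%E.
  by apply: integral_ge0 => z _; rewrite lee_fin mulr_ge0 ?powR_ge0// sumr_ge0// => i _; exact: sqr_ge0.
apply: (@le_trans _ _ ((2 * c3 * K)%:E * (M ^+ 2)%:E)%E).
  rewrite lee_wpmul2l ?lee_fin//; apply: le_trans (J _ HM).
  by under eq_integral do rewrite sumEFin -mulr_sumr.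
rewrite -EFinM lee_fin !exprMn C2 /K le_eqVlt; apply/orP; left; apply/eqP; ring.
Qed.

(** Nikol'skii's inequality at exponent 2 bounds the supremum by lambda_p^(3/2) times the L^2 norm.
    After interpolation the powers -1 + w and 3/2 - w, with w = 3/r, leave 1/2 for every [r]; thus
    blocks decay when s > 1/2. *)
Lemma block_size_sobolev (r : \bar R) (s : R) : (2%:E <= r)%E -> 0 <= s ->
  exists2 C : R, 0 <= C & forall (f : vfield R) (M : R) (p : nat),
  (forall i, l2 (f i)) -> (Hs_norm s f <= M%:E)%E ->
  (block_size chi r p f <= (C * lambda R p%:Z `^ (2^-1 - s) * M)%:E)%E.
Proof.
move=> r2 s0; have [C C0 CP] := Delta_L2_sobolev s0.
have p0 := pi_gt0 R.
pose D : R := 6 * (12 * pi) `^ (3 / 2).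
have D0 : 0 <= D by rewrite mulr_ge0 ?powR_ge0.
set w := three_over r.
exists (D `^ (1 - 2 / 3 * w) * C); first by rewrite mulr_ge0 ?powR_ge0.
move=> f M p fl2 HM.
have M0 : 0 <= M by have := le_trans (poweR_ge0 _ _) HM; rewrite lee_fin.
have l0 := lambda_gt0 R p%:Z; set l := lambda R p%:Z in l0 *.
have vb := CP f M p fl2 HM; rewrite -/l in vb; set b := C * _ * M in vb.
have b0 : 0 <= b by rewrite !mulr_ge0 ?powR_ge0.
have [A A0 /(_ p%:Z isT) tb] := lp_symbol_bounded hchi.
have L0 : 0 < 2 * l by rewrite mulr_gt0.
pose S := D * l `^ (3 / 2) * b.
have S0 : 0 <= S by rewrite !mulr_ge0 ?powR_ge0.
have vS x : vabs (Delta chi p%:Z f) x <= S.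
  apply: (le_trans (vabs_le_sum _ _)).
  have -> : S = \sum_(i < 3) (2 * (6 * (pi * (2 * l))) `^ (3 / 2) * b).
    rewrite sumr_const card_ord (_ : 6 * _ = 12 * pi * l); last by ring.
    by rewrite powRM ?mulr_ge0 ?(ltW p0) ?(ltW l0)// /S /D -mulr_natl; ring.
  apply: ler_sum => i _; rewrite -lee_fin.
  have := fmult_nikolskii (lexx 2%:E) L0 tb fl2 i x; rewrite -Delta_tfield.
  rewrite Delta_fmult => /le_trans; apply; rewrite [leRHS]EFinM lee_wpmul2l ?lee_fin ?mulr_ge0 ?powR_ge0//.
have [tl2 _] := @lp_symbol_l2 R chi hchi p%:Z isT.
have mv i : measurable3 (Delta chi p%:Z f i) by rewrite Delta_tfield; exact: measurable_fmult.
have := vLnorm_interp r2 S0 b0 mv vS vb; rewrite -/w => H.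
rewrite /block_size -/l -/w.
apply: (@le_trans _ _ ((l `^ (-1 + w))%:E * (S `^ (1 - 2 / 3 * w) * b `^ (2 / 3 * w))%:E)%E).
  by rewrite lee_wpmul2l ?lee_fin ?powR_ge0.
have bE : b `^ (1 - 2 / 3 * w) * b `^ (2 / 3 * w) = b.
  by rewrite -(@powRD _ b) subrK ?oner_eq0// powRr1.
have lE : l `^ (-1 + w) * (l `^ (3 / 2)) `^ (1 - 2 / 3 * w) * l `^ (- s) = l `^ (2^-1 - s).
  rewrite -powRrM -!(@powRD _ l) ?(gt_eqF l0) ?implybT//.
  by congr (_ `^ _); field.
have SE : S `^ (1 - 2 / 3 * w) = D `^ (1 - 2 / 3 * w) * (l `^ (3 / 2)) `^ (1 - 2 / 3 * w) * b `^ (1 - 2 / 3 * w).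
  have h0 : 0 <= l `^ (3 / 2) by exact: powR_ge0.
  by rewrite /S (powRM _ (mulr_ge0 D0 h0) b0) (powRM _ D0 h0).
rewrite -EFinM lee_fin SE -lE le_eqVlt; apply/orP; left; apply/eqP.
move: bE; rewrite {3}/b; clear.
move: (D `^ _) (l `^ (-1 + w)) ((l `^ (3 / 2)) `^ _) (b `^ _) (b `^ _) (l `^ (- s)) => d l1 l2 b1 b2 l3 bE.
by transitivity (d * (l1 * l2) * (b2 * b1)); [ring|rewrite bE; ring].
Qed.

End sobolev_blocks.

(** * Norm inequalities and composition of multipliers *)

Section block_algebra.
Variable R : realType.
Local Notation mR := (measurableTypeR R).
Local Notation X := (mR * mR * mR)%type.
Local Notation mu := (@mu3 R).
Implicit Types (x : X) (t : X -> R) (v w : vfield R) (r : \bar R).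

Definition vadd v w : vfield R := fun i y => v i y + w i y.
Definition vopp v : vfield R := fun i y => - v i y.

Lemma vabsD v w x : vabs (vadd v w) x <= vabs v x + vabs w x.
Proof.
have s0 v' : 0 <= \sum_i v' i x ^+ 2 :> R by apply: sumr_ge0 => i _; exact: sqr_ge0.
rewrite /vadd -[leRHS]ger0_norm ?addr_ge0 ?vabs_ge0// -sqrtr_sqr; apply: ler_wsqrtr.
rewrite sqrrD /vabs !sqr_sqrtr// -sqrtrM//.
have CS : \sum_i v i x * w i x <= Num.sqrt ((\sum_i v i x ^+ 2) * (\sum_i w i x ^+ 2)).
  apply: (le_trans (ler_norm _)); rewrite -sqrtr_sqr; apply: ler_wsqrtr.
  rewrite !big_ord_recl !big_ord0 /= !addr0 -subr_ge0.
  move: (v _ x) (v _ x) (v _ x) (w _ x) (w _ x) (w _ x) => a b c d e f.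
  rewrite (_ : _ - _ = (c * e - b * f) ^+ 2 + (c * d - a * f) ^+ 2 + (b * d - a * e) ^+ 2); last by ring.
  by rewrite !addr_ge0 ?sqr_ge0.
apply: (@le_trans _ _ (\sum_i v i x ^+ 2 + (\sum_i v i x * w i x) *+ 2 + \sum_i w i x ^+ 2)).
  rewrite le_eqVlt; apply/orP; left; apply/eqP.
  rewrite -mulr_natl mulr_sumr -!big_split; apply: eq_bigr => i _ /=; ring.
by rewrite lerD2r lerD2l lerMn2r CS orbT.
Qed.

Lemma le_vLnorm r v w : (2%:E <= r)%E -> (forall i, measurable3 (v i)) -> (forall i, measurable3 (w i)) ->
  (forall x, vabs v x <= vabs w x) -> (vLnorm r v <= vLnorm r w)%E.
Proof.
move=> r2 mv mw vw; case: r r2 => [r||]// r2.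
- have r0 : 0 < r by rewrite lee_fin in r2; exact: lt_le_trans r2.
  have mr v' : (forall i, measurable3 (v' i)) -> measurable_fun setT (fun y : X => (vabs v' y `^ r)%:E).
    by move=> mv'; apply/measurable_EFinP; apply: (measurableT_comp (measurable_powR r)); exact: measurable_vabs.
  have key : (\int[mu]_x (vabs v x `^ r)%:E <= \int[mu]_x (vabs w x `^ r)%:E)%E.
    apply: ge0_le_integral.
    - exact: measurableT.
    - by move=> y _; rewrite lee_fin powR_ge0.
    - exact: mr.
    - exact: mr.
    - move=> y _; rewrite lee_fin; apply: ge0_ler_powR; rewrite ?nnegrE ?vabs_ge0 ?(ltW r0)//; exact: vw.
  clear vw mv mw mr; rewrite (vLnormE r v) (vLnormE r w); apply: gt0_ler_poweR => //.
  + by rewrite invr_ge0 ltW.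
  + by rewrite in_itv/= leey andbT; apply: integral_ge0 => y _; rewrite lee_fin powR_ge0.
  + by rewrite in_itv/= leey andbT; apply: integral_ge0 => y _; rewrite lee_fin powR_ge0.
- by rewrite (vLnormy v) (vLnormy w); apply: le_ess_sup; apply: aeW => y /=; rewrite lee_fin.
Qed.

Lemma vLnormD r v w : (2%:E <= r)%E -> (forall i, measurable3 (v i)) -> (forall i, measurable3 (w i)) ->
  (vLnorm r (vadd v w) <= vLnorm r v + vLnorm r w)%E.
Proof.
move=> r2 mv mw.
have mvv := measurable_vabs mv; have mww := measurable_vabs mw.
have r1 : (1 <= r)%E by apply: le_trans r2; rewrite lee_fin ler1n.
apply: le_trans (@eminkowski _ _ R mu (vabs v) (vabs w) r mvv mww r1).
(* The scalar |v| + |w| is placed in one component, so that the comparison reduces to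
   [le_vLnorm]. *)
pose s : vfield R := fun i y => if i == 0 then vabs v y + vabs w y else 0.
have sE y : vabs s y = vabs v y + vabs w y.
  rewrite /vabs -/(vabs v y) -/(vabs w y) !big_ord_recl big_ord0 /= /s /=.
  by rewrite expr0n /= !addr0 sqrtr_sqr ger0_norm// addr_ge0 ?vabs_ge0.
apply: (@le_trans _ _ (vLnorm r s)); last first.
  by rewrite /vLnorm (@eq_Lnorm _ _ R mu r _ (EFin \o (vabs v \+ vabs w)%R))// => y /=; rewrite sE.
apply: le_vLnorm => //.
- by move=> i; exact: (measurable_funD (mv i) (mw i)).
- by move=> i; rewrite /s; case: eqP => _; [exact: measurable_funD|exact: measurable_cst].
- by move=> y; rewrite sE; exact: vabsD.
Qed.

Lemma vLnormN r v : vLnorm r (vopp v) = vLnorm r v.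
Proof.
rewrite /vLnorm; congr Lnorm; apply/funext => y; congr EFin.
by rewrite /vabs /vopp; under eq_bigr do rewrite sqrrN.
Qed.

Lemma fmultB (f g t : X -> R) a x : l2 f -> l2 g -> l2 t -> mu.-integrable setT (EFin \o t) ->
  fmult (fun y => f y - g y) t a x = fmult f t a x - fmult g t a x.
Proof.
move=> fl2 gl2 tl2 it; have fgl2 := l2D fl2 (l2N gl2).
have mb : measurable_fun setT (fun z : X => - dot x z - a).
  apply: measurable_funB => //; apply: (measurableT_comp (f := (-%R : R -> R))) => //.
  exact: measurable_dot.
have kl2 := l2_cosT it tl2 mb.
rewrite !fmult_rep// -mulrBr -RintegralB//; [|exact: l2M_integrable..].
by congr (_ * _); apply: eq_Rintegral => y _; rewrite mulrBl.
Qed.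

Lemma fmultD_symbol (f t1 t2 : X -> R) a x : l2 f -> l2 t1 -> l2 t2 ->
  fmult f (fun z => t1 z + t2 z) a x = fmult f t1 a x + fmult f t2 a x.
Proof.
move=> fl2 h1 h2; have [F1l2 F2l2] := is_ft_l2 fl2 (fourier_ft fl2).
by rewrite /fmult multD// mulrDr.
Qed.

(** The inner function is a sum of two cosine transforms. By [fmult_rep] the outer multiplier pairs
    it with the transform of [s], and Parseval's identity brings this pairing back to the frequency
    side, where the symbols multiply. *)
Lemma fmult_comp (f h s : X -> R) (A B : R) x : l2 f -> l2 h -> (forall z, `|h z| <= A) ->
  l2 s -> mu.-integrable setT (EFin \o s) -> (forall z, `|s z| <= B) ->
  continuous (s : R3 R -> R) -> (forall z, s (oppx z) = s z) ->
  fmult (fmult f h 0) s 0 x = fmult f (fun z => h z * s z) 0 x.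
Proof.
move=> fl2 hl2 hA sl2 is_ sB cs se.
have [F1l2 F2l2] := is_ft_l2 fl2 (fourier_ft fl2).
set F1 := (fun z : R3 R => complex.Re (fourier f z)) in F1l2.
set F2 := (fun z : R3 R => complex.Im (fourier f z)) in F2l2.
have hsl2 : l2 (fun z => h z * s z) by apply: (l2M_bounded hl2 _ sB); case: sl2.
have mb : measurable_fun setT (fun z : X => - dot x z).
  by apply: (measurableT_comp (f := (-%R : R -> R))) => //; exact: measurable_dot.
have kl2 := l2_cosT is_ sl2 mb.
have gl2 F : l2 F -> l2 (fun z => h z * F z).
  by move=> Fl2; under [X in l2 X]eq_fun do rewrite mulrC; apply: (l2M_bounded Fl2 _ hA); case: hl2.
have i1 := l2M_integrable hl2 F1l2; have i2 := l2M_integrable hl2 F2l2.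
have m0 : measurable_fun setT (cst 0 : X -> R) by exact: measurable_cst.
have mp : measurable_fun setT (cst (0 + pi / 2) : X -> R) by exact: measurable_cst.
have l1c := l2_cosT i1 (gl2 _ F1l2) m0; have l2c := l2_cosT i2 (gl2 _ F2l2) mp.
rewrite fmult_rep//; last exact: (l2_fmult _ fl2 hl2 hA).
under eq_Rintegral do rewrite /fmult (mult_cosT F1l2 F2l2)//.
under [X in cosT s X]eq_fun do rewrite subr0.
pose k := cosT s (fun z : X => - dot x z).
rewrite (_ : \int[mu]_y _ = (2 * pi) ^- 3 *
   (\int[mu]_y (cosT (fun z => h z * F1 z) (cst 0) y * k y) +
    \int[mu]_y (cosT (fun z => h z * F2 z) (cst (0 + pi / 2)) y * k y))); last first.
  have j1 := l2M_integrable l1c kl2; have j2 := l2M_integrable l2c kl2.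
  rewrite -RintegralD// -(@RintegralZl _ _ _ _ _ _ _ measurableT).
    by apply: eq_Rintegral => y _; rewrite /k -mulrA; congr (_ * _); exact: mulrDl.
  by have := integrableD measurableT j1 j2; apply: eq_integrable.
rewrite (parseval x i1 m0 (gl2 _ F1l2).2 is_ sB cs se) (parseval x i2 mp (gl2 _ F2l2).2 is_ sB cs se).
have cP : (2 * pi) ^- 3 * (2 * pi) ^+ 3 = 1 :> R by rewrite mulVf// gt_eqF// (pi3_gt0 R).
rewrite -mulrDr (mulrA ((2 * pi) ^- 3) ((2 * pi) ^+ 3)) cP mul1r.
rewrite /fmult (mult_cosT F1l2 F2l2)//; congr (_ * (_ + _)); apply: eq_Rintegral => z _; congr (_ * _);
  by rewrite mulrAC.
Qed.

Variables (chi : R3 R -> R) (r : \bar R).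
Hypotheses (hchi : cutoff chi) (r2 : (2%:E <= r)%E).

Lemma powR_lt_eventually (d e : R) : 0 < d -> 0 < e ->
  exists q0 : nat, forall p : nat, (q0 <= p)%N -> (2 ^+ p) `^ (- d) < e.
Proof.
move=> d0 e0; exists (Num.bound (e^-1 `^ d^-1)) => p qp.
have : e^-1 `^ d^-1 < 2 ^+ p.
  apply: (lt_trans (archi_boundP (powR_ge0 _ _))).
  by rewrite -natrX ltr_nat (leq_ltn_trans qp)// ltn_expl.
have p0 : 0 < 2 ^+ p :> R by rewrite exprn_gt0.
move=> /(gt0_ltr_powR d0 (powR_ge0 _ _) (ltW p0)).
rewrite -powRrM mulVf ?gt_eqF// powRr1 ?invr_ge0 ?(ltW e0)// => h.
by rewrite powRN invf_plt// posrE powR_gt0.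
Qed.

(** Continuity bounds the H^s norm on the compact interval, and [block_size_sobolev] converts the
    bound into decay like lambda_p^(1/2 - s), uniformly in [t]. *)
Lemma blocks_small (T s theta a b : R) (u : R -> vfield R) : 2^-1 < s ->
  (forall t : R, 0 <= t <= T -> L2 (u t)) -> Hs_continuous s `]0, T[ u -> 0 < theta -> 0 < a -> a <= b -> b < T ->
  exists q0 : nat, forall (p : nat) (t : R), (q0 <= p)%N -> a <= t <= b -> (block_size chi r p (u t) < theta%:E)%E.
Proof.
move=> s2 uL2 [Hfin Hc] th0 a0 ab bT.
have sub : `[a, b]%classic `<=` `]0, T[%classic.
  move=> t /=; rewrite !in_itv /= => /andP[h1 h2].
  by rewrite (lt_le_trans a0 h1) (le_lt_trans h2 bT).
have [t0 _ tmax] := EVT_max ab (continuous_subspaceW sub Hc).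
pose M := fine (Hs_norm s (u t0)).
have s0 : 0 <= s by rewrite (le_trans _ (ltW s2))// invr_ge0.
have [C C0 CP] := block_size_sobolev hchi r2 s0.
have M0 : 0 <= M by rewrite fine_ge0// poweR_ge0.
have d0 : 0 < s - 2^-1 by rewrite subr_gt0.
have e0 : 0 < theta / (C * M + 1) by rewrite divr_gt0// ltr_wpDl// mulr_ge0.
have [q0 q0P] := powR_lt_eventually d0 e0.
exists q0 => p t qp tab.
have t0T : `]0, T[%classic t by apply: sub; rewrite /= in_itv.
have HM : (Hs_norm s (u t) <= M%:E)%E.
  by rewrite -(fineK (Hfin _ t0T)) lee_fin; apply: tmax; rewrite in_itv.
have tl2 : forall i, l2 (u t i).
  apply: vLnorm2_l2; apply: uL2; move: t0T; rewrite /= in_itv/= => /andP[/ltW -> /ltW ->]; by [].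
apply: (le_lt_trans (CP _ _ _ tl2 HM)); rewrite lte_fin lambdaX.
have := q0P p qp; rewrite opprB ltr_pdivlMr ?ltr_wpDl ?mulr_ge0// => h.
apply: le_lt_trans h; rewrite mulrDr mulr1 mulrAC mulrC -[leLHS]addr0.
by rewrite lerD ?powR_ge0.
Qed.

End block_algebra.

(** * Blocks of the truncation u_(<=Q) *)

Section low_frequencies.
Variable R : realType.
Local Notation mR := (measurableTypeR R).
Local Notation X := (mR * mR * mR)%type.
Local Notation mu := (@mu3 R).
Implicit Types (x z : X).
Variables (chi : R3 R -> R) (r : \bar R).
Hypotheses (hchi : cutoff chi) (r2 : (2%:E <= r)%E).

Local Notation low n := (chis chi (lambda R (n%:Z))^-1).

Lemma low_symbol_l2 (n : nat) : l2 (low n) /\ exists A, forall z, `|low n z| <= A.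
Proof.
have [A A0 /(_ (lambda R n%:Z)^-1)] := bounded_symbol_chis hchi.
rewrite invr_gt0 lambda_gt0 invrK => /(_ isT) tb.
split; first exact: bounded_symbol_l2 (ltW (lambda_gt0 _ _)) tb.
by exists A; case: tb.
Qed.

Lemma low_symbolS (n : nat) : low n.+1 = (fun z => low n z + lp_symbol chi n%:Z z).
Proof.
apply/funext => z; rewrite lp_symbolE; last by lia.
by rewrite /= (_ : n%:Z + 1 = n.+1%:Z) ?subrKC//; lia.
Qed.

Lemma fmult_low (f : X -> R) (n : nat) x : l2 f ->
  fmult f (low n) 0 x = \sum_(0 <= k < n.+1) fmult f (lp_symbol chi (k%:Z - 1)) 0 x.
Proof.
move=> fl2; elim: n => [|n IH].
  rewrite big_nat1; congr (fmult f _ 0 x); apply/funext => z.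
  by rewrite -(sum_lp_symbol chi) big_nat1.
have hl := (low_symbol_l2 n).1; have pl := (@lp_symbol_l2 R chi hchi n%:Z isT).1.
rewrite low_symbolS.
apply: (etrans (fmultD_symbol 0 x fl2 hl pl)).
rewrite [RHS]big_nat_recr; last by [].
apply: (congr2 +%R); first exact: IH.
by rewrite (_ : n.+1%:Z - 1 = n%:Z)//; lia.
Qed.

(** The blocks of index up to [n] telescope to the cutoff at radius lambda_(n+1), not lambda_n. *)
Lemma lp_low_fmult (f : vfield R) (n : nat) : (forall i, l2 (f i)) ->
  lp_low chi n%:R%:E f = fun i => fmult (f i) (low n.+1) 0.
Proof.
move=> fl2; apply/funext => i; apply/funext => x; rewrite fmult_low// /lp_low.
(* The condition k - 1 <= n means k < n + 2, so the partial sums are constant from n + 2 on. *)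
apply: lim_near_cst => //; exists n.+2 => // N /= nN.
rewrite (big_cat_nat (n := n.+2))//= [X in _ + X]big1_seq ?addr0.
  apply: congr_big_nat => // k /andP[_ kn]; last by rewrite Delta_fmult.
  by rewrite lee_fin -[n%:R]/(n%:Z%:~R) ler_int; lia.
move=> k /andP[]; rewrite lee_fin -[n%:R]/(n%:Z%:~R) ler_int mem_index_iota; lia.
Qed.

(** For q < n the support of the block lies within radius 2 lambda_q <= lambda_n, where the cutoff
    at scale lambda_(n+1) is still 1. *)
Lemma low_mul_block (q n : nat) z : (q < n)%N -> low n.+1 z * lp_symbol chi q%:Z z = lp_symbol chi q%:Z z.
Proof.
move=> qn; have [B B0 /(_ q%:Z isT)[_ _ t0]] := lp_symbol_bounded hchi.
have [zq|/t0 ->] := leP (enorm z) (2 * lambda R q%:Z); last by rewrite mulr0.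
rewrite chis_inner ?mul1r ?invr_gt0 ?lambda_gt0// invrK (le_trans zq)//.
rewrite !lambdaX exprS -exprS mulrA.
have : (2 : R) ^+ q.+1 <= 2 ^+ n by rewrite ler_eXn2l ?ltr1n.
have : 0 < (2 : R) ^+ n by rewrite exprn_gt0.
lra.
Qed.

(** At the edge [q = n] the cutoff is no longer 1 on the whole support of the block. The two symbols
    add up to [low n.+2 - low n], and multiplying by [low n.+1] changes the first cutoff into
    [low n.+1] and fixes the second, by the nesting of the regions where they are 1 or 0. *)
Lemma low_mul_blocks (n : nat) z :
  low n.+1 z * lp_symbol chi n%:Z z + low n.+1 z * lp_symbol chi n.+1%:Z z = lp_symbol chi n%:Z z.
Proof.
rewrite -mulrDr !lp_symbolE; [|lia..].
rewrite /= (_ : n%:Z + 1 = n.+1%:Z); last by lia.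
rewrite (_ : n.+1%:Z + 1 = n.+2%:Z); last by lia.
have l0 : 0 < lambda R n%:Z by exact: lambda_gt0.
have l1 : lambda R n.+1%:Z = 2 * lambda R n%:Z by rewrite !lambdaX exprS.
have l2 : lambda R n.+2%:Z = 4 * lambda R n%:Z by rewrite !lambdaX !exprS mulrA -natrM.
have i0 k : 0 < (lambda R k)^-1 by rewrite invr_gt0 lambda_gt0.
have [z1|z1] := leP (enorm z) (3 / 4 * (2 * lambda R n%:Z)).
  have -> : low n.+1 z = 1 by rewrite chis_inner// invrK l1.
  have -> : low n.+2 z = 1 by rewrite chis_inner// invrK l2; lra.
  by ring.
have -> : low n z = 0 by rewrite chis_outer// invrK; lra.
have [z2|z2] := leP (enorm z) (3 / 4 * (4 * lambda R n%:Z)).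
  have -> : low n.+2 z = 1 by rewrite chis_inner// invrK l2.
  by ring.
have -> : low n.+1 z = 0 by rewrite chis_outer// invrK l1; lra.
by ring.
Qed.

Lemma Delta_low (f : vfield R) (q n : nat) i x : (forall i, l2 (f i)) ->
  Delta chi q%:Z (lp_low chi n%:R%:E f) i x =
  fmult (f i) (fun z => low n.+1 z * lp_symbol chi q%:Z z) 0 x.
Proof.
move=> fl2; rewrite lp_low_fmult// Delta_fmult.
have [hl2 [A hA]] := low_symbol_l2 n.+1.
have [B B0 /(_ q%:Z isT)[_ sB _]] := lp_symbol_bounded hchi.
have [sl2 si] := @lp_symbol_l2 R chi hchi q%:Z isT.
apply: (fmult_comp x (fl2 i) hl2 hA sl2 si sB); first exact: lp_symbol_continuous.
by move=> z; exact: lp_symbol_oppx.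
Qed.

Lemma besov_ge (s : R) (f : vfield R) (q : nat) :
  ((lambda R q%:Z `^ s)%:E * vLnorm r (Delta chi q%:Z f) <= besov chi s r f)%E.
Proof. by apply: ereal_sup_ubound; exists q%:Z => //=; lia. Qed.

Lemma measurable_Delta (f : vfield R) (q : nat) i : (forall i, l2 (f i)) -> measurable3 (Delta chi q%:Z f i).
Proof.
by move=> fl2; rewrite Delta_tfield; apply: measurable_fmult => //; exact: (@lp_symbol_l2 R chi hchi q%:Z isT).1.
Qed.

(** For q < n the blocks of [f] and of its truncation coincide. For q = n the blocks n and n + 1 of
    the truncation are both needed, and lambda_n^s <= 2 lambda_(n+1)^s because s >= -1; hence 3 = 1
    + 2. *)
Lemma block_le_besov_low (s : R) (f : vfield R) (q n : nat) : -1 <= s -> (forall i, l2 (f i)) -> (q <= n)%N ->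
  ((lambda R q%:Z `^ s)%:E * vLnorm r (Delta chi q%:Z f) <= 3%:E * besov chi s r (lp_low chi n%:R%:E f))%E.
Proof.
move=> s1 fl2 qn; set v := lp_low _ _ _.
have vl2 i : l2 (v i).
  have [hl2 [A hA]] := low_symbol_l2 n.+1.
  by rewrite /v lp_low_fmult//; exact: l2_fmult hA.
have B0 : (0 <= besov chi s r v)%E.
  by apply: le_trans (besov_ge s v 0); rewrite mule_ge0 ?lee_fin ?powR_ge0 ?vLnorm_ge0.
have [qn'|nq] := ltnP q n.
  have -> : Delta chi q%:Z f = Delta chi q%:Z v.
    apply/funext => i; apply/funext => x; rewrite Delta_low// Delta_fmult.
    by congr (fmult _ _ 0 x); apply/funext => z; rewrite low_mul_block.
  apply: (le_trans (besov_ge s v q)); rewrite -[leLHS]mul1e.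
  by apply: lee_wpmul2r => //; rewrite lee_fin ler1n.
have -> : q = n by apply/eqP; rewrite eqn_leq qn nq.
have -> : Delta chi n%:Z f = vadd (Delta chi n%:Z v) (Delta chi n.+1%:Z v).
  apply/funext => i; apply/funext => x; rewrite /vadd !Delta_low// Delta_fmult.
  have hb k : l2 (fun z => low n.+1 z * lp_symbol chi k%:Z z).
    have [B _ /(_ k%:Z isT)[mk kB _]] := lp_symbol_bounded hchi.
    by apply: (l2M_bounded (low_symbol_l2 n.+1).1 mk kB).
  by rewrite -fmultD_symbol//; congr (fmult _ _ 0 x); apply/funext => z; rewrite low_mul_blocks.
have l0 : 0 <= lambda R n%:Z `^ s by exact: powR_ge0.
apply: (@le_trans _ _ ((lambda R n%:Z `^ s)%:E *
   (vLnorm r (Delta chi n%:Z v) + vLnorm r (Delta chi n.+1%:Z v)))%E).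
  by rewrite lee_wpmul2l ?lee_fin//; apply: vLnormD => // i; exact: measurable_Delta.
rewrite ge0_muleDr ?vLnorm_ge0//.
have -> : (3%:E * besov chi s r v = besov chi s r v + 2%:E * besov chi s r v)%E.
  by rewrite -[X in (X + _)%E]mul1e -ge0_muleDl ?lee_fin// -EFinD; congr (_%:E * _)%E; ring.
apply: leeD; first exact: besov_ge.
apply: (@le_trans _ _ (2%:E * ((lambda R n.+1%:Z `^ s)%:E * vLnorm r (Delta chi n.+1%:Z v)))%E); last first.
  by rewrite lee_wpmul2l ?lee_fin//; exact: besov_ge.
rewrite muleA -EFinM lee_wpmul2r ?vLnorm_ge0// lee_fin !lambdaX exprS powRM ?exprn_ge0// mulrA.
rewrite ler_peMl ?powR_ge0// -{1}[2]powRr1// -powRD; last by rewrite pnatr_eq0 implybT.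
by rewrite -[leLHS](powRr0 2); apply: ler_powR; [rewrite ler1n|rewrite -lerBlDl sub0r].
Qed.

(** The decomposition is f = (f - g) - (h - g) + h. It is used with f = u(t), g = u(T) and h = u(t0)
    for a time t0 < T: high blocks are known to be small at t0, but not at T. *)
Lemma block_size_triangle (f g h : vfield R) (p : nat) :
  (forall i, l2 (f i)) -> (forall i, l2 (g i)) -> (forall i, l2 (h i)) ->
  (block_size chi r p f <= besov chi (-1 + three_over r) r (vsub f g) +
     besov chi (-1 + three_over r) r (vsub h g) + block_size chi r p h)%E.
Proof.
move=> fl2 gl2 hl2; set s := -1 + three_over r.
have sub_l2 (a b : vfield R) : (forall i, l2 (a i)) -> (forall i, l2 (b i)) -> forall i, l2 (vsub a b i).
  by move=> al2 bl2 i; exact: l2D (al2 i) (l2N (bl2 i)).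
have fg := sub_l2 _ _ fl2 gl2; have hg := sub_l2 _ _ hl2 gl2.
have [tl2 ti] := @lp_symbol_l2 R chi hchi p%:Z isT.
have alg (a b d a1 a2 : R) : a1 = a - b -> a2 = d - b -> a = a1 + - a2 + d by move=> -> ->; ring.
have E : Delta chi p%:Z f =
    vadd (vadd (Delta chi p%:Z (vsub f g)) (vopp (Delta chi p%:Z (vsub h g)))) (Delta chi p%:Z h).
  apply/funext => i; apply/funext => x; rewrite /vadd /vopp !Delta_fmult.
  have e1 : fmult (vsub f g i) (lp_symbol chi p%:Z) 0 x = _ := fmultB 0 x (fl2 i) (gl2 i) tl2 ti.
  have e2 : fmult (vsub h g i) (lp_symbol chi p%:Z) 0 x = _ := fmultB 0 x (hl2 i) (gl2 i) tl2 ti.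
  exact: alg e1 e2.
have l0 : (0 <= (lambda R p%:Z `^ s)%:E)%E by rewrite lee_fin powR_ge0.
have mD a i : (forall i, l2 (a i)) -> measurable3 (Delta chi p%:Z a i) by move=> al2; exact: measurable_Delta.
have mO i : measurable3 (vopp (Delta chi p%:Z (vsub h g)) i).
  by apply: (measurableT_comp (f := (-%R : R -> R))) => //; exact: mD.
have H : (vLnorm r (Delta chi p%:Z f) <= vLnorm r (Delta chi p%:Z (vsub f g)) +
     vLnorm r (Delta chi p%:Z (vsub h g)) + vLnorm r (Delta chi p%:Z h))%E.
  rewrite {1}E; apply: (le_trans (vLnormD r2 _ _)).
  - by move=> i; apply: (measurable_funD _ (mO i)); exact: mD.
  - by move=> i; exact: mD.
  apply: leeD => //; apply: (le_trans (vLnormD r2 _ _)) => //; last by rewrite vLnormN.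
  by move=> i; exact: mD.
apply: (le_trans (lee_wpmul2l l0 H)).
rewrite ge0_muleDr ?adde_ge0 ?vLnorm_ge0// ge0_muleDr ?vLnorm_ge0//.
by apply: leeD => //; apply: leeD; exact: besov_ge.
Qed.

End low_frequencies.

(** * Time integrals *)

Section limsup.
Variable R : realType.
Implicit Types (a v : (\bar R)^nat).
Local Open Scope ereal_scope.

Lemma le_limn_esup a v : (exists n0, forall n, (n0 <= n)%N -> a n <= v n) -> limn_esup a <= limn_esup v.
Proof.
move=> [n0 av]; apply: le_ereal_inf_tmp => _ [V [n1 _ Vn1] <-].
apply: ge_ereal_inf; exists (ereal_sup (a @` [set n | (maxn n0 n1 <= n)%N])).
  by exists [set n | (maxn n0 n1 <= n)%N] => //; exists (maxn n0 n1).
apply: ge_ereal_sup => y [n /=]; rewrite geq_max => /andP[n0n n1n] <-.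
apply: (le_trans (av _ n0n)); apply: ereal_sup_ubound; exists n => //; exact: Vn1.
Qed.

Lemma limn_esup_le a M : (exists n0, forall n, (n0 <= n)%N -> a n <= M) -> limn_esup a <= M.
Proof.
move=> [n0 aM]; apply: ge_ereal_inf; exists (ereal_sup (a @` [set n | (n0 <= n)%N])).
  by exists [set n | (n0 <= n)%N] => //; exists n0.
by apply: ge_ereal_sup => _ [n /= n0n <-]; exact: aM.
Qed.

Lemma limn_esup_lt a M : limn_esup a < M -> exists n0, forall n, (n0 <= n)%N -> a n < M.
Proof.
move=> /ereal_inf_lt[_ [V [n0 _ Vn0] <-]] VM; exists n0 => n n0n.
by apply: le_lt_trans VM; apply: ereal_sup_ubound; exists n => //; exact: Vn0.
Qed.

End limsup.

Section time_integrals.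
Variable R : realType.
Local Notation leb := (@lebesgue_measure R).
Local Open Scope ereal_scope.
Implicit Types (D E : set R) (f g h : R -> \bar R).

(** Measurability is not assumed: the integral of a nonnegative function is a supremum over the
    simple functions below it. This matters for the integrands of (3) and (7), whose measurability
    in time is not established. *)
Lemma le_ge0_integral D f g : (forall t, D t -> 0 <= f t <= g t) ->
  \int[leb]_(t in D) f t <= \int[leb]_(t in D) g t.
Proof.
move=> fg; rewrite !ge0_integralE; last 2 first.
- by move=> t /fg/andP[f0]; exact: le_trans.
- by move=> t /fg/andP[].
apply: ereal_sup_le => _ [h hf <-]; exists h => // t; apply: (le_trans (hf t)).
by rewrite !patchE; case: ifP => // /set_mem /fg /andP[].
Qed.

Lemma le_subset_integral D E f : D `<=` E -> (forall t, E t -> 0 <= f t) ->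
  \int[leb]_(t in D) f t <= \int[leb]_(t in E) f t.
Proof.
move=> DE f0; rewrite integral_mkcond [leRHS]integral_mkcond; apply: le_ge0_integral => t _.
rewrite !patchE; case: ifPn => [/set_mem tD|tD].
  by rewrite mem_set ?f0 ?lexx//; exact: DE.
by case: ifPn => [/set_mem tE|_]; rewrite lexx// f0.
Qed.

Lemma integral_le_off D E f g (t0 : R) : measurable D -> measurable_fun D g ->
  (forall t, D t -> 0 <= g t) -> (forall t, 0 <= f t) ->
  (forall t, D t -> t != t0 -> ~ E t -> g t = 0) -> (forall t, D t -> g t <= f t) ->
  \int[leb]_(t in D) g t <= \int[leb]_(t in E) f t.
Proof.
move=> mD mg g0 f0 gE gf.
rewrite (@ge0_negligible_integral _ _ _ leb D [set t0])//; last exact: lebesgue_measure_set1.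
apply: (@le_trans _ _ (\int[leb]_(t in D `\` [set t0]) (f \_ E) t)).
  apply: le_ge0_integral => t [Dt /eqP tt0]; rewrite g0//= patchE.
  by case: ifPn => [_|]; [exact: gf|rewrite notin_setE => nE; rewrite gE].
rewrite -integral_mkcondr; apply: le_subset_integral => //; exact: subIsetr.
Qed.

(** The dominating function [h] need not be measurable. Dominated convergence is run with the
    supremum of the sequence instead, which is measurable and lies below [k] times [h]. *)
Lemma limsup_integral_dom D (f : nat -> R -> \bar R) h (k t0 : R) : measurable D -> (0 < k)%R ->
  (forall n, measurable_fun D (f n)) -> (forall n t, D t -> 0 <= f n t) ->
  (forall t, D t -> t != t0 -> exists n0, forall n, (n0 <= n)%N -> f n t = 0) ->
  (forall n t, D t -> t != t0 -> f n t <= k%:E * h t) -> (forall t, 0 <= h t) ->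
  \int[leb]_(t in D) h t < +oo ->
  limn_esup (fun n => \int[leb]_(t in D) f n t) = 0.
Proof.
move=> mD k0 mf f0 fz fh h0 hoo.
pose D' := D `\` [set t0].
have mD' : measurable D' by exact: measurableD.
have DD' t : D' t -> D t by case.
have mf' n : measurable_fun D' (f n) by apply: measurable_funS (mf n).
pose g t := ereal_sup (range (f ^~ t)).
have fg n t : f n t <= g t by apply: ereal_sup_ubound; exists n.
have mg : measurable_fun D' g.
  have := measurable_fun_esups mf' 0%N; apply: eq_measurable_fun => t _.
  by rewrite /esups /sdrop /g; congr ereal_sup; apply/seteqP; split => _ [n _ <-]; exists n.
have ig : leb.-integrable D' g.
  have g0 t : D' t -> 0 <= g t by move=> [Dt _]; apply: (le_trans _ (fg 0%N t)); exact: f0.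
  have ki : 0 <= k^-1%:E by rewrite lee_fin invr_ge0 ltW.
  apply/integrableP; split => //.
  rewrite (@le_lt_trans _ _ (\int[leb]_(t in D') g t))//.
    by apply: le_ge0_integral => t Dt; rewrite abse_ge0 gee0_abs ?g0 ?lexx.
  rewrite -(@lte_pmul2l _ k^-1%:E) ?lte_fin ?invr_gt0//.
  rewrite -(@ge0_integralZl _ _ _ leb D' mD' _ mg _ g0 ki) gt0_muley ?lte_fin ?invr_gt0//.
  apply: le_lt_trans hoo; apply: (@le_trans _ _ (\int[leb]_(t in D') h t)).
    apply: le_ge0_integral => t Dt; rewrite mule_ge0 ?g0//=.
    rewrite -[leRHS]mul1e -(_ : k^-1%:E * k%:E = 1); last by rewrite -EFinM mulVf ?gt_eqF.
    rewrite -muleA; apply: lee_wpmul2l => //.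
    by apply: ge_ereal_sup => _ [n _ <-]; case: Dt => Dt /eqP tt0; exact: fh.
  by apply: le_subset_integral => // t /DD'.
have [_ _ H] : [/\ leb.-integrable D' (cst 0), \int[leb]_(t in D') `|f n t - cst 0 t| @[n --> \oo] --> 0 &
    \int[leb]_(t in D') f n t @[n --> \oo] --> \int[leb]_(t in D') (cst 0 t : \bar R)].
  apply: (@dominated_convergence _ _ R leb D' mD' f (cst 0) g) => //; last first.
  - by apply: aeW => t n [Dt _]; rewrite gee0_abs ?f0.
  - apply: aeW => t [Dt /eqP tt0]; have [n0 n0P] := fz t Dt tt0.
    by apply: cvg_near_cst; exists n0 => // n /= /n0P.
rewrite integral0 in H.
have E n : \int[leb]_(t in D) f n t = \int[leb]_(t in D') f n t.
  have N0 := lebesgue_measure_set1 t0.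
  exact: (@ge0_negligible_integral _ _ _ leb D [set t0] (f n) _ mD (mf n) (f0 n) N0).
rewrite (funext E) is_cvg_limn_esupE; first exact/cvg_lim.
by apply/cvg_ex; exists 0.
Qed.

Lemma limsup_integral_vanish D (f : nat -> R -> \bar R) (t0 : R) : measurable D ->
  (forall n, measurable_fun D (f n)) -> (forall n t, D t -> 0 <= f n t) ->
  (exists n0, forall n t, (n0 <= n)%N -> D t -> t != t0 -> f n t = 0) ->
  limn_esup (fun n => \int[leb]_(t in D) f n t) <= 0.
Proof.
move=> mD mf f0 [n0 fz]; apply: limn_esup_le; exists n0 => n n0n.
apply: (le_trans (@integral_le_off D set0 (f n \_ D) (f n) t0 mD (mf n) (f0 n) _ _ _)).
- by move=> t; rewrite patchE; case: ifPn => // /set_mem /f0.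
- by move=> t Dt tt0 _; exact: fz.
- by move=> t Dt; rewrite patchE mem_set.
- by rewrite !integral_set0.
Qed.

Variables (T : R) (F : nat -> R -> \bar R) (J : nat -> R -> \bar R).
Hypotheses (T0 : (0 < T)%R).
Hypotheses (F0 : forall q t, 0 <= F q t) (J01 : forall q t, 0 <= J q t <= 1).
Local Notation D := `[(T / 2)%R, T]%classic.
Hypotheses (mJF : forall q, measurable_fun D (fun t => J q t * F q t)).

Let JF0 q t : 0 <= J q t * F q t.
Proof. by rewrite mule_ge0//; case/andP: (J01 q t). Qed.

Let JF_le q t : J q t * F q t <= F q t.
Proof. by rewrite -[leRHS]mul1e; apply: lee_wpmul2r => //; case/andP: (J01 q t). Qed.

Lemma limsup_integral_from (tq : nat -> R) :
  (forall q t, (T / 2 < t)%R -> (t < tq q)%R -> J q t = 0) ->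
  limn_esup (fun q => \int[leb]_(t in D) (J q t * F q t)) <=
  limn_esup (fun q => \int[leb]_(t in `[tq q, T]) F q t).
Proof.
move=> Jz; apply: le_limn_esup; exists 0%N => q _.
apply: (@integral_le_off _ _ _ _ (T / 2)%R) => //.
move=> t /=; rewrite in_itv/= => /andP[t1 t2] tt0 tE; rewrite Jz ?mul0e//.
  by rewrite lt_neqAle eq_sym tt0.
by rewrite ltNge; apply/negP => h; apply: tE; rewrite in_itv/= h.
Qed.

(** The upper limits are monotone in [eps], so their limit at 0 exists, and a bound valid for every
    small [eps] passes to it. *)
Lemma limsup_integral_last :
  (forall eps : R, (0 < eps)%R -> exists q0, forall q t, (q0 <= q)%N ->
     (T / 2 <= t <= T - eps)%R -> J q t = 0) ->
  limn_esup (fun q => \int[leb]_(t in D) (J q t * F q t)) <=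
  lim (limn_esup (fun q => \int[leb]_(t in `[(T - eps)%R, T]) F q t) @[eps --> (0 : R)^'+]).
Proof.
move=> Jz; apply: lime_ge.
  apply: nondecreasing_at_right_is_cvge; apply: nearW => x e1 e2 _ _ e12.
  apply: le_limn_esup; exists 0%N => q _; apply: le_subset_integral => //.
  by move=> t /=; rewrite !in_itv/= => /andP[h ->]; rewrite andbT (le_trans _ h)// lerD2l lerN2.
near=> eps; have eps0 : (0 < eps)%R by near: eps; exact: nbhs_right_gt.
have [q0 q0P] := Jz _ eps0.
apply: le_limn_esup; exists q0 => q qq.
apply: (@integral_le_off _ _ _ _ 0%R) => //.
move=> t /=; rewrite in_itv/= => /andP[t1 t2] _ tE; rewrite (q0P q t) ?mul0e// t1/=.
by rewrite leNgt; apply/negP => h; apply: tE; rewrite in_itv/= t2 andbT ltW.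
Unshelve. all: by end_near. Qed.

End time_integrals.

(** * From the integrals in (4) to the vorticity integral *)

Section vorticity_criterion.
Variable R : realType.
Local Notation leb := (@lebesgue_measure R).
(* In the application [N q t], [V q t], [b q t] and [w] are the L^r norm of u_q,
   the L^oo norm of Delta_q (curl u), [q <= Q_r t] and [3 / r]. *)
Variables (D : set R) (N V : nat -> R -> \bar R) (b : nat -> R -> bool).
Variables (C w l c m : R).
Hypotheses (mD : measurable D) (C0 : 0 < C) (l1 : 1 <= l) (c0 : 0 < c) (m0 : 0 < m).
Let theta := c * m.
Let J q t : \bar R := ((b q t)%:R)%:E.
Let lam (q : nat) : R := lambda R q%:Z.
Let x q t : \bar R := ((lam q `^ (-1 + w))%:E * N q t)%E.
Let Y q t := poweR ((lam q `^ (-1 + 2 / l + w))%:E * N q t)%E l.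
Hypotheses (N0 : forall q t, (0 <= N q t)%E) (V0 : forall q t, (0 <= V q t)%E).
Hypotheses (mN : forall q, measurable_fun D (N q)) (mV : forall q, measurable_fun D (V q)).
Hypothesis mJ : forall q, measurable_fun D (J q).
Hypothesis VN : forall q t, D t -> (V q t <= (C * lam q `^ (1 + w))%:E * N q t)%E.
Hypothesis bx : forall q p t, (theta%:E <= x p t)%E -> (q <= p)%N -> b q t.
Hypothesis xb : forall q t, (0 < q)%N -> b q t -> exists2 p, (q <= p)%N & (theta%:E <= x p t)%E.

Let lam0 q : 0 < lam q. Proof. exact: lambda_gt0. Qed.
Let theta0 : 0 < theta. Proof. exact: mulr_gt0. Qed.
Let l0 : 0 < l. Proof. exact: lt_le_trans l1. Qed.
Let J0 q t : (0 <= J q t)%E. Proof. by rewrite lee_fin. Qed.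
Let x0 q t : (0 <= x q t)%E. Proof. by rewrite mule_ge0 ?lee_fin ?powR_ge0. Qed.
Let Y0 q t : (0 <= Y q t)%E. Proof. exact: poweR_ge0. Qed.

(** The extra power lambda_q^(2/l) in (4) becomes lambda_q^2 after raising to the power [l], which
    is the weight of x_q in the vorticity bound. *)
Let YE q t : Y q t = ((lam q ^+ 2)%:E * poweR (x q t) l)%E.
Proof.
have -> : Y q t = poweR ((lam q `^ (2 / l))%:E * x q t)%E l.
  rewrite /Y /x muleA -EFinM -powRD; last by rewrite (gt_eqF (lam0 q)) implybT.
  by rewrite (_ : 2 / l + (-1 + w) = -1 + 2 / l + w)//; ring.
rewrite poweRM ?lee_fin ?powR_ge0 ?x0//.
by rewrite poweR_EFin -powRrM divfK ?gt_eqF// powR_mulrn// ltW.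
Qed.

Let mY q : measurable_fun D (Y q).
Proof. by apply: (measurableT_comp (measurable_poweR l)); apply: emeasurable_funM. Qed.

Let mJY q : measurable_fun D (fun t => J q t * Y q t)%E.
Proof. exact: emeasurable_funM. Qed.

Let K1 : R := (theta `^ (l - 1))^-1.
Let K10 : 0 < K1. Proof. by rewrite invr_gt0 powR_gt0. Qed.

(** If x_q <= theta the last term suffices; otherwise x_q <= theta^(1-l) x_q^l because l >= 1. *)
Let V_le q t : D t -> (J q t * V q t <=
  (C * K1)%:E * (J q t * Y q t) + (C * lam q ^+ 2 * theta)%:E * J q t)%E.
Proof.
move=> Dt; rewrite /J; case: (b q t); last by rewrite !mul0e !mule0 adde0.
rewrite !mul1e mule1; apply: (le_trans (VN q Dt)).
have -> : ((C * lam q `^ (1 + w))%:E * N q t = (C * lam q ^+ 2)%:E * x q t)%E.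
  rewrite /x muleA -EFinM; congr (_%:E * _)%E; rewrite -mulrA; congr (_ * _).
  rewrite -powR_mulrn ?(ltW (lam0 q))// -powRD; last by rewrite (gt_eqF (lam0 q)) implybT.
  by congr (_ `^ _); ring.
have L2 : 0 < lam q ^+ 2 by rewrite exprn_gt0.
rewrite YE; case: (x q t) (x0 q t) => [y||]// y0; last first.
  have e1 : ((lam q ^+ 2)%:E * +oo = +oo :> \bar R)%E by rewrite gt0_muley ?lte_fin.
  have e2 : ((C * K1)%:E * +oo = +oo :> \bar R)%E by rewrite gt0_muley ?lte_fin ?mulr_gt0.
  by rewrite poweRyr ?(gt_eqF l0)// e1 e2 addye// leey.
rewrite poweR_EFin -!EFinM -EFinD lee_fin.
rewrite (_ : _ + _ = C * lam q ^+ 2 * (K1 * y `^ l + theta)); last by ring.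
rewrite ler_wpM2l//; first by rewrite mulr_ge0 ?ltW.
have yl : 0 <= y `^ l by exact: powR_ge0.
have [yt|ty] := leP y theta.
  by rewrite (le_trans yt)// lerDr mulr_ge0// ltW.
have y1 : 0 < y by exact: lt_trans ty.
apply: (@le_trans _ _ (K1 * y `^ l)); last by rewrite lerDl ltW.
rewrite /K1 ler_pdivlMl ?powR_gt0// -(mulr_powRB1 (ltW y1) l0) mulrC ler_pM2l//.
by rewrite ge0_ler_powR ?nnegrE ?subr_ge0 ?(ltW y1) ?(ltW theta0) ?(ltW ty).
Qed.

Let K2 p : R := (lam p ^+ 2 * theta `^ l)^-1.
Let K20 p : 0 < K2 p. Proof. by rewrite invr_gt0 mulr_gt0 ?exprn_gt0 ?powR_gt0. Qed.

(** The pointwise form of Chebyshev's inequality; the indicator is 1 since x_p >= theta forces p <=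
    Q_r. *)
Let x_JY p t : (theta%:E <= x p t)%E -> (1 <= (K2 p)%:E * (J p t * Y p t))%E.
Proof.
move=> tx; rewrite /J (bx tx (leqnn p)) mul1e YE.
have h : ((theta `^ l)%:E <= poweR (x p t) l)%E.
  rewrite -poweR_EFin; apply: gt0_ler_poweR => //; first exact: ltW.
  - by rewrite in_itv/= leey andbT lee_fin ltW.
  - by rewrite in_itv/= leey andbT x0.
have -> : (1 = (K2 p)%:E * ((lam p ^+ 2)%:E * (theta `^ l)%:E))%E.
  by rewrite -!EFinM /K2 mulVf// gt_eqF// mulr_gt0 ?exprn_gt0 ?powR_gt0.
apply: lee_wpmul2l; first by rewrite lee_fin ltW.
by apply: lee_wpmul2l => //; rewrite lee_fin sqr_ge0.
Qed.

(** When q <= Q_r, some p >= q has x_p >= theta, and the single term of index p - q already exceeds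
    1. *)
Let J_le q t : (0 < q)%N -> (J q t <= \sum_(0 <= k <oo) ((K2 (q + k))%:E * (J (q + k)%N t * Y (q + k)%N t)))%E.
Proof.
move=> q0; have u0 k : (0 <= (K2 (q + k))%:E * (J (q + k)%N t * Y (q + k)%N t))%E.
  by apply: mule_ge0; [rewrite lee_fin ltW|exact: mule_ge0].
case bq : (b q t); last by rewrite /J bq; apply: nneseries_ge0 => k _ _; exact: u0.
have [p qp /x_JY h] := xb q0 bq; rewrite {1}/J bq.
apply: (le_trans h); rewrite -(subnKC qp).
apply: (@le_trans _ _ (\sum_(0 <= k < (p - q).+1) ((K2 (q + k))%:E * (J (q + k)%N t * Y (q + k)%N t)))%E).
  by rewrite big_nat_recr//= leeDr// sume_ge0.
by apply: nneseries_lim_ge => k _ _; exact: u0.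
Qed.

Lemma limsup_vort_le : (limn_esup (fun q => \int[leb]_(t in D) (J q t * Y q t)) <=
    ((6 * C)^-1 * c `^ l * m `^ (l - 1))%:E)%E ->
  (limn_esup (fun q => \int[leb]_(t in D) (J q t * V q t)) <= c%:E)%E.
Proof.
move=> H; set M := (6 * C)^-1 * c `^ l * m `^ (l - 1) in H.
have M0 : 0 < M by rewrite !mulr_gt0 ?powR_gt0// invr_gt0 mulr_gt0.
(* An upper limit at most [M] bounds the terms only by numbers larger than [M]; [2 * M] is
   chosen. *)
have /limn_esup_lt[q0 q0P] : (limn_esup (fun q => \int[leb]_(t in D) (J q t * Y q t)) < (2 * M)%:E)%E.
  by apply: le_lt_trans H _; rewrite lte_fin ltr_pMl// ltr1n.
apply: limn_esup_le; exists (maxn q0 1) => q; rewrite geq_max => /andP[qq0 q1].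
have JY0 p t : D t -> (0 <= J p t * Y p t)%E by move=> _; exact: mule_ge0.
have k1 : 0 <= C * K1 by rewrite mulr_ge0 ?ltW.
have k2 : 0 <= C * lam q ^+ 2 * theta 
  by apply: mulr_ge0; [apply: mulr_ge0; [exact: ltW|exact: sqr_ge0]|exact: ltW].
have A1 : (\int[leb]_(t in D) (J q t * V q t) <= (C * K1)%:E * \int[leb]_(t in D) (J q t * Y q t) +
    (C * lam q ^+ 2 * theta)%:E * \int[leb]_(t in D) J q t)%E.
  have k1e : (0 <= (C * K1)%:E)%E by rewrite lee_fin.
  have k2e : (0 <= (C * lam q ^+ 2 * theta)%:E)%E by rewrite lee_fin.
  rewrite -(@ge0_integralZl _ _ _ leb D mD _ (mJY q) _ (JY0 q) k1e).
  rewrite -(@ge0_integralZl _ _ _ leb D mD _ (mJ q) _ (fun t _ => J0 q t) k2e).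
  rewrite -ge0_integralD//; last 4 first.
  - by move=> t Dt; apply: mule_ge0; [rewrite lee_fin|exact: JY0].
  - by apply: emeasurable_funM; [exact: measurable_cst|exact: mJY].
  - by move=> t Dt; apply: mule_ge0; [rewrite lee_fin|exact: J0].
  - by apply: emeasurable_funM; [exact: measurable_cst|exact: mJ].
  apply: le_ge0_integral => t Dt; rewrite V_le// andbT; exact: mule_ge0.
have A2 : (\int[leb]_(t in D) J q t <= (2 * (2 * M * K2 q))%:E)%E.
  apply: (@le_trans _ _ (\int[leb]_(t in D) \sum_(0 <= k <oo) ((K2 (q + k))%:E * (J (q + k)%N t * Y (q + k)%N t)))%E).
    by apply: le_ge0_integral => t Dt; rewrite J0 J_le.
  rewrite integral_nneseries//; last 2 first.
  - by move=> k; apply: emeasurable_funM; [exact: measurable_cst|exact: mJY].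
  - by move=> k t Dt; apply: mule_ge0; [rewrite lee_fin ltW|exact: JY0].
  (* The terms decay like 4^-k because [K2 (q + k)] carries lambda_(q+k)^-2; they are compared with
     twice 2^-(k+1), whose sum is 2. *)
  apply: (@le_trans _ _ (\sum_(0 <= k <oo) (2 * (2 * M * K2 q) / (2 ^ k.+1)%:R)%:E)%E); last first.
    by apply: epsilon_trick0; apply: mulr_ge0 => //; apply: mulr_ge0; [apply: mulr_ge0 => //|]; exact: ltW.
  apply: lee_nneseries => k _; first by move=> _; apply: integral_ge0 => t Dt; apply: mule_ge0; [rewrite lee_fin ltW|exact: JY0].
  have k2e : (0 <= (K2 (q + k))%:E)%E by rewrite lee_fin ltW.
  rewrite (@ge0_integralZl _ _ _ leb D mD _ (mJY (q + k)%N) _ (JY0 (q + k)%N) k2e).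
  apply: (@le_trans _ _ ((K2 (q + k))%:E * (2 * M)%:E)%E).
    by apply: lee_wpmul2l; [rewrite lee_fin ltW|apply/ltW/q0P; rewrite (leq_trans qq0)// leq_addr].
  rewrite -EFinM lee_fin.
  have -> : K2 (q + k) = K2 q * (2 ^+ k)^-1 * (2 ^+ k)^-1.
    rewrite /K2 /lam !lambdaX exprD; field.
    by rewrite !expf_neq0// gt_eqF// powR_gt0.
  rewrite natrX exprS invfM.
  rewrite (_ : 2 * (2 * M * K2 q) * _ = 2 * M * K2 q * (2 ^+ k)^-1); last by field; rewrite expf_neq0.
  rewrite (_ : _ * (2 * M) = 2 * M * K2 q * (2 ^+ k)^-1 * (2 ^+ k)^-1); last by ring.
  rewrite ler_piMr//.
    apply: mulr_ge0; last by rewrite invr_ge0 exprn_ge0.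
    by apply: mulr_ge0; [apply: mulr_ge0 => //|]; exact: ltW.
  by rewrite invf_le1 ?exprn_gt0// exprn_ege1// ler1n.
apply: (le_trans A1).
apply: (@le_trans _ _ ((C * K1)%:E * (2 * M)%:E + (C * lam q ^+ 2 * theta)%:E * (2 * (2 * M * K2 q))%:E)%E).
  by apply: leeD; apply: lee_wpmul2l => //; exact/ltW/q0P.
(* The two terms are 2 and 4 times C M theta^(1-l), together exactly [c] by the choice of [M]. *)
rewrite -!EFinM -EFinD lee_fin le_eqVlt; apply/orP; left; apply/eqP.
have tE : theta `^ (l - 1) = c `^ (l - 1) * m `^ (l - 1) by rewrite powRM ?ltW.
have tl : theta `^ l = theta * theta `^ (l - 1) by rewrite mulr_powRB1 ?ltW.
have cl : c `^ l = c * c `^ (l - 1) by rewrite mulr_powRB1 ?ltW.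
have lq : lam q != 0 by rewrite gt_eqF.
have cp : c `^ (l - 1) != 0 by rewrite gt_eqF// powR_gt0.
have mp : m `^ (l - 1) != 0 by rewrite gt_eqF// powR_gt0.
rewrite /K1 /K2 tl tE /M cl; field.
by rewrite lq cp mp !gt_eqF.
Qed.

End vorticity_criterion.

Section wavenumber_in_time.
Variables (R : realType) (chi : R3 R -> R) (r : \bar R) (theta T : R) (u : R -> vfield R).
Hypotheses (hchi : cutoff chi) (r2 : (2%:E <= r)%E) (theta0 : 0 < theta) (T0 : 0 < T).
Hypothesis uC : in_Cw_L2 T u.
Local Notation D := `[T / 2, T]%classic.
Local Notation Q t := (Q_r chi r theta (u t)).
Local Notation vort q t := (vLnorm +oo%E (Delta_curl chi q (u t))).
Local Notation crit l q t :=
  ((lambda R q `^ (-1 + 2 / l + three_over r))%:E * vLnorm r (Delta chi q (u t)))%E.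

Lemma half_itv t : D t -> 0 <= t <= T.
Proof.
rewrite /= in_itv/= => /andP[t1 ->]; rewrite andbT (le_trans _ t1)//.
by rewrite divr_ge0// ltW.
Qed.

Lemma u_l2 t : 0 <= t <= T -> forall i, l2 (u t i).
Proof. by move=> tT; apply: vLnorm2_l2; exact: uC.1. Qed.

Lemma ind_le_itv (q : int) (x : \bar R) : (0 <= ind_le q x <= 1)%E.
Proof. by rewrite /ind_le; move: (q%:~R%:E <= x)%E => []; rewrite !lee_fin ?ler01 ?lexx. Qed.

Lemma ind_le0 (q : int) (x : \bar R) : (x < q%:~R%:E)%E -> ind_le q x = 0%E.
Proof. by move=> h; rewrite /ind_le leNgt h. Qed.

Lemma ind_le_small (q0 q : nat) (f : vfield R) :
  (forall p, (q0 <= p)%N -> (block_size chi r p f < theta%:E)%E) -> (q0 < q)%N ->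
  ind_le q%:Z (Q_r chi r theta f) = 0%E.
Proof.
move=> H qq; apply: ind_le0; rewrite ltNge; apply/negP.
move=> /le_Q_r_witness-/(_ (leq_ltn_trans (leq0n _) qq))[p qp].
by rewrite leNgt H// (leq_trans (ltnW qq)).
Qed.

Let measurable_D (f : vfield R -> \bar R) :
  measurable_fun setT (fun s => f (u (clamp T s))) -> measurable_fun D (fun t => f (u t)).
Proof.
move=> mf; apply: (@eq_measurable_fun _ _ _ _ _ (fun s => f (u (clamp T s)))); last exact: measurable_funTS.
by move=> t /set_mem /half_itv /clamp_id ->.
Qed.

Lemma measurable_block_half (q : nat) : measurable_fun D (fun t => vLnorm r (Delta chi q%:Z (u t))).
Proof.
apply: (measurable_D (f := fun f => vLnorm r (Delta chi q%:Z f))).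
exact: (measurable_block hchi r2 (ltW T0) uC).
Qed.

Lemma measurable_vort_half (q : nat) : measurable_fun D (fun t => vort q%:Z t).
Proof.
apply: (measurable_D (f := fun f => vLnorm +oo%E (Delta_curl chi q%:Z f))).
exact: (measurable_block_curl hchi (ltW T0) uC).
Qed.

Lemma measurable_ind_half (q : nat) : measurable_fun D (fun t => ind_le q%:Z (Q t)).
Proof.
apply: (measurable_D (f := fun f => ind_le q%:Z (Q_r chi r theta f))).
have mA := measurable_le_Q_r hchi r2 (ltW T0) uC q theta.
rewrite (_ : (fun s => _) = EFin \o \1_[set s | ((q%:Z)%:~R%:E <= Q (clamp T s))%E]).
  by apply/measurable_EFinP; exact: measurable_indic.
apply/funext => s /=; rewrite /ind_le indicE; congr ((nat_of_bool _)%:R%:E).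
by apply/idP/idP => [h|/set_mem//]; exact: mem_set.
Qed.

Lemma measurable_crit_half (l : R) (q : nat) : measurable_fun D (fun t => poweR (crit l q%:Z t) l).
Proof.
by apply: (measurableT_comp (measurable_poweR l)); apply: emeasurable_funM => //; exact: measurable_block_half.
Qed.

Lemma crit_ge0 (l : R) (q : int) t : (0 <= crit l q t)%E.
Proof. by rewrite mule_ge0 ?lee_fin ?powR_ge0 ?vLnorm_ge0. Qed.

(** If [time_set] is empty, the default value T/2 contradicts the two hypotheses; otherwise an
    element of the set lies beyond [t]. *)
Lemma ind_le_before_time_T (q : nat) t : T / 2 < t -> t < time_T T (fun t => Q t) q%:Z -> ind_le q%:Z (Q t) = 0%E.
Proof.
move=> t1; rewrite /time_T; case: asboolP => [ne tq|_ /(lt_trans t1)]; last by rewrite ltxx.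
have [s [_ sQ] ts] := sup_gt ne tq.
by apply: ind_le0; apply: sQ; rewrite t1.
Qed.

End wavenumber_in_time.

(** * The eight conditions *)

Theorem theorem1p3 (R : realType) (chi : R * R * R -> R) (hchi : cutoff chi) :
  exists2 kappa : R, 0 < kappa &
  forall (nu mu T : R) (u0 b0 : vfield R) (u b : R -> vfield R)
         (r : \bar R) (c : R),
  0 < nu -> 0 < mu -> 0 < T ->
  mhd_weak_solution nu mu T u0 b0 u b ->
  regular_on `]0, T[ u b ->
  (2%:E <= r)%E -> (r < 6%:E)%E \/ vanishes T b ->
  0 < c ->
  let leb := @lebesgue_measure R in
  let m := Num.min nu mu in
  let Q t := Q_r chi r (c * m) (u t) in
  let vort (q : int) t := vLnorm +oo%E (Delta_curl chi q (u t)) in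
  let crit (l : R) (q : int) t :=
    ((lambda R q `^ (-1 + 2 / l + three_over r))%:E
       * vLnorm r (Delta chi q (u t)))%E in
  (limn_esup (fun q : nat =>
     \int[leb]_(t in `[time_T T Q q%:Z, T]) vort q%:Z t) <= c%:E)%E
  \/
  (lim (limn_esup (fun q : nat =>
     \int[leb]_(t in `[(T - eps)%R, T]) vort q%:Z t)
       @[eps --> (0 : R)^'+]) <= c%:E)%E
  \/
  (\int[leb]_(t in `[0%R, T])
     ereal_sup [set vort q t |
       q in [set q : int | (-1 <= q)%R /\ q%:~R%:E <= Q t]] < +oo)%E
  \/
  (exists2 l : R, 1 <= l &
     (limn_esup (fun q : nat =>
        \int[leb]_(t in `[0%R, T])
          (ind_le q%:Z (Q t) * poweR (crit l q%:Z t) l))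
      <= (kappa * c `^ l * m `^ (l - 1))%:E)%E)
  \/
  (exists2 l : R, 1 <= l &
     (limn_esup (fun q : nat =>
        \int[leb]_(t in `[time_T T Q q%:Z, T]) poweR (crit l q%:Z t) l)
      <= (kappa * c `^ l * m `^ (l - 1))%:E)%E)
  \/
  (exists2 l : R, 1 <= l &
     (lim (limn_esup (fun q : nat =>
        \int[leb]_(t in `[(T - eps)%R, T]) poweR (crit l q%:Z t) l)
          @[eps --> (0 : R)^'+])
      <= (kappa * c `^ l * m `^ (l - 1))%:E)%E)
  \/
  (exists2 l : R, 1 <= l &
     (\int[leb]_(t in `[0%R, T])
        poweR (besov chi (-1 + 2 / l + three_over r) r
                 (lp_low chi (Q t) (u t))) l < +oo)%E)
  \/
  (limf_esup (fun t =>
     besov chi (-1 + three_over r) r (vsub (u t) (u T))) T^'-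
   < (c / 2 * m)%:E)%E ->
  (limn_esup (fun q : nat =>
     \int[leb]_(t in `[(T / 2)%R, T]) (ind_le q%:Z (Q t) * vort q%:Z t))
   <= c%:E)%E.
Proof.
have B0 := bernstein_const_gt0 R.
(* The constant of [limsup_vort_le], with C the constant of [vort_le]. *)
exists (6 * bernstein_const R)^-1; first by rewrite invr_gt0 mulr_gt0.
move=> nu mu T u0 b0 u b r c nu0 mu0 T0 sol [s s2 [Hs _]] r2 _ c0 leb m Q vort crit.
have m0 : 0 < m by rewrite /m lt_min nu0 mu0.
have theta0 : 0 < c * m by exact: mulr_gt0.
have uC := mhd_Cw_u sol.
have ul2 := u_l2 uC.
pose D := `[T / 2, T]%classic : set R.
have mD : measurable D by exact: measurable_itv.
have DT t : D t -> 0 <= t <= T by exact: half_itv.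
have DI : D `<=` `[0, T]%classic by move=> t /DT; rewrite /= in_itv.
have T2 : 0 < T / 2 by rewrite divr_gt0.
have T2T : T / 2 < T by rewrite ltr_pdivrMr// ltr_pMr// ltr1n.
have mvort q : measurable_fun D (fun t => vort q%:Z t) := measurable_vort_half hchi T0 uC q.
have mind (q : nat) : measurable_fun D (fun t => ind_le q%:Z (Q t)) := measurable_ind_half (c * m) hchi r2 T0 uC q.
have mcrit l (q : nat) : measurable_fun D (fun t => poweR (crit l q%:Z t) l) := measurable_crit_half hchi r2 T0 uC l q.
have mJV (q : nat) : measurable_fun D (fun t => ind_le q%:Z (Q t) * vort q%:Z t)%E by exact: emeasurable_funM.
have mJY l (q : nat) : measurable_fun D (fun t => ind_le q%:Z (Q t) * poweR (crit l q%:Z t) l)%E.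
  exact: emeasurable_funM.
have vort0 q t : (0 <= vort q t)%E by exact: vLnorm_ge0.
have crit0 l q t : (0 <= poweR (crit l q t) l)%E by exact: poweR_ge0.
have J01 (q : nat) t : (0 <= ind_le q%:Z (Q t) <= 1)%E by exact: ind_le_itv.
have J0 (q : nat) t : (0 <= ind_le q%:Z (Q t))%E by case/andP: (J01 q t).
have small a b' : 0 < a -> a <= b' -> b' < T -> exists q0, forall (q : nat) t, (q0 <= q)%N -> a <= t <= b' ->
    ind_le q%:Z (Q t) = 0%E.
  move=> a0 ab bT; have [q0 q0P] := blocks_small hchi r2 s2 uC.1 Hs theta0 a0 ab bT.
  exists q0.+1 => q t qq tab; apply: ind_le_small qq => p qp; exact: q0P.
have vanish t : D t -> t != T -> exists q0, forall q : nat, (q0 <= q)%N -> ind_le q%:Z (Q t) = 0%E.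
  rewrite /D /= in_itv/= => /andP[t1 t2] tT.
  have tT' : t < T by rewrite lt_neqAle tT.
  have [q0 q0P] := small t t (lt_le_trans T2 t1) (lexx t) tT'.
  by exists q0 => q qq; apply: q0P; rewrite // lexx.
have last (eps : R) : 0 < eps -> exists q0, forall (q : nat) t, (q0 <= q)%N -> T / 2 <= t <= T - eps ->
    ind_le q%:Z (Q t) = 0%E.
  move=> e0; have [h|h] := leP (T / 2) (T - eps).
    have eT : T - eps < T by rewrite ltrBlDr ltrDl.
    by have [q0 q0P] := small _ _ T2 h eT; exists q0.
  by exists 0%N => q t _ /andP[h1 h2]; have := le_trans h1 h2; rewrite leNgt h.
have from (q : nat) t : T / 2 < t -> t < time_T T Q q%:Z -> ind_le q%:Z (Q t) = 0%E.
  exact: ind_le_before_time_T.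
have goal4 l : 1 <= l ->
  (limn_esup (fun q : nat => \int[leb]_(t in D) (ind_le q%:Z (Q t) * poweR (crit l q%:Z t) l)) <=
   ((6 * bernstein_const R)^-1 * c `^ l * m `^ (l - 1))%:E)%E ->
  (limn_esup (fun q : nat => \int[leb]_(t in D) (ind_le q%:Z (Q t) * vort q%:Z t)) <= c%:E)%E.
  move=> l1; apply: (@limsup_vort_le R D (fun q t => vLnorm r (Delta chi q%:Z (u t))) (fun q t => vort q%:Z t)
    (fun q t => (q%:Z%:~R%:E <= Q t)%E) (bernstein_const R) (three_over r) l c m) => //.
  - by move=> q t; exact: vLnorm_ge0.
  - by move=> q; exact: (measurable_block_half hchi r2 T0 uC).
  - by move=> q t /DT/ul2 tl2; exact: vort_le.
  - by move=> q p t h qp; exact: (block_size_le_Q_r h qp).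
  - by move=> q t q0 h; exact: (le_Q_r_witness q0 h).
move=> [H1|[H2|[H3|[[l l1 H4]|[[l l1 H5]|[[l l1 H6]|[[l l1 H7]|H8]]]]]]].
- apply: le_trans H1; exact: (limsup_integral_from (F := fun q t => vort q%:Z t) (J := fun q t => ind_le q%:Z (Q t))).
- apply: le_trans H2; exact: (limsup_integral_last (F := fun q t => vort q%:Z t) (J := fun q t => ind_le q%:Z (Q t))).
- pose h t := ereal_sup [set vort q t | q in [set q : int | (-1 <= q)%R /\ (q%:~R%:E <= Q t)%E]].
  (* The index 0 always belongs to the set, so the supremum is over a nonempty set of nonnegative
     numbers. *)
  have Q0 t : (((0%N)%:Z)%:~R%:E <= Q t)%E by apply/le_Q_r.
  have h0 t : (0 <= h t)%E.
    by apply: (le_trans (vort0 0 t)); apply: ereal_sup_ubound; exists 0.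
  rewrite (@limsup_integral_dom R D (fun q t => (ind_le q%:Z (Q t) * vort q%:Z t)%E) h 1 T) ?lee_fin ?(ltW c0)//.
  + by move=> q t _; exact: mule_ge0.
  + move=> t Dt tT; have [q0 q0P] := vanish t Dt tT.
    by exists q0 => q qq; rewrite (q0P q qq) mul0e.
  + move=> q t _ _; rewrite mul1e /ind_le; case qQ : ((q%:Z)%:~R%:E <= Q t)%E; last by rewrite mul0e.
    by rewrite mul1e; apply: ereal_sup_ubound; exists q%:Z.
  + apply: le_lt_trans H3; apply: (le_subset_integral DI) => t _; exact: h0.
- apply: (goal4 l l1); apply: le_trans H4; apply: le_limn_esup; exists 0%N => q _.
  by apply: (le_subset_integral DI) => t _; exact: mule_ge0.
- apply: (goal4 l l1); apply: le_trans H5.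
  exact: (limsup_integral_from (F := fun q t => poweR (crit l q%:Z t) l) (J := fun q t => ind_le q%:Z (Q t))).
- apply: (goal4 l l1); apply: le_trans H6.
  exact: (limsup_integral_last (F := fun q t => poweR (crit l q%:Z t) l) (J := fun q t => ind_le q%:Z (Q t))).
- apply: (goal4 l l1).
  have l0 : 0 < l by exact: lt_le_trans l1.
  set sg := -1 + 2 / l + three_over r in H7.
  have sg1 : -1 <= sg.
    have /andP[w0 _] := three_over_ge0 r2.
    by rewrite /sg -addrA lerDl addr_ge0// divr_ge0// (ltW l0).
  pose h t := poweR (besov chi sg r (lp_low chi (Q t) (u t))) l.
  (* Under (7) the upper limit in (4) is 0, by domination: the 3 of [block_le_besov_low] becomes
     [3 ^ l]. *)
  apply: (@le_trans _ _ (0%:E : \bar R)); last first.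
    by rewrite lee_fin !mulr_ge0 ?powR_ge0// invr_ge0 mulr_ge0// ltW.
  rewrite le_eqVlt; apply/orP; left; apply/eqP.
  apply: (@limsup_integral_dom R D (fun q t => (ind_le q%:Z (Q t) * poweR (crit l q%:Z t) l)%E) h (3 `^ l) T) => //.
  + by move=> q t _; exact: mule_ge0.
  + move=> t Dt tT; have [q0 q0P] := vanish t Dt tT.
    by exists q0 => q qq; rewrite (q0P q qq) mul0e.
  + move=> q t Dt tT; rewrite /ind_le; case qQ : ((q%:Z)%:~R%:E <= Q t)%E; last first.
      by rewrite mul0e mule_ge0 ?lee_fin ?powR_ge0// poweR_ge0.
    have tl2 := ul2 t (DT t Dt).
    (* For t < T the high blocks lie below the threshold, so Q_r is a natural number [n] and the
       results on truncations apply. *)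
    have [q0 q0P] : exists q0 : nat, forall p, (q0 <= p)%N -> (block_size chi r p (u t) < (c * m)%:E)%E.
      move: Dt; rewrite /D /= in_itv/= => /andP[t1 t2].
      have tT' : t < T by rewrite lt_neqAle tT.
      have [q0 q0P] := blocks_small hchi r2 s2 uC.1 Hs theta0 (lt_le_trans T2 t1) (lexx t) tT'.
      by exists q0 => p pp; apply: q0P; rewrite // lexx.
    have [n _ Qn'] := Q_r_nat q0P; have Qn : Q t = n%:R%:E := Qn'; rewrite /h Qn.
    have qn : (q <= n)%N by move: qQ; rewrite Qn lee_fin ler_nat.
    have B := block_le_besov_low hchi r2 sg1 tl2 qn.
    have b0' : (0 <= besov chi sg r (lp_low chi n%:R%:E (u t)))%E.
      by apply: le_trans (besov_ge chi r sg _ 0); rewrite mule_ge0 ?lee_fin ?powR_ge0 ?vLnorm_ge0.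
    rewrite mul1e -poweR_EFin -poweRM//; apply: gt0_ler_poweR; rewrite ?in_itv/= ?leey ?andbT ?(ltW l0)//.
    * exact: crit_ge0.
    * by rewrite mule_ge0.
  + by move=> t; exact: poweR_ge0.
  + apply: le_lt_trans H7; apply: (le_subset_integral DI) => t _; exact: poweR_ge0.
(* On a left neighbourhood [V] of [T] the distance to u(T) stays at most [k] < c m / 2. A fixed time
   t0 in it is compared with every later t: two distances cost 2k, and the high blocks at t0 fit
   into the remaining room. *)
- move: H8 => /ereal_inf_lt[_ [V TV <-]].
  set E := (X in (ereal_sup X < _)%E) => EV.
  have [dl dl0 dlP] : exists2 dl : R, 0 < dl & forall t, T - dl < t -> t < T -> V t.
    have [dl /= dl0 H] := TV; exists dl => // t t1 t2; apply: H => //=.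
    by rewrite gtr0_norm ?subr_gt0// ltrBlDl -ltrBlDr.
  pose t0 := Num.max (T / 2) (T - dl / 2).
  have t0T : t0 < T by rewrite gt_max T2T ltrBlDr ltrDl divr_gt0.
  have t02 : T / 2 <= t0 by rewrite le_max lexx.
  have Vt t : t0 <= t -> t < T -> V t.
    move=> h1 h2; apply: dlP => //; apply: lt_le_trans h1; rewrite lt_max; apply/orP; right.
    by rewrite ltrD2l ltrN2 ltr_pdivrMr// ltr_pMr// ltr1n.
  pose bs t := besov chi (-1 + three_over r) r (vsub (u t) (u T)).
  have bsV t : V t -> (bs t <= ereal_sup E)%E by move=> Vt'; apply: ereal_sup_ubound; exists t.
  have bs0 t : (0 <= bs t)%E.
    by apply: le_trans (besov_ge chi r _ _ 0); rewrite mule_ge0 ?lee_fin ?powR_ge0 ?vLnorm_ge0.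
  have E0 : (0 <= ereal_sup E)%E by apply: le_trans (bs0 t0) (bsV _ (Vt _ _ _)).
  case EE : (ereal_sup E) EV bsV E0 => [k||]// EV bsV E0.
  (* The room left below the threshold is positive because of the strict inequality with c / 2 in
     (8). *)
  have k2 : 0 < c * m - 2 * k by move: EV; rewrite lte_fin; lra.
  have [q1 q1P] := blocks_small hchi r2 s2 uC.1 Hs k2 (lt_le_trans T2 t02) (lexx t0) t0T.
  have [q2 q2P] := small _ _ T2 t02 t0T.
  apply: (@le_trans _ _ (0%:E : \bar R)); last by rewrite lee_fin ltW.
  apply: (@limsup_integral_vanish R D (fun q t => (ind_le q%:Z (Q t) * vort q%:Z t)%E) T) => //.
    by move=> q t _; exact: mule_ge0.
  exists (maxn q1.+1 q2) => q t; rewrite geq_max => /andP[qq1 qq2] Dt tT.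
  have tb : 0 <= t <= T by exact: DT.
  move: (Dt); rewrite /D /= in_itv/= => /andP[t1 t2].
  have tT' : t < T by rewrite lt_neqAle tT.
  have [tt0|tt0] := leP t t0; first by rewrite q2P ?mul0e ?t1.
  have t0b : 0 <= t0 <= T by rewrite (le_trans (ltW T2) t02) ltW.
  have Tb : 0 <= T <= T by rewrite (ltW T0) lexx.
  rewrite (@ind_le_small _ _ _ (c * m) q1 q) ?mul0e// => p pq.
  apply: (le_lt_trans (block_size_triangle hchi r2 p (ul2 t tb) (ul2 T Tb) (ul2 t0 t0b))).
  apply: (@le_lt_trans _ _ (k%:E + k%:E + block_size chi r p (u t0))%E).
    by apply: leeD => //; apply: leeD; apply: bsV; apply: Vt => //; exact: ltW.
  have := q1P p t0 pq (_ : t0 <= t0 <= t0); rewrite lexx => /(_ isT).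
  case: (block_size chi r p (u t0)) (block_size_ge0 chi r p (u t0)) => [z||]// _.
  by rewrite -!EFinD !lte_fin; lra.
Qed.
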